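(* Let $\Omega\subset\mathbb{R}^2$ be a maximizer of the Gaussian perimeter among convex sets, i.e. $\Omega$ is convex and $P_{\gamma_2}(\Omega)\ge P_{\gamma_2}(D)$ for every convex set $D\subset\mathbb{R}^2$. Assume that there exist a point $P\in\partial\Omega$ and $\delta>0$ such that $B_{2\delta}(P)\cap\partial\Omega$ is a curve of class $C^2$. Then $B_{\delta}(P)\cap\partial\Omega$ is a straight line segment.
   Context: For a convex set $\Omega\subset\mathbb{R}^2$, its Gaussian perimeter is $P_{\gamma_2}(\Omega)=\frac{1}{2\pi}\int_{\partial\Omega}\exp\left(-\frac{|\mathbf{x}|^2}{2}\right)d\mathcal{H}^1(\mathbf{x})$, where $\mathcal{H}^1$ is the one-dimensional Hausdorff measure. $B_r(P)$ denotes the open disc of radius $r$ centered at $P$. *)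

(* Defs.v *)
(* The plane R^2 is modelled as R * R (product
   topology = Euclidean topology); the Euclidean distance is explicit. *)
From HB Require Import structures.
From mathcomp Require Import all_boot all_order all_algebra.
From mathcomp Require Import all_classical all_reals all_analysis.
Set Implicit Arguments. Unset Strict Implicit. Unset Printing Implicit Defensive.
Import Order.TTheory GRing.Theory Num.Theory.
Import numFieldNormedType.Exports.
Local Open Scope classical_set_scope.
Local Open Scope ring_scope.

Section Defs.
Variable R : realType.
Notation pt := (R * R)%type.

Definition enorm (x : pt) : R := Num.sqrt (x.1 ^+ 2 + x.2 ^+ 2).
Definition edist (x y : pt) : R := enorm (x.1 - y.1, x.2 - y.2).

Definition disc (P : pt) (r : R) : set pt := [set x | edist x P < r].

Definition bdry (A : set pt) : set pt := closure A `\` interior A.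

Definition convex_set2 (A : set pt) : Prop :=
  forall x y t, A x -> A y -> 0 <= t <= 1 ->
    A ((1 - t) * x.1 + t * y.1, (1 - t) * x.2 + t * y.2).

(* diameter (0 for the empty set) *)
Definition diam (C : set pt) : \bar R :=
  ereal_sup ([set 0%E] `|` [set (edist x y)%:E | x in C & y in C]).

Definition hausdorff1_approx (d : R) (A : set pt) : \bar R :=
  ereal_inf [set (\sum_(0 <= n <oo) diam (C n))%E
            | C in [set C : nat -> set pt |
                    A `<=` \bigcup_n C n /\ forall n, (diam (C n) <= d%:E)%E]].

Definition hausdorff1 (A : set pt) : \bar R :=
  ereal_sup [set hausdorff1_approx d A | d in [set d : R | 0 < d]].

Definition gauss_w (x : pt) : R := expR (- (enorm x ^+ 2) / 2).

(* integral of the (nonnegative, bounded by 1) Gaussian weight over S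
   with respect to H^1, as a layer-cake (Choquet) integral:
   int_S w dH^1 = int_0^oo H^1(S ∩ {w > t}) dt *)
Definition gauss_layer (S : set pt) (t : R) : set pt :=
  S `&` [set x | t < gauss_w x].

Definition gauss_H1_integral (S : set pt) : \bar R :=
  (\int[@lebesgue_measure R]_(t in `[0%R, +oo[%classic)
      hausdorff1 (gauss_layer S t))%E.

Definition gauss_perimeter (Om : set pt) : \bar R :=
  (((2 * pi)^-1)%:E * gauss_H1_integral (bdry Om))%E.

(* f is C^2 at t (f is assumed derivable on a neighbourhood, see below) *)
Definition C2_at (f : R -> R) (t : R) : Prop :=
  derivable f t 1 /\ derivable (derive1 f) t 1 /\ {for t, continuous (derive1 (derive1 f))}.

(* S is a (regular, simple) curve of class C^2: either an open arc
   parametrized injectively by a regular C^2 map on an open interval ]a,b[,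
   or a closed curve parametrized by a regular C^2 (b-a)-periodic map,
   injective on [a,b[. *)
Definition C2_curve (S : set pt) : Prop :=
  exists (g1 g2 : R -> R) (a b : R), a < b /\
   ( ( (forall t, a < t < b ->
          [/\ C2_at g1 t, C2_at g2 t & (derive1 g1 t, derive1 g2 t) != (0, 0)])
       /\ set_inj `]a, b[ (fun t => (g1 t, g2 t))
       /\ (fun t => (g1 t, g2 t)) @` `]a, b[ = S )
   \/ ( (forall t, [/\ C2_at g1 t, C2_at g2 t & (derive1 g1 t, derive1 g2 t) != (0, 0)])
       /\ (forall t, g1 (t + (b - a)) = g1 t /\ g2 (t + (b - a)) = g2 t)
       /\ set_inj `[a, b[ (fun t => (g1 t, g2 t))
       /\ (fun t => (g1 t, g2 t)) @` `[a, b[ = S ) ).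

Definition open_seg (x y : pt) : set pt :=
  [set ((1 - t) * x.1 + t * y.1, (1 - t) * x.2 + t * y.2) | t in `]0, 1[].
Definition closed_seg (x y : pt) : set pt :=
  [set ((1 - t) * x.1 + t * y.1, (1 - t) * x.2 + t * y.2) | t in `[0, 1]].

End Defs.

(* Main.v *)
(* Suppose the arc has positive curvature k at a boundary point; rotate so that
   the tangent there is horizontal.  Write K for the closure of the maximizer and
   consider the sub-arc over [x0 - h, x0 + h].  Cutting K along the chord of the
   sub-arc, and enlarging K up to the two tangents at its end points, both give
   convex sets that coincide with K beyond the chord.  With w the weight at the
   point, y0 its height and S the weighted length of the horizontal segment below
   the arc, the weighted lengths of the three curves are, up to o(h^3),
     arc      : S + w (k^2 / 3 - y0 k / 3) h^3,
     chord    : S - w y0 k h^3,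
     tangents : S + w k^2 h^3,
   so that 2 tangents + chord - 3 arc = w k^2 h^3 + o(h^3) > 0 and one of the two
   competitors has a larger perimeter.  Hence the curvature vanishes and the arc
   is straight.  The perimeter of every convex set is finite, so the comparison
   is not between infinities. *)
Require Import Defs.
From HB Require Import structures.
From mathcomp Require Import all_boot all_order all_algebra.
From mathcomp Require Import all_classical all_reals all_analysis.
From mathcomp Require Import measurable_realfun ring lra.
Set Implicit Arguments.
Unset Strict Implicit.
Unset Printing Implicit Defensive.
Import Order.TTheory GRing.Theory Num.Theory.
Import numFieldNormedType.Exports.
Local Open Scope classical_set_scope.
Local Open Scope ring_scope.

(* MathComp-Analysis exports another [edist]. *)
Local Notation edist := Defs.edist.

(** The weighted length is handled as an outer measure: monotone and subadditive on all sets,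
    additive on sets at positive distance, so no measurability of boundary pieces enters. This
    shapes the comparison. The common part of two boundaries can be cancelled only when it stays at
    positive distance from the modified part; hence a competitor is compared with the arc over a
    slightly larger interval, the corner of the two tangents is left out, and these margins shrink
    to zero by continuity. Each length is needed on one side only: from above for the arc, where
    coverings suffice, and from below for straight segments, where Lebesgue measure on the line
    gives the bound. The coefficients 2, 1 and -3 are forced: [S] has order [h], and the terms in
    [y0] have no definite sign, so both must cancel. For the same reason neither competitor suffices
    alone: its gain over the arc can be negative, depending on [y0] and [k]. Rotations and
    reflections through the origin are harmless because the weight is radial. *)

Section plane_metric.
Context {R : realType}.
Implicit Types x y z : R * R.

Lemma enorm_ge0 x : 0 <= enorm x.
Proof. exact: sqrtr_ge0. Qed.

Lemma enorm_sqr x : enorm x ^+ 2 = x.1 ^+ 2 + x.2 ^+ 2.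
Proof. by rewrite sqr_sqrtr// addr_ge0// sqr_ge0. Qed.

Lemma euclidean_edist_ge0 x y : 0 <= edist x y.
Proof. exact: enorm_ge0. Qed.

Lemma edist_sqr x y : edist x y ^+ 2 = (x.1 - y.1) ^+ 2 + (x.2 - y.2) ^+ 2.
Proof. by rewrite enorm_sqr. Qed.

Lemma edistxx x : edist x x = 0.
Proof. by rewrite /edist !subrr /enorm/= expr0n/= addr0 sqrtr0. Qed.

Lemma edistC x y : edist x y = edist y x.
Proof. by rewrite /edist /enorm/= -sqrrN opprB -[X in _ + X]sqrrN opprB. Qed.

Lemma edist_le x y (r : R) : 0 <= r ->
  (x.1 - y.1) ^+ 2 + (x.2 - y.2) ^+ 2 <= r ^+ 2 -> edist x y <= r.
Proof. by move=> r0; rewrite -edist_sqr ler_sqr// nnegrE// euclidean_edist_ge0. Qed.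

Lemma ge_edist x y (r : R) : 0 <= r ->
  r ^+ 2 <= (x.1 - y.1) ^+ 2 + (x.2 - y.2) ^+ 2 -> r <= edist x y.
Proof. by move=> r0; rewrite -edist_sqr ler_sqr// nnegrE// euclidean_edist_ge0. Qed.

Lemma edist_le_l1 x y : edist x y <= `|x.1 - y.1| + `|x.2 - y.2|.
Proof.
apply: edist_le; first by rewrite addr_ge0.
rewrite [leRHS]sqrrD !real_normK ?num_real// addrAC lerDl.
by rewrite mulrn_wge0// mulr_ge0.
Qed.

Lemma fst_le_edist x y : `|x.1 - y.1| <= edist x y.
Proof. by apply: ge_edist => //; rewrite real_normK ?num_real// lerDl sqr_ge0. Qed.

Lemma snd_le_edist x y : `|x.2 - y.2| <= edist x y.
Proof. by apply: ge_edist => //; rewrite real_normK ?num_real// lerDr sqr_ge0. Qed.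

End plane_metric.

(** * Series, infima and suprema of nonnegative extended reals *)

Section ereal_sums.
Context {R : realType}.
Implicit Types (u : (\bar R)^nat) (S : set (\bar R)).
Local Open Scope ereal_scope.

Lemma nneseries_le u M : (forall n, 0 <= u n) ->
  (forall N, \sum_(0 <= i < N) u i <= M) -> \sum_(0 <= i <oo) u i <= M.
Proof.
move=> u0 uM; apply: lime_le; first by apply: is_cvg_nneseries.
by near=> N; exact: uM.
Unshelve. all: by end_near. Qed.

Lemma nneseries_partial_le u N : (forall n, 0 <= u n) ->
  \sum_(0 <= i < N) u i <= \sum_(0 <= i <oo) u i.
Proof. by move=> u0; exact: nneseries_lim_ge. Qed.

Lemma ereal_infD_ge S1 S2 z : (forall x, S1 x -> 0 <= x) ->
  (forall y, S2 y -> 0 <= y) ->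
  (forall x y, S1 x -> S2 y -> z <= x + y) ->
  z <= ereal_inf S1 + ereal_inf S2.
Proof.
move=> S10 S20 Sz.
have i1 : 0 <= ereal_inf S1 by apply: le_ereal_inf_tmp => x /S10.
have i2 : 0 <= ereal_inf S2 by apply: le_ereal_inf_tmp => x /S20.
have [f1|] := boolP (ereal_inf S1 \is a fin_num); last first.
  rewrite ge0_fin_numE// -leNgt leye_eq => /eqP ->.
  by rewrite addye ?leey// gt_eqF// (lt_le_trans _ i2).
have [f2|] := boolP (ereal_inf S2 \is a fin_num); last first.
  rewrite ge0_fin_numE// -leNgt leye_eq => /eqP ->.
  by rewrite addey ?leey// gt_eqF// (lt_le_trans _ i1).
apply/lee_addgt0Pr => e e0.
have e20 : (0 < e / 2)%R by rewrite divr_gt0.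
have [x S1x xi] := lb_ereal_inf_adherent e20 f1.
have [y S2y yi] := lb_ereal_inf_adherent e20 f2.
apply: (le_trans (Sz _ _ S1x S2y)).
rewrite [e]splitr EFinD addeACA; apply: leeD; exact: ltW.
Qed.

Lemma ereal_supD_le S1 S2 z : (exists2 x, S1 x & 0 <= x) ->
  (exists2 x, S2 x & 0 <= x) ->
  (forall x y, S1 x -> S2 y -> x + y <= z) ->
  ereal_sup S1 + ereal_sup S2 <= z.
Proof.
move=> [a S1a a0] [b S2b b0] Sz.
have i1 : 0 <= ereal_sup S1 by apply: (le_trans a0); exact: ereal_sup_ubound.
have i2 : 0 <= ereal_sup S2 by apply: (le_trans b0); exact: ereal_sup_ubound.
have [->|zy] := eqVneq z +oo; first exact: leey.
have zlt : z < +oo by rewrite ltey.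
have S1z : ereal_sup S1 <= z.
  by apply: ge_ereal_sup => x S1x; apply: le_trans (Sz _ _ S1x S2b); exact: leeDl.
have S2z : ereal_sup S2 <= z.
  by apply: ge_ereal_sup => x S2x; apply: le_trans (Sz _ _ S1a S2x); exact: leeDr.
have f1 : ereal_sup S1 \is a fin_num by rewrite ge0_fin_numE// (le_lt_trans S1z).
have f2 : ereal_sup S2 \is a fin_num by rewrite ge0_fin_numE// (le_lt_trans S2z).
apply/lee_addgt0Pr => e e0.
have e20 : (0 < e / 2)%R by rewrite divr_gt0.
have [x S1x xi] := ub_ereal_sup_adherent e20 f1.
have [y S2y yi] := ub_ereal_sup_adherent e20 f2.
rewrite -leeBlDr// [e]splitr EFinD oppeD// addeACA.
by apply: le_trans (Sz _ _ S1x S2y); apply: leeD; exact: ltW.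
Qed.

End ereal_sums.

(** * One-dimensional Hausdorff measure *)

Section hausdorff1_theory.
Context {R : realType}.
Implicit Types A B C : set (R * R).
Local Open Scope ereal_scope.

Lemma diam_ge0 A : 0 <= diam A.
Proof. by apply: ereal_sup_ubound; left. Qed.

Lemma edist_le_diam A x y : A x -> A y -> (edist x y)%:E <= diam A.
Proof. by move=> Ax Ay; apply: ereal_sup_ubound; right; exists x => //; exists y. Qed.

Lemma diam_le A (r : \bar R) : 0 <= r ->
  (forall x y, A x -> A y -> (edist x y)%:E <= r) -> diam A <= r.
Proof. by move=> r0 Ar; apply: ge_ereal_sup => _ [->//|[x Ax [y Ay <-]]]; exact: Ar. Qed.

Lemma diamS A B : A `<=` B -> diam A <= diam B.
Proof.
move=> AB; apply: diam_le; first exact: diam_ge0.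
by move=> x y /AB Bx /AB By; exact: edist_le_diam.
Qed.

Lemma diam0 : diam (@set0 (R * R)) = 0.
Proof. by apply/le_anti; rewrite diam_ge0 diam_le. Qed.

Lemma hausdorff1_approx_le (d : R) A (C : nat -> set (R * R)) (M : \bar R) :
  A `<=` \bigcup_n C n -> (forall n, diam (C n) <= d%:E) ->
  \sum_(0 <= n <oo) diam (C n) <= M -> hausdorff1_approx d A <= M.
Proof. by move=> AC Cd; apply: le_trans; apply: ereal_inf_lbound; exists C. Qed.

Lemma hausdorff1_approx_ge0 (d : R) A : 0 <= hausdorff1_approx d A.
Proof.
by apply: le_ereal_inf_tmp => _ [C _ <-]; apply: nneseries_ge0 => n _ _; exact: diam_ge0.
Qed.

Lemma hausdorff1_approxS (d : R) A B : A `<=` B ->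
  hausdorff1_approx d A <= hausdorff1_approx d B.
Proof.
move=> AB; apply: le_ereal_inf_tmp => _ [C [BC Cd] <-].
by apply: (@hausdorff1_approx_le _ _ C) => //; exact: subset_trans BC.
Qed.

Lemma hausdorff1_approx_anti (d d' : R) A : (d <= d')%R ->
  hausdorff1_approx d' A <= hausdorff1_approx d A.
Proof.
move=> dd; apply: le_ereal_inf_tmp => _ [C [BC Cd] <-].
apply: (@hausdorff1_approx_le _ _ C) => // n.
by apply: (le_trans (Cd n)); rewrite lee_fin.
Qed.

Lemma hausdorff1_approx_le_hausdorff1 (d : R) A : (0 < d)%R ->
  hausdorff1_approx d A <= hausdorff1 A.
Proof. by move=> d0; apply: ereal_sup_ubound; exists d. Qed.

Lemma hausdorff1_le A (M : \bar R) :
  (forall d, (0 < d)%R -> hausdorff1_approx d A <= M) -> hausdorff1 A <= M.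
Proof. by move=> h; apply: ge_ereal_sup => _ [d d0 <-]; exact: h. Qed.

Lemma hausdorff1_ge0 A : 0 <= hausdorff1 A.
Proof.
apply: le_trans (@hausdorff1_approx_le_hausdorff1 1%R A ltr01).
exact: hausdorff1_approx_ge0.
Qed.

Lemma hausdorff1S A B : A `<=` B -> hausdorff1 A <= hausdorff1 B.
Proof.
move=> AB; apply: hausdorff1_le => d d0.
by apply: (le_trans (hausdorff1_approxS d AB)); exact: hausdorff1_approx_le_hausdorff1.
Qed.

Lemma hausdorff1_approxU (d : R) A B :
  hausdorff1_approx d (A `|` B) <= hausdorff1_approx d A + hausdorff1_approx d B.
Proof.
apply: ereal_infD_ge.
- by move=> _ [C _ <-]; apply: nneseries_ge0 => n _ _; exact: diam_ge0.
- by move=> _ [C _ <-]; apply: nneseries_ge0 => n _ _; exact: diam_ge0.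
move=> _ _ [C1 [AC1 C1d] <-] [C2 [BC2 C2d] <-].
pose C n := if odd n then C2 n./2 else C1 n./2.
apply: (@hausdorff1_approx_le _ _ C).
- move=> x [/AC1[n _ Cn]|/BC2[n _ Cn]].
    by exists n.*2 => //; rewrite /C odd_double doubleK.
  by exists n.*2.+1 => //; rewrite /C /= odd_double /= uphalf_double.
- by move=> n; rewrite /C; case: ifP.
apply: nneseries_le => [n|N]; first exact: diam_ge0.
have NE : forall M, \sum_(0 <= i < M.*2) diam (C i) =
    \sum_(0 <= i < M) diam (C1 i) + \sum_(0 <= i < M) diam (C2 i).
  elim=> [|M IH]; first by rewrite !big_geq// adde0.
  rewrite doubleS !big_nat_recr//= IH /C /= odd_double /= uphalf_double doubleK.
  by rewrite -addeA addeACA.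
apply: (@le_trans _ _ (\sum_(0 <= i < N.*2) diam (C i))).
  apply: lee_sum_nneg_natr => //; last by rewrite -addnn leq_addr.
  by move=> n _ _; exact: diam_ge0.
by rewrite NE; apply: leeD; apply: nneseries_partial_le => n; exact: diam_ge0.
Qed.

Lemma hausdorff1U A B : hausdorff1 (A `|` B) <= hausdorff1 A + hausdorff1 B.
Proof.
apply: hausdorff1_le => d d0; apply: (le_trans (hausdorff1_approxU d A B)).
by apply: leeD; exact: hausdorff1_approx_le_hausdorff1.
Qed.

(* A set of diameter smaller than the gap meets at most one of [A] and [B]. *)
Lemma hausdorff1U_separated (d0 : R) A B : (0 < d0)%R ->
  (forall a b, A a -> B b -> (d0 < edist a b)%R) ->
  hausdorff1 A + hausdorff1 B <= hausdorff1 (A `|` B).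
Proof.
move=> d00 AB; apply: ereal_supD_le.
- by exists (hausdorff1_approx 1 A); [exists 1%R => //=|exact: hausdorff1_approx_ge0].
- by exists (hausdorff1_approx 1 B); [exists 1%R => //=|exact: hausdorff1_approx_ge0].
move=> _ _ [d1 /= d10 <-] [d2 /= d20 <-].
pose d := Num.min d0 (Num.min d1 d2).
have d_gt0 : (0 < d)%R by rewrite !lt_min d00 d10.
have dd0 : (d <= d0)%R by rewrite ge_min lexx.
have dd1 : (d <= d1)%R by rewrite !ge_min lexx !orbT.
have dd2 : (d <= d2)%R by rewrite !ge_min lexx !orbT.
apply: le_trans (hausdorff1_approx_le_hausdorff1 (A `|` B) d_gt0).
apply: (le_trans (leeD (hausdorff1_approx_anti A dd1) (hausdorff1_approx_anti B dd2))).
apply: le_ereal_inf_tmp => _ [C [ABC Cd] <-].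
have sub (E : set (R * R)) : E `<=` A `|` B ->
    hausdorff1_approx d E <= \sum_(0 <= n <oo) diam (C n `&` E).
  move=> EAB; apply: (@hausdorff1_approx_le _ _ (fun n => C n `&` E)) => //.
    by move=> x Ex; have [n _ Cx] := ABC _ (EAB _ Ex); exists n.
  by move=> n; apply: le_trans (Cd n); apply: diamS => x [].
apply: (le_trans (leeD (sub A _) (sub B _))); [by left|by right|].
rewrite -nneseriesD; [|by move=> *; exact: diam_ge0..].
apply: lee_nneseries => [n _ _|n _]; first by rewrite adde_ge0 ?diam_ge0.
have [[a [Ca Aa]]|nA] := pselect (exists a, (C n `&` A) a); last first.
  rewrite (_ : C n `&` A = set0) ?diam0 ?add0e; last first.
    by apply/seteqP; split => x // CA; apply: nA; exists x.
  by apply: diamS => x [].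
have [[b [Cb Bb]]|nB] := pselect (exists b, (C n `&` B) b); last first.
  rewrite (_ : C n `&` B = set0) ?diam0 ?adde0; last first.
    by apply/seteqP; split => x // CB; apply: nB; exists x.
  by apply: diamS => x [].
have := AB _ _ Aa Bb; rewrite ltNge => /negP; elim.
rewrite -lee_fin; apply: (le_trans (edist_le_diam Ca Cb)).
by apply: (le_trans (Cd n)); rewrite lee_fin.
Qed.

(** A cover of [A] pulls back to a cover whose diameters are no larger, because [phi] does not
    shrink distances. *)
Lemma hausdorff1_preimage (phi : R * R -> R * R) A :
  (forall x y, (edist x y <= edist (phi x) (phi y))%R) ->
  hausdorff1 (phi @^-1` A) <= hausdorff1 A.
Proof.
move=> phiE; apply: hausdorff1_le => d d0.
apply: le_trans (hausdorff1_approx_le_hausdorff1 A d0).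
apply: le_ereal_inf_tmp => _ [C [AC Cd] <-].
have dC n : diam (phi @^-1` C n) <= diam (C n).
  apply: diam_le => [|x y Cx Cy]; first exact: diam_ge0.
  by apply: le_trans (@edist_le_diam (C n) (phi x) (phi y) Cx Cy); rewrite lee_fin.
apply: (@hausdorff1_approx_le _ _ (fun n => phi @^-1` C n)).
- by move=> x /= /AC[n _ Cn]; exists n.
- by move=> n; exact: le_trans (dC n) (Cd n).
- by apply: lee_nneseries => // n _ _; exact: diam_ge0.
Qed.

(** [N] pieces of diameter [L / N] have total diameter [L], and [L / N] falls below any scale. *)
Lemma hausdorff1_pieces A (L : R) : (0 <= L)%R ->
  (forall N, (0 < N)%N -> exists C : nat -> set (R * R),
     A `<=` \bigcup_(n in `I_N) C n /\
     forall n x y, C n x -> C n y -> (edist x y <= L / N%:R)%R) ->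
  hausdorff1 A <= L%:E.
Proof.
move=> L0 AL; apply: hausdorff1_le => d d0.
have [N N0 LN] : exists2 N, (0 < N)%N & (L / N%:R <= d)%R.
  exists (Num.truncn (L / d)).+1 => //.
  rewrite ler_pdivrMr// mulrC -ler_pdivrMr//.
  by apply/ltW/truncnS_gt; rewrite ?divr_ge0 ?ltW.
have [C [AC CL]] := AL _ N0.
(* The finite family is continued by empty sets, which have diameter 0. *)
pose D n := if (n < N)%N then C n else set0.
have LN0 : (0 <= L / N%:R)%R by rewrite divr_ge0.
have DL n : diam (D n) <= (L / N%:R)%:E.
  rewrite /D; case: ifP => nN; last by rewrite diam0 lee_fin.
  by apply: diam_le => [|x y Cx Cy]; rewrite lee_fin//; exact: CL Cx Cy.
apply: (@hausdorff1_approx_le _ _ D).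
- by move=> x /AC [n /= nN Cn]; exists n => //; rewrite /D nN.
- by move=> n; apply: (le_trans (DL n)); rewrite lee_fin.
apply: nneseries_le => [n|M]; first exact: diam_ge0.
apply: (@le_trans _ _ (((minn M N)%:R * (L / N%:R))%:E)).
  elim: M => [|M IH]; first by rewrite big_geq// min0n mul0r.
  rewrite big_nat_recr//=; have [MN|NM] := ltnP M N.
    rewrite (minn_idPl (ltnW MN)) in IH; rewrite (minn_idPl MN).
    rewrite -addn1 natrD mulrDl mul1r EFinD; exact: leeD.
  rewrite (minn_idPr NM) in IH; rewrite (minn_idPr (leqW NM)).
  by rewrite /D ltnNge NM /= diam0 adde0.
rewrite lee_fin mulrCA -[leRHS]mulr1 ler_wpM2l// ler_pdivrMr ?ltr0n// mul1r.
by rewrite ler_nat geq_minr.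
Qed.

Lemma hausdorff1_set0 : hausdorff1 (@set0 (R * R)) = 0.
Proof.
apply/le_anti; rewrite hausdorff1_ge0 andbT.
by apply: (@hausdorff1_pieces _ 0%R) => // N _; exists (fun=> set0); split.
Qed.

(** A covering set pulls back to a subset of the line whose closed hull has length at most its
    diameter divided by [enorm v]; subadditivity of Lebesgue measure sums these lengths. *)
Lemma hausdorff1_affine_ge (p v : R * R) (S : set R) : measurable S ->
  (enorm v)%:E * lebesgue_measure S <=
  hausdorff1 ((fun x => (p.1 + x * v.1, p.2 + x * v.2)%R) @` S).
Proof.
set sg := (fun x => _); move=> mS.
have := enorm_ge0 v; rewrite le_eqVlt => /orP[/eqP <-|v0].
  by rewrite mul0e hausdorff1_ge0.
have sgE x y : edist (sg x) (sg y) = (`|x - y| * enorm v)%R.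
  apply/eqP; rewrite -(eqrXn2 (n := 2))// ?mulr_ge0 ?euclidean_edist_ge0 ?enorm_ge0//.
  rewrite edist_sqr exprMn enorm_sqr real_normK ?num_real// /sg /=.
  by apply/eqP; ring.
(* Scale 1 suffices: it only makes the sets [E n] bounded. *)
apply: le_trans (@hausdorff1_approx_le_hausdorff1 1%R (sg @` S) ltr01).
apply: le_ereal_inf_tmp => _ [C [SC Cd] <-].
pose E n := sg @^-1` C n.
(* Empty [E n] are set apart because [inf] and [sup] carry no information there. *)
pose I n := if asbool (E n !=set0) then `[inf (E n), sup (E n)]%classic else set0.
have diamE n x y : E n x -> E n y -> (`|x - y| * enorm v)%:E <= diam (C n).
  by move=> Ex Ey; rewrite -sgE; exact: edist_le_diam.
have bnd n x y : E n x -> E n y -> (`|x - y| <= (enorm v)^-1)%R.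
  move=> Ex Ey; have := le_trans (diamE _ _ _ Ex Ey) (Cd n).
  by rewrite lee_fin -ler_pdivlMr// mul1r.
have hub n : E n !=set0 -> has_ubound (E n).
  move=> [x Ex]; exists (x + (enorm v)^-1)%R => y Ey.
  by rewrite addrC -lerBlDr; apply: le_trans (bnd _ _ _ Ey Ex); exact: ler_norm.
have hlb n : E n !=set0 -> has_lbound (E n).
  move=> [x Ex]; exists (x - (enorm v)^-1)%R => y Ey.
  rewrite lerBlDl -lerBlDr; apply: le_trans (bnd _ _ _ Ex Ey); exact: ler_norm.
have mI n : measurable (I n) by rewrite /I; case: asboolP.
have SI : S `<=` \bigcup_n I n.
  move=> x Sx; have [|n _ Cx] := SC (sg x); first by exists x.
  exists n => //; have En : E n !=set0 by exists x.
  rewrite /I asboolT//= in_itv/=; apply/andP; split.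
    by apply: ge_inf => //; exact: hlb.
  by apply: ub_le_sup => //; exact: hub.
have h : lebesgue_measure S <= \sum_(0 <= n <oo) lebesgue_measure (I n).
  exact: measure_sigma_subadditive.
have v0E : 0 <= (enorm v)%:E by rewrite lee_fin ltW.
apply: (le_trans (lee_wpmul2l v0E h)).
rewrite -nneseriesZl//; apply: lee_nneseries => [n _ _|n _]; first exact: mule_ge0.
rewrite /I; case: asboolP => [En|_]; last by rewrite measure0 mule0 diam_ge0.
rewrite lebesgue_measure_itv/= lte_fin; case: ifP => [infsup|_]; last first.
  by rewrite mule0 diam_ge0.
have dfin : diam (C n) \is a fin_num.
  by rewrite ge0_fin_numE ?diam_ge0// (le_lt_trans (Cd n)) ?ltry.
rewrite -EFinB -EFinM -(fineK dfin) lee_fin mulrC -ler_pdivlMr// lerBlDr.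
apply: ge_sup => // x Ex; rewrite addrC -lerBlDr.
apply: lb_le_inf => // y Ey; rewrite lerBlDr addrC -lerBlDr ler_pdivlMr//.
rewrite -lee_fin fineK//; apply: le_trans (diamE _ _ _ Ex Ey).
by rewrite lee_fin ler_wpM2r// ?ler_norm// ltW.
Qed.

End hausdorff1_theory.

(** * Gaussian length *)

Section gauss_integral.
Context {R : realType}.
Implicit Types S A B : set (R * R).
Local Notation mu := (@lebesgue_measure R).

Lemma gauss_wE (z : R * R) : gauss_w z = expR (- (z.1 ^+ 2 + z.2 ^+ 2) / 2).
Proof. by rewrite /gauss_w enorm_sqr. Qed.

Lemma gauss_w_gt0 (z : R * R) : 0 < gauss_w z.
Proof. exact: expR_gt0. Qed.

Lemma gauss_w_le1 (z : R * R) : gauss_w z <= 1.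
Proof.
rewrite gauss_wE -[leRHS]expR0 ler_expR mulNr oppr_le0.
by rewrite divr_ge0// addr_ge0// sqr_ge0.
Qed.

Lemma gauss_layer_anti S (s t : R) : s <= t -> gauss_layer S t `<=` gauss_layer S s.
Proof. by move=> st z [Sz /= tz]; split=> //=; exact: le_lt_trans tz. Qed.

Lemma gauss_layerS A B (t : R) : A `<=` B -> gauss_layer A t `<=` gauss_layer B t.
Proof. by move=> AB z [/AB Bz tz]. Qed.

Lemma gauss_layerU A B (t : R) :
  gauss_layer (A `|` B) t = gauss_layer A t `|` gauss_layer B t.
Proof. by rewrite /gauss_layer setIUl. Qed.

Local Open Scope ereal_scope.

(** The preimages of upper rays are intervals. This makes the layer-cake integrand measurable for an
    arbitrary set [S]. *)
Lemma nonincreasing_emeasurable (D : set R) (f : R -> \bar R) : measurable D ->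
  {homo f : x y / (x <= y)%R >-> y <= x} -> measurable_fun D f.
Proof.
move=> mD fni _; apply: (measurability _ (ErealGenOInfty.measurableE R)) => //.
move=> _ [_ [r ->] <-]; apply: measurableI => //; apply: is_interval_measurable.
move=> x y /= + + z /andP[_ zy]; rewrite !in_itv/= !andbT => _ ry.
by apply: (lt_le_trans ry); exact: fni.
Qed.

Lemma measurable_hausdorff1_layer S (D : set R) : measurable D ->
  measurable_fun D (fun t => hausdorff1 (gauss_layer S t)).
Proof.
move=> mD; apply: nonincreasing_emeasurable => // x y xy.
by apply: hausdorff1S; exact: gauss_layer_anti.
Qed.
Hint Resolve measurable_hausdorff1_layer : core.

Lemma gauss_H1_integral_ge0 S : 0 <= gauss_H1_integral S.
Proof. by apply: integral_ge0 => t _; exact: hausdorff1_ge0. Qed.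

Lemma gauss_H1_integral_le A B :
  (forall t, (0 <= t)%R -> hausdorff1 (gauss_layer A t) <= hausdorff1 (gauss_layer B t)) ->
  gauss_H1_integral A <= gauss_H1_integral B.
Proof.
move=> AB; apply: ge0_le_integral => //.
- by move=> t _; exact: hausdorff1_ge0.
- exact: measurable_hausdorff1_layer.
- exact: measurable_hausdorff1_layer.
- by move=> t /=; rewrite in_itv/= andbT; exact: AB.
Qed.

Lemma gauss_H1_integralS A B : A `<=` B -> gauss_H1_integral A <= gauss_H1_integral B.
Proof.
by move=> AB; apply: gauss_H1_integral_le => t _; apply/hausdorff1S/gauss_layerS.
Qed.

Lemma gauss_H1_integralU A B :
  gauss_H1_integral (A `|` B) <= gauss_H1_integral A + gauss_H1_integral B.
Proof.
rewrite /gauss_H1_integral -ge0_integralD//; last 4 first.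
- by move=> *; exact: hausdorff1_ge0.
- exact: measurable_hausdorff1_layer.
- by move=> *; exact: hausdorff1_ge0.
- exact: measurable_hausdorff1_layer.
apply: ge0_le_integral => //.
- by move=> t _; exact: hausdorff1_ge0.
- exact: measurable_hausdorff1_layer.
- by apply: emeasurable_funD; exact: measurable_hausdorff1_layer.
- by move=> t _; rewrite gauss_layerU; exact: hausdorff1U.
Qed.

Lemma gauss_H1_integralU_separated (d0 : R) A B : (0 < d0)%R ->
  (forall a b, A a -> B b -> (d0 < edist a b)%R) ->
  gauss_H1_integral A + gauss_H1_integral B <= gauss_H1_integral (A `|` B).
Proof.
move=> d00 AB.
rewrite /gauss_H1_integral -ge0_integralD//; last 4 first.
- by move=> *; exact: hausdorff1_ge0.
- exact: measurable_hausdorff1_layer.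
- by move=> *; exact: hausdorff1_ge0.
- exact: measurable_hausdorff1_layer.
apply: ge0_le_integral => //.
- by move=> t _; apply: adde_ge0; exact: hausdorff1_ge0.
- by apply: emeasurable_funD; exact: measurable_hausdorff1_layer.
- exact: measurable_hausdorff1_layer.
- move=> t _; rewrite gauss_layerU; apply: (hausdorff1U_separated d00).
  by move=> a b [Aa _] [Bb _]; exact: AB.
Qed.

(** Layers above level [M] are empty, and each other layer is contained in [S]. *)
Lemma gauss_H1_integral_le_sup S (M : R) : (0 <= M)%R ->
  (forall z, S z -> (gauss_w z <= M)%R) ->
  gauss_H1_integral S <= M%:E * hausdorff1 S.
Proof.
move=> M0 SM; rewrite /gauss_H1_integral.
rewrite (_ : \int[mu]_(t in _) _ = \int[mu]_(t in `[0%R, +oo[ `&` `[0%R, M])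
    hausdorff1 (gauss_layer S t)); last first.
  rewrite integral_mkcondr; apply: eq_integral => t; rewrite inE/= in_itv/= andbT => t0.
  rewrite patchE; case: ifPn => //; rewrite notin_setE/= in_itv/= t0/= => /negP.
  rewrite -ltNge => Mt; rewrite (_ : gauss_layer S t = set0).
    exact: hausdorff1_set0.
  apply/seteqP; split => // z [Sz /= tw]; have := SM _ Sz.
  by rewrite leNgt => /negP; apply; exact: lt_trans tw.
rewrite (_ : `[0%R, +oo[ `&` `[0%R, M] = `[0%R, M]%classic); last first.
  by apply/seteqP; split => t /=; rewrite !in_itv/= andbT; lra.
apply: (@le_trans _ _ (\int[mu]_(t in `[0%R, M]) cst (hausdorff1 S) t)).
  apply: ge0_le_integral => //.
  - by move=> t _; exact: hausdorff1_ge0.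
  - exact: measurable_hausdorff1_layer.
  - by move=> t _; apply: hausdorff1S => z [].
rewrite integral_cst//= muleC lebesgue_measure_itv/= lte_fin.
by case: ifP => [M0'|_]; rewrite ?sube0 ?lexx// mul0e mule_ge0 ?lee_fin ?hausdorff1_ge0.
Qed.

Lemma gauss_H1_integral_preimage (phi : R * R -> R * R) S :
  (forall x y, (edist x y <= edist (phi x) (phi y))%R) ->
  (forall x, enorm (phi x) = enorm x) ->
  gauss_H1_integral (phi @^-1` S) <= gauss_H1_integral S.
Proof.
move=> phiE phiN; apply: gauss_H1_integral_le => t _.
apply: le_trans (hausdorff1_preimage _ phiE); apply: hausdorff1S => z [Sz /= tz].
by split => //=; rewrite /gauss_w phiN.
Qed.

Lemma expR_ge_pow2 n : ((2 ^ n)%:R <= expR n%:R :> R)%R.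
Proof.
elim: n => [|n IH]; first by rewrite expn0 expR0.
rewrite -[n.+1%:R]natr1 expRD expnSr natrM ler_pM//.
by apply: le_trans (expR_ge1Dx _); rewrite -natr1 addrC.
Qed.

(* [{w > t}] is a disc of radius [sqrt (-2 ln t)], of order at most [n + 1]
   when [2^-(n+1) < t <= 2^-n]. *)
Lemma gauss_H1_integral_lty S (C : R) : (0 <= C)%R ->
  (forall r, (0 <= r)%R ->
    hausdorff1 (S `&` [set z | (`|z.1| <= r)%R /\ (`|z.2| <= r)%R]) <= (C * r)%:E) ->
  gauss_H1_integral S < +oo.
Proof.
move=> C0 SC.
pose h (n : nat) : R := ((2 ^ n)%:R^-1)%R.
have h_gt0 n : (0 < h n)%R by rewrite invr_gt0 ltr0n expn_gt0.
have hanti m n : (m <= n)%N -> (h n <= h m)%R.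
  by move=> mn; rewrite lef_pV2 ?posrE ?ltr0n ?expn_gt0// ler_nat leq_pexp2l.
(* For [2 ^ -(k + 1) < t <= 2 ^ -k] the terms [n <= k] add up to [2 * C * (k + 1)], which is the
   bound for the box of radius [2 * (k + 1)]. Since [2 <= e], the layer satisfies
   [z.1 ^+ 2 + z.2 ^+ 2 < 2 * (k + 1)] and lies in that box. The integrals form a geometric
   series. *)
pose g n (t : R) : \bar R := ((2 * C)%:E * (\1_(`[0%R, h n]) t)%:E).
have C20 : (0 <= 2 * C)%R by rewrite mulr_ge0.
have g0 n t : 0 <= g n t by rewrite mule_ge0 ?lee_fin.
have mg n : measurable_fun (`]0%R, +oo[%classic : set R) (g n).
  apply: measurable_funeM; apply/measurable_EFinP; apply: measurable_indic.
  exact: measurable_itv.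
rewrite /gauss_H1_integral -integral_itv_obnd_cbnd; last exact: measurable_hausdorff1_layer.
apply: (@le_lt_trans _ _ (\int[mu]_(t in `]0%R, +oo[) \sum_(0 <= n <oo) g n t)).
  apply: ge0_le_integral => //.
  - by move=> t _; exact: hausdorff1_ge0.
  - exact: measurable_hausdorff1_layer.
  - by apply: ge0_emeasurable_sum => [n t _ _|n _]; [exact: g0|exact: mg].
  move=> t /=; rewrite in_itv/= andbT => t0.
  have [t1|t1] := leP 1%R t.
    rewrite (_ : gauss_layer S t = set0).
      by rewrite hausdorff1_set0; apply: nneseries_ge0.
    apply/seteqP; split => // z [_ /= tz].
    by have := gauss_w_le1 z; rewrite leNgt => /negP; apply; exact: le_lt_trans tz.
  have [N tN] : exists N, (h N < t)%R.
    exists (Num.truncn t^-1); rewrite /h -[ltRHS]invrK ltf_pV2 ?posrE ?invr_gt0 ?ltr0n ?expn_gt0//.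
    apply: (lt_le_trans (truncnS_gt _)); rewrite ler_nat; exact: ltn_expl.
  have [N' tN' N'min] : exists2 N', (h N' < t)%R & forall m, (h m < t)%R -> (N' <= m)%N.
    have ex : exists n, (h n < t)%R by exists N.
    by exists (ex_minn ex); case: ex_minnP.
  case: N' tN' N'min => [|k] tk kmin.
    by move: tk; rewrite /h expn0 invr1 ltNge (ltW t1).
  have tk' : (t <= h k)%R by rewrite leNgt; apply/negP => /kmin; rewrite ltnn.
  apply: (@le_trans _ _ (\sum_(0 <= n < k.+1) g n t)); last exact: nneseries_partial_le.
  rewrite (_ : \sum_(0 <= n < k.+1) g n t = (C * (2 * k.+1%:R))%:E); last first.
    rewrite (eq_big_nat _ _ (F2 := fun=> (2 * C)%:E)); last first.
      move=> n /andP[_ nk]; rewrite /g indicE mem_set ?mule1//=.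
      by rewrite in_itv/= ltW//=; apply: (le_trans tk'); exact: hanti.
    by rewrite sumEFin sumr_const_nat subn0; congr EFin; rewrite -mulr_natr; ring.
  apply: le_trans (SC _ _); last by rewrite mulr_ge0.
  apply: hausdorff1S => z [Sz /= tz]; split => //=.
  have : (z.1 ^+ 2 + z.2 ^+ 2 < (2 * k.+1%:R) )%R.
    have : (h k.+1 < gauss_w z)%R by exact: lt_trans tz.
    have : (expR (- k.+1%:R) <= h k.+1)%R.
      by rewrite expRN /h lef_pV2 ?posrE ?expR_gt0 ?ltr0n ?expn_gt0// expR_ge_pow2.
    by move=> /le_lt_trans /[apply]; rewrite gauss_wE ltr_expR; lra.
  have k1 : (1 <= k.+1%:R :> R)%R by rewrite ler1n.
  have := sqr_ge0 z.1; have := sqr_ge0 z.2 => z2 z1 zz.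
  by split; rewrite -ler_sqr ?nnegrE ?mulr_ge0// real_normK ?num_real//; nra.
rewrite integral_nneseries//.
apply: (@le_lt_trans _ _ (4 * C)%:E); last exact: ltry.
apply: le_trans (epsilon_trick0 xpredT _); last by rewrite mulr_ge0.
apply: lee_nneseries => [n _ _|n _]; first by apply: integral_ge0 => t _; exact: g0.
rewrite ge0_integralZl_EFin//; last first.
  by apply/measurable_EFinP; apply: measurable_indic; exact: measurable_itv.
rewrite integral_indic//=.
apply: (@le_trans _ _ ((2 * C)%:E * (h n)%:E)).
  apply: lee_wpmul2l; first by rewrite lee_fin.
  apply: (@le_trans _ _ (mu `[0%R, h n])).
    by apply: le_measure; rewrite ?inE//; exact: measurableI.
  by rewrite lebesgue_measure_itv/= lte_fin h_gt0 oppr0 adde0.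
rewrite -EFinM lee_fin /h expnS natrM invfM le_eqVlt; apply/orP; left; apply/eqP.
field; by rewrite pnatr_eq0 -lt0n expn_gt0.
Qed.

End gauss_integral.

(** * One-variable calculus *)

Section real_calculus.
Context {R : realType}.
Implicit Types f k : R -> R.

Lemma continuous_delta f (s : R) : {for s, continuous f} ->
  forall e, 0 < e -> exists2 d, 0 < d & forall z, `|z - s| < d -> `|f z - f s| <= e.
Proof.
move=> cf e e0; have /cvgrPdist_le /(_ _ e0) /nbhs_ballP[d /= d0 dP] := cf.
by exists d => // z zs; rewrite distrC; apply: dP; rewrite /ball/= distrC.
Qed.

Lemma is_derive_continuous f (s l : R) : is_derive s 1 f l -> {for s, continuous f}.
Proof. by move=> [df _]; exact/differentiable_continuous/derivable1_diffP. Qed.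

Lemma is_derive_delta f (s l : R) : is_derive s 1 f l ->
  forall e, 0 < e -> exists2 d, 0 < d & forall z, `|z - s| < d ->
    `|f z - f s - l * (z - s)| <= e * `|z - s|.
Proof.
move=> /is_derive1_caratheodory[k [fk ck <-]] e e0.
have [d d0 dP] := continuous_delta ck e0.
by exists d => // z /dP kz; rewrite fk -mulrBl normrM ler_wpM2r.
Qed.

Lemma MVT_cc f k (a b : R) : a <= b ->
  (forall x, a <= x <= b -> is_derive x 1 f (k x)) ->
  exists2 c, a <= c <= b & f b - f a = k c * (b - a).
Proof.
move=> ab fk; have [||c] := @MVT_segment R f k a b ab.
- by move=> x; rewrite in_itv/= => /andP[ax xb]; apply: fk; rewrite !ltW.
- apply: derivable_within_continuous => x; rewrite in_itv/= => /fk h.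
  exact: ex_derive.
by rewrite in_itv/=; exists c.
Qed.

End real_calculus.

(** * Weighted length of a graph: upper bound *)

Section gauss_curves.
Context {R : realType}.
Local Notation mu := (@lebesgue_measure R).

(** Slices of [A] of equal width in the parameter [th] are the pieces. The parameter is the abscissa
    for graphs and a signed sum of coordinates for convex boundaries. *)
Lemma hausdorff1_lipschitz_param (A : set (R * R)) (th : R * R -> R) (c d V : R) :
  c <= d -> 0 <= V -> (forall z, A z -> c <= th z <= d) ->
  (forall x y, A x -> A y -> edist x y <= V * `|th x - th y|) ->
  (hausdorff1 A <= (V * (d - c))%:E)%E.
Proof.
move=> cd V0 Acd AV; apply: hausdorff1_pieces; first by rewrite mulr_ge0// subr_ge0.
move=> N N0; have N0' : 0 < N%:R :> R by rewrite ltr0n.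
pose w := (d - c) / N%:R.
have w0 : 0 <= w by rewrite divr_ge0// subr_ge0.
have wN : w * N%:R = d - c by rewrite divfK// gt_eqF.
pose C n := A `&` [set z | c + n%:R * w <= th z <= c + n.+1%:R * w].
exists C; split; last first.
  move=> n x y [Ax /= /andP[x1 x2]] [Ay /= /andP[y1 y2]].
  apply: (le_trans (AV _ _ Ax Ay)); rewrite -mulrA ler_wpM2l// -/w.
  rewrite ler_norml; rewrite -natr1 mulrDl mul1r in x2 y2.
  by apply/andP; split; lra.
move=> z Az; have /andP[cz zd] := Acd _ Az.
have [wpos|] := ltP 0 w; last first.
  move=> w0'; have {w0'}w0E : w = 0 by apply/le_anti; rewrite w0'.
  by exists 0%N => //; split => //=; move: wN; rewrite w0E !mulr0 mul0r; lra.
pose q := (th z - c) / w.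
have q0 : 0 <= q by rewrite divr_ge0// subr_ge0.
have qE : q * w = th z - c by rewrite divfK// gt_eqF.
have /andP[tq qt] := Num.Theory.truncn_itv q0.
have [kN|Nk] := ltnP (Num.truncn q) N.
  exists (Num.truncn q) => //; split => //=; apply/andP; split.
    by rewrite -lerBrDl -qE ler_wpM2r.
  by rewrite -lerBlDl -qE ler_wpM2r// ltW.
(* The right end [th z = d] gives quotient [N] and is put in the last slice. *)
exists N.-1; first by rewrite /= prednK.
split => //=; rewrite prednK//; apply/andP; split; last by rewrite mulrC wN; lra.
rewrite -lerBrDl -qE ler_wpM2r// (le_trans _ tq)// ler_nat.
by apply: leq_trans Nk; exact: leq_pred.
Qed.

Definition graph_on (f : R -> R) (a b : R) : set (R * R) :=
  [set (x, f x) | x in `[a, b]].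

Section graph_upper_bound.
Variables (f f1 G g : R -> R) (a b : R).
Hypothesis ab : a <= b.
Hypothesis ff1 : forall x, a <= x <= b -> is_derive x 1 f (f1 x).
Hypothesis cf1 : forall x, a <= x <= b -> {for x, continuous f1}.
Hypothesis Gg : forall x, a <= x <= b -> is_derive x 1 G (g x).
Hypothesis gw : forall x, a <= x <= b -> gauss_w (x, f x) * Num.sqrt (1 + f1 x ^+ 2) <= g x.

Let hausdorff1_graph_le c d V : a <= c -> c <= d -> d <= b ->
  (forall x, c <= x <= d -> Num.sqrt (1 + f1 x ^+ 2) <= V) ->
  (hausdorff1 (graph_on f c d) <= (V * (d - c))%:E)%E.
Proof.
move=> ac cd db fV.
have V0 : 0 <= V by apply: le_trans (fV c _); rewrite ?sqrtr_ge0// lexx.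
apply: (@hausdorff1_lipschitz_param _ fst) => //.
  by move=> _ [x /= xcd <-] /=; move: xcd; rewrite in_itv.
suff le x y : c <= x -> x <= y -> y <= d ->
    edist (x, f x) (y, f y) <= V * `|x - y|.
  move=> _ _ [x /= xcd <-] [y /= ycd <-] /=; move: xcd ycd; rewrite !in_itv/=.
  move=> /andP[cx xd] /andP[cy yd]; have [xy|yx] := leP x y; first exact: le.
  by rewrite edistC distrC; apply: le => //; exact: ltW.
move=> cx xy yd.
have [xi xixy fxy] : exists2 xi, x <= xi <= y & f y - f x = f1 xi * (y - x).
  by apply: MVT_cc => // z zxy; apply: ff1; lra.
have V1 : 1 + f1 xi ^+ 2 <= V ^+ 2.
  have /fV : c <= xi <= d by lra.
  by move=> h; rewrite -[leLHS]sqr_sqrtr ?addr_ge0 ?sqr_ge0// ler_sqr ?nnegrE ?sqrtr_ge0.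
apply: edist_le; first by rewrite mulr_ge0.
rewrite /= -[f x - _]opprB sqrrN fxy [leRHS]exprMn real_normK ?num_real//.
rewrite (_ : _ + _ = (1 + f1 xi ^+ 2) * (x - y) ^+ 2); last by ring.
by rewrite ler_wpM2r// sqr_ge0.
Qed.

(** Near [s] the weight and the stretch factor are almost constant and [G] is almost affine, so the
    bound holds with an error proportional to the width. *)
Let graph_local s (eps : R) : a <= s <= b -> 0 < eps ->
  exists2 del, 0 < del & forall c d, a <= c -> d <= b -> s - del < c -> c <= s ->
    s <= d -> d < s + del ->
    (gauss_H1_integral (graph_on f c d) <= (G d - G c + eps * (d - c))%:E)%E.
Proof.
move=> sab eps0.
pose W x := gauss_w (x, f x).
pose S x := Num.sqrt (1 + f1 x ^+ 2).
have cf : {for s, continuous f} by apply: is_derive_continuous; exact: ff1.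
have cW : {for s, continuous W}.
  have -> : W = fun x => expR (- (x * x + f x * f x) / 2).
    by apply/funext => x; rewrite /W gauss_wE/= !expr2.
  apply: (@continuous_comp _ _ _ _ expR); last exact: continuous_expR.
  by apply: cvgM; [apply: cvgN; apply: cvgD; apply: cvgM|exact: cvg_cst].
have cS : {for s, continuous S}.
  apply: (@continuous_comp _ _ _ _ Num.sqrt); last exact: sqrt_continuous.
  by apply: cvgD; [exact: cvg_cst|apply: cvgM; exact: cf1].
have v0 : 0 <= S s by exact: sqrtr_ge0.
have w0 : 0 < W s by exact: gauss_w_gt0.
have w1 : W s <= 1 by exact: gauss_w_le1.
(* The product [(W s + eta) * (S s + eta)] exceeds [W s * S s] by at most [eta * (S s + 2)]; one
   more [eta] pays for the linearization of [G]. *)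
pose eta := Num.min 1 (eps / (S s + 3)).
have eta0 : 0 < eta by rewrite lt_min ltr01 divr_gt0// ltr_wpDl.
have eta1 : eta <= 1 by rewrite ge_min lexx.
have eta2 : eta * (S s + 3) <= eps.
  by rewrite -ler_pdivlMr ?ltr_wpDl// ge_min lexx orbT.
have [d1 d10 d1P] := continuous_delta cW eta0.
have [d2 d20 d2P] := continuous_delta cS eta0.
have [d3 d30 d3P] := is_derive_delta (Gg sab) eta0.
exists (Num.min d1 (Num.min d2 d3)); first by rewrite !lt_min d10 d20.
set del := Num.min _ _ => c d ac db sc cs sd ds.
have cd : c <= d by lra.
have near x : c <= x -> x <= d -> [/\ `|x - s| < d1, `|x - s| < d2 & `|x - s| < d3].
  move=> cx xd; have : `|x - s| < del by rewrite ltr_norml; apply/andP; split; lra.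
  by rewrite !lt_min => /and3P[].
have Gd : (g s - eta) * (d - s) <= G d - G s.
  have [_ _ /d3P] := near d cd (lexx d); rewrite ler_norml.
  by rewrite [`|d - s|]ger0_norm ?subr_ge0// => /andP[]; lra.
have Gc : (g s - eta) * (s - c) <= G s - G c.
  have [_ _ /d3P] := near c (lexx c) cd; rewrite ler_norml.
  by rewrite [`|c - s|]ler0_norm ?subr_le0// => /andP[]; lra.
have M1 : 0 <= W s + eta by rewrite addr_ge0 ?ltW.
apply: (@le_trans _ _ ((W s + eta)%:E * hausdorff1 (graph_on f c d)))%E.
  apply: gauss_H1_integral_le_sup => // z [x /=]; rewrite in_itv/= => /andP[cx xd] <-.
  by have [/d1P + _ _] := near _ cx xd; rewrite ler_norml /W => /andP[]; lra.
apply: (@le_trans _ _ ((W s + eta)%:E * ((S s + eta) * (d - c))%:E))%E.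
  apply: lee_wpmul2l; first by rewrite lee_fin.
  apply: hausdorff1_graph_le => // x /andP[cx xd].
  by have [_ /d2P + _] := near _ cx xd; rewrite ler_norml /S => /andP[]; lra.
rewrite -EFinM lee_fin mulrA.
apply: (@le_trans _ _ ((g s - eta + eps) * (d - c))); last by lra.
rewrite ler_wpM2r ?subr_ge0//.
have := gw sab; rewrite -/(S s) -/(W s) => gs.
have : eta * W s <= eta * 1 by rewrite ler_pM2l.
have : eta * eta <= eta * 1 by rewrite ler_pM2l.
by lra.
Qed.

(* Continuous induction: the points up to which the bound holds form an interval
   that is closed and open in [a, b]. *)
Lemma gauss_H1_integral_graph_le :
  (gauss_H1_integral (graph_on f a b) <= (G b - G a)%:E)%E.
Proof.
suff H eps : 0 < eps ->
    (gauss_H1_integral (graph_on f a b) <= (G b - G a + eps * (b - a))%:E)%E.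
  apply/lee_addgt0Pr => e e0.
  (* The [+ 1] covers the case [a = b]. *)
  have ba1 : 0 < b - a + 1 by rewrite ltr_wpDl// subr_ge0.
  apply: (le_trans (H (e / (b - a + 1)) _)); first exact: divr_gt0.
  rewrite -EFinD lee_fin lerD2l mulrAC ler_pdivrMr// ler_pM2l//.
  by rewrite lerDl.
move=> eps0.
pose T := [set x | a <= x <= b /\
  (gauss_H1_integral (graph_on f a x) <= (G x - G a + eps * (x - a))%:E)%E].
have Ta : T a.
  split; first by rewrite lexx.
  have [|del del0 dP] := graph_local (s := a) _ eps0; first by rewrite lexx.
  by apply: dP => //; lra.
have T0 : T !=set0 by exists a.
have Tub : has_ubound T by exists b => x [/andP[]].
have Tsup : has_sup T by [].
have as_ : a <= sup T by exact: ub_le_sup.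
have sb : sup T <= b by apply: ge_sup => // x [/andP[]].
have [|del del0 dP] := graph_local (s := sup T) _ eps0; first by rewrite as_.
(* The local bound at [sup T] is used from a point [c] of [T] just before the supremum to a point
   [d] beyond it. *)
have [c Tc sc] := sup_adherent del0 Tsup.
have cs : c <= sup T by exact: ub_le_sup.
have [/andP[ac cb] ITc] := Tc.
pose d := Num.min b (sup T + del / 2).
have db : d <= b by rewrite ge_min lexx.
have sd : sup T <= d by rewrite le_min sb/=; lra.
have dds : d <= sup T + del / 2 by rewrite ge_min lexx orbT.
have Td : T d.
  split; first by rewrite db andbT; lra.
  apply: (@le_trans _ _ (gauss_H1_integral (graph_on f a c `|` graph_on f c d))).
    apply: gauss_H1_integralS => z [x /=]; rewrite in_itv/= => /andP[ax xd] <-.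
    have [xc|cx] := leP x c; [left|right]; exists x => //=; rewrite in_itv/=.
      by rewrite ax.
    by rewrite ltW.
  apply: (le_trans (gauss_H1_integralU _ _)).
  have dcd : (gauss_H1_integral (graph_on f c d) <= (G d - G c + eps * (d - c))%:E)%E.
    by apply: dP => //; lra.
  apply: (le_trans (leeD ITc dcd)); rewrite -EFinD lee_fin; lra.
(* Passing the supremum is impossible, so [d] was stopped by [b]. *)
have ds : d <= sup T by exact: ub_le_sup.
have dE : d = b.
  by move: dds ds; rewrite /d; case: (leP b (sup T + del / 2)) => //; lra.
by rewrite dE in Td; case: Td.
Qed.

End graph_upper_bound.

End gauss_curves.

(** * Weighted length of a segment: lower bound *)

Section segment_lower_bound.
Context {R : realType}.
Local Notation mu := (@lebesgue_measure R).
Local Open Scope ereal_scope.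

Lemma measurable_superlevel (W : R -> R) t : continuous W ->
  measurable [set x | (t < W x)%R].
Proof.
move=> cW; have mt : measurable_fun [set: R] (fun x => (t < W x)%R).
  apply: measurable_fun_ltr; first exact: measurable_cst.
  exact: continuous_measurable_fun.
rewrite (_ : [set x | _] = (fun x => (t < W x)%R) @^-1` [set true]) //.
by rewrite -[X in measurable X]setTI; exact: mt.
Qed.

(** Both sides are the planar measure of the region below [W] over [[a, b]], by Tonelli's
    theorem. *)
Lemma integral_superlevel (a b : R) (W : R -> R) : continuous W ->
  (forall x, (0 <= W x)%R) ->
  \int[mu]_(t in `[0%R, +oo[) mu (`[a, b] `&` [set x | (t < W x)%R]) =
  \int[mu]_(x in `[a, b]) (W x)%:E.
Proof.
move=> cW W0.
have mW : measurable_fun [set: R] W by exact: continuous_measurable_fun.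
have lvl t := measurable_superlevel t cW.
pose A : set (R * R) :=
  [set p | [/\ (0 <= p.1)%R, (a <= p.2 <= b)%R & (p.1 < W p.2)%R]].
have mA : measurable A.
  have m12 : measurable_fun [set: R * R] (fun p : R * R => (p.1 < W p.2)%R).
    apply: measurable_fun_ltr; first exact: measurable_fst.
    exact: (measurableT_comp mW measurable_snd).
  have mD : measurable_fun [set: R * R] (fun p : R * R => (0 <= p.1)%R).
    by apply: measurable_fun_ler; [exact: measurable_cst|exact: measurable_fst].
  have ma : measurable_fun [set: R * R] (fun p : R * R => (a <= p.2)%R).
    by apply: measurable_fun_ler; [exact: measurable_cst|exact: measurable_snd].
  have mb : measurable_fun [set: R * R] (fun p : R * R => (p.2 <= b)%R).
    by apply: measurable_fun_ler; [exact: measurable_snd|exact: measurable_cst].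
  have pre (f : R * R -> bool) : measurable_fun [set: R * R] f -> measurable (f @^-1` [set true]).
    by move=> mf; rewrite -[X in measurable X]setTI; exact: mf.
  rewrite (_ : A = (fun p : R * R => (0 <= p.1)%R) @^-1` [set true] `&`
     ((fun p : R * R => (a <= p.2)%R) @^-1` [set true] `&`
     ((fun p : R * R => (p.2 <= b)%R) @^-1` [set true] `&`
      (fun p : R * R => (p.1 < W p.2)%R) @^-1` [set true]))).
    by do 3 (apply: measurableI; first exact: pre); exact: pre.
  apply/seteqP; split => p; first by move=> [? /andP[? ?] ?].
  by move=> [/= ? [? [? ?]]]; split => //; apply/andP.
pose F (p : R * R) : \bar R := (\1_A p)%:E.
have mF : measurable_fun [set: R * R] F.
  by apply/measurable_EFinP; exact: measurable_indic.
have F0 p : 0 <= F p by rewrite lee_fin.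
have E1 : \int[mu]_(t in `[0%R, +oo[) mu (`[a, b] `&` [set x | (t < W x)%R]) =
    \int[mu]_t \int[mu]_x F (t, x).
  rewrite integral_mkcond; apply: eq_integral => t _; rewrite patchE.
  case: ifPn => [|]; rewrite ?inE ?notin_setE/= in_itv/= andbT => t0.
    rewrite -[in LHS](setIT (_ `&` _)) -integral_indic//.
    apply: eq_integral => x _; rewrite /F !indicE; congr ((_ : bool)%:R%:E).
    apply/idP/idP; rewrite !inE /A /= in_itv/=.
      by move=> [xab tW]; split.
    by move=> [_ xab tW].
    by apply: measurableI; [exact: measurable_itv|exact: lvl].
  change (0 = \int[mu]_x F (t, x)).
  apply/esym/integral0_eq => x _.
  by rewrite /F indicE memNset//= /A /= => -[].
have E2 : \int[mu]_(x in `[a, b]) (W x)%:E = \int[mu]_x \int[mu]_t F (t, x).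
  rewrite integral_mkcond; apply: eq_integral => x _; rewrite patchE.
  case: ifPn => [|]; rewrite ?inE ?notin_setE/= in_itv/= => xab.
    transitivity (\int[mu]_t (\1_(`[0%R, W x[) t)%:E); last first.
      apply: eq_integral => t _; rewrite /F !indicE; congr ((_ : bool)%:R%:E).
      apply/idP/idP; rewrite !inE /A /= in_itv/=.
        by move=> /andP[t0 tW]; split.
      by move=> [t0 _ tW]; apply/andP.
    rewrite integral_indic//= setIT lebesgue_measure_itv/= lte_fin oppr0 adde0.
    by case: ifPn => //; rewrite -leNgt => Wx0; congr EFin; apply/le_anti; rewrite W0 Wx0.
  change (0 = \int[mu]_t F (t, x)).
  apply/esym/integral0_eq => t _.
  by rewrite /F indicE memNset//= /A /= => -[].
rewrite E1 E2; exact: fubini_tonelli.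
Qed.

(** Each layer of the segment is the affine image of a measurable set of abscissae, so
    [hausdorff1_affine_ge] bounds it by a Lebesgue measure; [integral_superlevel] then exchanges
    levels and abscissae. *)
Lemma gauss_H1_integral_segment_ge (c m a b : R) (G g : R -> R) : (a <= b)%R ->
  (forall x : R, (a <= x <= b)%R -> is_derive x 1%R G (g x)) -> continuous g ->
  (forall x, (a <= x <= b)%R ->
     (g x <= gauss_w (x, c + m * x) * Num.sqrt (1 + m ^+ 2))%R) ->
  (G b - G a)%:E <= gauss_H1_integral (graph_on (fun x => c + m * x)%R a b).
Proof.
move=> ab Gg cg gW.
have [ab'|] := ltP a b; last first.
  move=> ba; have -> : a = b by apply/le_anti; rewrite ab.
  by rewrite subrr gauss_H1_integral_ge0.
pose W x := gauss_w (x, c + m * x)%R.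
pose V := Num.sqrt (1 + m ^+ 2)%R.
have V0 : (0 <= V)%R by exact: sqrtr_ge0.
have cW : continuous W.
  suff cW x0 : {for x0, continuous W} by move=> x0; exact: cW.
  have -> : W = fun x => expR (- (x * x + (c + m * x) * (c + m * x)) / 2)%R.
    by apply/funext => x; rewrite /W gauss_wE/= !expr2.
  apply: (@continuous_comp _ _ _ _ expR); last exact: continuous_expR.
  apply: cvgM; last exact: cvg_cst.
  have cl : (c + m * x)%R @[x --> x0] --> (c + m * x0)%R.
    by apply: cvgD; [exact: cvg_cst|apply: cvgM; [exact: cvg_cst|exact: cvg_id]].
  by apply: cvgN; apply: cvgD; apply: cvgM.
have W0 x : (0 <= W x)%R by rewrite ltW// gauss_w_gt0.
have mW : measurable_fun [set: R] W by exact: continuous_measurable_fun.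
apply: (@le_trans _ _ (\int[mu]_(x in `[a, b]) (g x)%:E)).
  rewrite (@continuous_FTC2 _ g G a b ab')//.
  - by apply: continuous_subspaceT => x; exact: cg.
  - have cG x : (a <= x <= b)%R -> {for x, continuous G}.
      by move=> /Gg; exact: is_derive_continuous.
    split.
    + move=> x; rewrite in_itv/= => /andP[ax xb].
      have /Gg h : (a <= x <= b)%R by rewrite !ltW.
      exact: ex_derive.
    + by apply: cvg_at_right_filter; apply: cG; rewrite lexx ltW.
    + by apply: cvg_at_left_filter; apply: cG; rewrite lexx ltW.
  - move=> x; rewrite in_itv/= => /andP[ax xb]; rewrite derive1E.
    have /Gg h : (a <= x <= b)%R by rewrite !ltW.
    exact: derive_val.
have ig (h : R -> R) : continuous h -> mu.-integrable `[a, b] (EFin \o h).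
  move=> ch; apply: continuous_compact_integrable; first exact: segment_compact.
  by apply: continuous_subspaceT => x; exact: ch.
apply: (@le_trans _ _ (\int[mu]_(x in `[a, b]) (W x * V)%:E)).
  apply: le_integral => //; first exact: ig.
    by apply: ig => x; apply: cvgM; [exact: cW|exact: cvg_cst].
  by move=> x; rewrite inE/= in_itv/= => xab; rewrite lee_fin; exact: gW.
under eq_integral do rewrite EFinM muleC.
rewrite ge0_integralZl_EFin//; last 2 first.
  by move=> x _; rewrite lee_fin.
  by apply/measurable_EFinP; exact: measurable_funTS.
rewrite -integral_superlevel// -ge0_integralZl_EFin//; last first.
  apply: nonincreasing_emeasurable => // s t st; apply: le_measure; rewrite ?inE.
  - by apply: measurableI => //; exact: measurable_superlevel.
  - by apply: measurableI => //; exact: measurable_superlevel.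
  - by move=> x [xab /= tx]; split => //=; exact: le_lt_trans tx.
apply: ge0_le_integral => //.
- by move=> t _; rewrite mule_ge0// lee_fin.
- apply: measurable_funeM; apply: nonincreasing_emeasurable => // s t st.
  apply: le_measure; rewrite ?inE.
  - by apply: measurableI => //; exact: measurable_superlevel.
  - by apply: measurableI => //; exact: measurable_superlevel.
  - by move=> x [xab /= tx]; split => //=; exact: le_lt_trans tx.
- exact: measurable_hausdorff1_layer.
move=> t _.
rewrite (_ : V = enorm (1, m)%R); last by rewrite /enorm/= expr1n.
have mS : measurable (`[a, b] `&` [set x | (t < W x)%R]).
  by apply: measurableI => //; exact: measurable_superlevel.
apply: (le_trans (hausdorff1_affine_ge (0, c)%R (1, m)%R mS)).
apply: hausdorff1S => _ [x [/= xab tx] <-] /=.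
have -> : (0 + x * 1, c + x * m)%R = (x, c + m * x)%R.
  by rewrite add0r mulr1 [(x * m)%R]mulrC.
by split => //; exists x.
Qed.
End segment_lower_bound.

(** * Planar convex sets *)

Section planar_topology.
Context {R : realType}.
Implicit Types (A : set (R * R)) (z : R * R).

Lemma closure_boxP A z : closure A z <->
  forall e : R, 0 < e -> exists a, [/\ A a, `|a.1 - z.1| < e & `|a.2 - z.2| < e].
Proof.
split=> [Az e e0|Az B /nbhs_ballP[e /= e0 zB]].
  have [a [Aa [/= a1 a2]]] := Az _ (nbhsx_ballx z e e0).
  by exists a; rewrite distrC [`|a.2 - _|]distrC.
have [a [Aa a1 a2]] := Az _ e0; exists a; split => //; apply: zB.
by split; rewrite /ball/= distrC.
Qed.

Lemma interior_boxP A z : interior A z <->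
  exists2 e : R, 0 < e & forall a, `|a.1 - z.1| < e -> `|a.2 - z.2| < e -> A a.
Proof.
split=> [/nbhs_ballP[e /= e0 zA]|[e e0 zA]].
  by exists e => // a a1 a2; apply: zA; split; rewrite /ball/= distrC.
apply/nbhs_ballP; exists e => //= a [a1 a2].
by apply: zA; rewrite distrC.
Qed.

(** Points straight below [z] violate the support inequality. This places the new pieces of a
    competitor on its boundary. *)
Lemma bdry_supported_below A z (m : R) : A z ->
  (forall a, A a -> z.2 + m * (a.1 - z.1) <= a.2) -> bdry A z.
Proof.
move=> Az Am; split; first exact: subset_closure.
move=> /interior_boxP[e e0 zA].
have : A (z.1, z.2 - e / 2) by apply: zA => /=; rewrite ltr_norml; apply/andP; split; lra.
by move=> /Am /=; rewrite subrr mulr0; lra.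
Qed.

Lemma closure_convex A : convex_set2 A -> convex_set2 (closure A).
Proof.
move=> cA x y t /closure_boxP Ax /closure_boxP Ay /andP[t0 t1].
apply/closure_boxP => e e0.
have e20 : 0 < e / 2 by rewrite divr_gt0.
have [a [Aa a1 a2]] := Ax _ e20; have [b [Ab b1 b2]] := Ay _ e20.
have comb (u v u' v' : R) : `|u - u'| < e / 2 -> `|v - v'| < e / 2 ->
    `|(1 - t) * u + t * v - ((1 - t) * u' + t * v')| < e.
  move=> /ltW uu /ltW vv.
  have -> : (1 - t) * u + t * v - ((1 - t) * u' + t * v') =
      (1 - t) * (u - u') + t * (v - v') by ring.
  apply: (le_lt_trans (ler_normD _ _)); rewrite !normrM [`|t|]ger0_norm//.
  rewrite [`|1 - t|]ger0_norm ?subr_ge0//.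
  have := ler_wpM2l t0 vv; have t1' : 0 <= 1 - t by lra.
  by have := ler_wpM2l t1' uu; lra.
exists ((1 - t) * a.1 + t * b.1, (1 - t) * a.2 + t * b.2); split => /=.
- by apply: cA => //; rewrite t0.
- exact: comb.
- exact: comb.
Qed.

Lemma convex_vertical_section A (p q : R * R) (y : R) : convex_set2 A ->
  A p -> A q -> q.2 < y < p.2 ->
  exists2 t, 0 <= t <= 1 & A ((1 - t) * p.1 + t * q.1, y).
Proof.
move=> cA Ap Aq /andP[qy yp].
have pq : 0 < p.2 - q.2 by lra.
have t01 : 0 <= (p.2 - y) / (p.2 - q.2) <= 1.
  by rewrite divr_ge0 ?ler_pdivrMr//; lra.
exists ((p.2 - y) / (p.2 - q.2)) => //.
have := cA _ _ _ Ap Aq t01; congr (A (_, _)).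
by field; rewrite gt_eqF.
Qed.

(** The horizontal through [z] meets the segment [p1 p4] to the right of [z] and [p2 p3] to the
    left, and [z] lies between the two intersections. *)
Lemma convex_quadrants_mem A z (p1 p2 p3 p4 : R * R) : convex_set2 A ->
  A p1 -> A p2 -> A p3 -> A p4 ->
  z.1 < p1.1 -> z.2 < p1.2 -> p2.1 < z.1 -> z.2 < p2.2 ->
  p3.1 < z.1 -> p3.2 < z.2 -> z.1 < p4.1 -> p4.2 < z.2 -> A z.
Proof.
move=> cA A1 A2 A3 A4 z11 z12 z21 z22 z31 z32 z41 z42.
have [|t /andP[t0 t1] Ar] := convex_vertical_section (y := z.2) cA A1 A4.
  by rewrite z42.
have [|u /andP[u0 u1] Al] := convex_vertical_section (y := z.2) cA A2 A3.
  by rewrite z32.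
set r := (1 - t) * _ + _ in Ar; set l := (1 - u) * _ + _ in Al.
have comb (c x y v : R) : 0 <= v -> v <= 1 -> c < x -> c < y -> c < (1 - v) * x + v * y.
  move=> v0 v1 cx cy; have v1' : 0 <= 1 - v by lra.
  have cm : c < Num.min x y by rewrite lt_min cx.
  have mx : Num.min x y <= x by rewrite ge_min lexx.
  have my : Num.min x y <= y by rewrite ge_min lexx orbT.
  by have := ler_wpM2l v1' mx; have := ler_wpM2l v0 my; lra.
have zr : z.1 < r by exact: comb.
have lz : - z.1 < (1 - u) * - p2.1 + u * - p3.1 by apply: comb; lra.
have {}lz : l < z.1 by move: lz; rewrite /l; lra.
have lr : 0 < r - l by lra.
have s01 : 0 <= (z.1 - l) / (r - l) <= 1.
  by rewrite divr_ge0 ?ler_pdivrMr//; lra.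
have := cA _ _ _ Al Ar s01; rewrite /= [z in _ -> A z]surjective_pairing.
by congr (A (_, _)); field; rewrite gt_eqF.
Qed.

(** Lying in an open quadrant survives small moves of the point and of [z]: the four witnesses may
    be moved into [A], and [z] to its neighbours. By contraposition, the closure misses a whole open
    quadrant at every boundary point. *)
Lemma interior_quadrants A z : convex_set2 A ->
  (forall s1 s2 : bool, exists a, [/\ closure A a,
     0 < (-1) ^+ s1 * (a.1 - z.1) & 0 < (-1) ^+ s2 * (a.2 - z.2)]) ->
  interior A z.
Proof.
move=> cA Q.
have Q' (s1 s2 : bool) : exists e a, [/\ 0 < e, A a,
    e <= (-1) ^+ s1 * (a.1 - z.1) & e <= (-1) ^+ s2 * (a.2 - z.2)].
  have [a [/closure_boxP cAa a1 a2]] := Q s1 s2.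
  pose e := Num.min ((-1) ^+ s1 * (a.1 - z.1)) ((-1) ^+ s2 * (a.2 - z.2)) / 2.
  have e0 : 0 < e by rewrite divr_gt0// lt_min a1.
  have e1 : 2 * e <= (-1) ^+ s1 * (a.1 - z.1) by rewrite mulrC divfK// ge_min lexx.
  have e2 : 2 * e <= (-1) ^+ s2 * (a.2 - z.2) by rewrite mulrC divfK// ge_min lexx orbT.
  have [b [Ab b1 b2]] := cAa _ e0; exists e, b; split => //.
    by move: b1 e1; rewrite ltr_norml => /andP[? ?]; case: (s1); rewrite ?expr1 ?expr0; lra.
  by move: b2 e2; rewrite ltr_norml => /andP[? ?]; case: (s2); rewrite ?expr1 ?expr0; lra.
have [e1 [p1 [e10 A1 p11 p12]]] := Q' false false.
have [e2 [p2 [e20 A2 p21 p22]]] := Q' true false.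
have [e3 [p3 [e30 A3 p31 p32]]] := Q' true true.
have [e4 [p4 [e40 A4 p41 p42]]] := Q' false true.
move: p11 p12 p21 p22 p31 p32 p41 p42; rewrite !expr0 !expr1 !mulN1r !mul1r.
move=> p11 p12 p21 p22 p31 p32 p41 p42.
apply/interior_boxP; exists (Num.min (Num.min e1 e2) (Num.min e3 e4)).
  by rewrite !lt_min e10 e20 e30.
move=> a; rewrite !lt_min => /andP[/andP[+ +] /andP[+ +]] /andP[/andP[+ +] /andP[+ +]].
rewrite !ltr_norml => /andP[? ?] /andP[? ?] /andP[? ?] /andP[? ?].
move=> /andP[? ?] /andP[? ?] /andP[? ?] /andP[? ?].
by apply: (convex_quadrants_mem (p1 := p1) (p2 := p2) (p3 := p3) (p4 := p4)) => //; lra.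
Qed.

(** The corners of a box contained in the closure are the four witnesses. Competitors can thus be
    built from the closure. *)
Lemma interior_closure_convex A z : convex_set2 A ->
  interior (closure A) z -> interior A z.
Proof.
move=> cA /interior_boxP[e e0 zA]; apply: interior_quadrants => // s1 s2.
exists (z.1 + (-1) ^+ s1 * (e / 2), z.2 + (-1) ^+ s2 * (e / 2)); split => /=.
- apply: zA => /=; rewrite addrC addKr normrM normrX normrN1 expr1n mul1r ger0_norm; lra.
- by rewrite addrC addKr mulrA -expr2 sqrr_sign mul1r; lra.
- by rewrite addrC addKr mulrA -expr2 sqrr_sign mul1r; lra.
Qed.

(** A competitor keeps the boundary points near which it agrees with the closure, since by convexity
    the closure has no more interior than [A]. *)
Lemma bdry_local A D z (e : R) : convex_set2 A -> 0 < e ->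
  (forall a, `|a.1 - z.1| < e -> `|a.2 - z.2| < e -> D a <-> closure A a) ->
  bdry A z -> bdry D z.
Proof.
move=> cA e0 DA [Az nAz].
have Dz : D z by apply/DA => //; rewrite subrr normr0.
split; first exact: subset_closure.
move=> /interior_boxP[d d0 zD]; apply: nAz; apply: interior_closure_convex => //.
apply/interior_boxP; exists (Num.min d e); first by rewrite lt_min d0.
move=> a; rewrite !lt_min => /andP[ad ae] /andP[ad' ae'].
by apply/DA => //; exact: zD.
Qed.

(** Twice the signed area of the triangle [p q z], positive when [z] is to the left of the line from
    [p] to [q]. *)
Definition cross3 (p q z : R * R) : R :=
  (q.1 - p.1) * (z.2 - p.2) - (q.2 - p.2) * (z.1 - p.1).

(** The three signed areas are barycentric coordinates of [z] up to normalization; the combination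
    is taken first on the side [q r], then towards [p]. *)
Lemma convex_triangle_mem A (p q r z : R * R) : convex_set2 A ->
  A p -> A q -> A r ->
  0 < cross3 p q z -> 0 < cross3 q r z -> 0 < cross3 r p z -> A z.
Proof.
move=> cA Ap Aq Ar pq qr rp.
pose al := cross3 q r z; pose be := cross3 r p z; pose ga := cross3 p q z.
have E1 : al * p.1 + be * q.1 + ga * r.1 = (al + (be + ga)) * z.1.
  by rewrite /al /be /ga /cross3; ring.
have E2 : al * p.2 + be * q.2 + ga * r.2 = (al + (be + ga)) * z.2.
  by rewrite /al /be /ga /cross3; ring.
move: (al) (be) (ga) (qr : 0 < al) (rp : 0 < be) (pq : 0 < ga) E1 E2.
move=> {pq qr rp}{al be ga} al be ga al0 be0 ga0 E1 E2.
have bg : 0 < be + ga by rewrite addr_gt0.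
have abg : 0 < al + (be + ga) by rewrite addr_gt0.
have t01 : 0 <= ga / (be + ga) <= 1.
  by rewrite divr_ge0 ?(ltW ga0) ?(ltW bg)//= ler_pdivrMr// mul1r lerDr ltW.
have s01 : 0 <= (be + ga) / (al + (be + ga)) <= 1.
  by rewrite divr_ge0 ?(ltW abg) ?(ltW bg)//= ler_pdivrMr// mul1r lerDr ltW.
have bg0 : be + ga != 0 by rewrite gt_eqF.
have abg0 : al + (be + ga) != 0 by rewrite gt_eqF.
have comb (x y w v : R) : al * x + be * y + ga * w = (al + (be + ga)) * v ->
    (1 - (be + ga) / (al + (be + ga))) * x + (be + ga) / (al + (be + ga)) *
      ((1 - ga / (be + ga)) * y + ga / (be + ga) * w) = v.
  move=> E; apply: (mulfI abg0); rewrite -E; field.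
  by rewrite bg0 abg0.
have := cA _ _ _ Ap (cA _ _ _ Aq Ar t01) s01.
by rewrite /= (comb _ _ _ _ E1) (comb _ _ _ _ E2) -surjective_pairing.
Qed.

Lemma cross3_near p q z (e : R) : 0 < cross3 p q z ->
  exists2 d : R, 0 < d &
    forall a, `|a.1 - z.1| < d -> `|a.2 - z.2| < d -> 0 < cross3 p q a.
Proof.
move=> c0; pose K := `|q.1 - p.1| + `|q.2 - p.2| + 1.
have K0 : 0 < K by rewrite ltr_wpDl// addr_ge0.
exists (cross3 p q z / K); first exact: divr_gt0.
set d := _ / K => a a1 a2.
have -> : cross3 p q a = d * K +
   ((q.1 - p.1) * (a.2 - z.2) - (q.2 - p.2) * (a.1 - z.1)).
  by rewrite /d divfK ?gt_eqF// /cross3; ring.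
have d0 : 0 < d by rewrite divr_gt0.
have h1 : `|(q.1 - p.1) * (a.2 - z.2)| <= `|q.1 - p.1| * d by rewrite normrM ler_wpM2l// ltW.
have h2 : `|(q.2 - p.2) * (a.1 - z.1)| <= `|q.2 - p.2| * d by rewrite normrM ler_wpM2l// ltW.
move: h1 h2; rewrite !ler_norml => /andP[h1 _] /andP[_ h2].
by rewrite /K; nra.
Qed.

Lemma interior_triangle A (p q r z : R * R) : convex_set2 A ->
  closure A p -> closure A q -> closure A r ->
  0 < cross3 p q z -> 0 < cross3 q r z -> 0 < cross3 r p z -> interior A z.
Proof.
move=> cA Ap Aq Ar /(cross3_near 0)[d1 d10 D1] /(cross3_near 0)[d2 d20 D2].
move=> /(cross3_near 0)[d3 d30 D3].
apply: interior_closure_convex => //; apply/interior_boxP.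
exists (Num.min d1 (Num.min d2 d3)); first by rewrite !lt_min d10 d20.
move=> a; rewrite !lt_min => /and3P[? ? ?] /and3P[? ? ?].
apply: (convex_triangle_mem (p := p) (q := q) (r := r)) => //.
- exact: closure_convex.
- exact: D1.
- exact: D2.
- exact: D3.
Qed.

(* Two boundary points with the same missed quadrant are in anti-monotone position,
   so a signed sum of the coordinates is a 1-Lipschitz parameter. *)
Lemma hausdorff1_bdry_box A (r : R) : convex_set2 A -> 0 <= r ->
  (hausdorff1 (bdry A `&` [set z | (`|z.1| <= r)%R /\ (`|z.2| <= r)%R]) <= (16 * r)%:E)%E.
Proof.
move=> cA r0.
pose B (s1 s2 : bool) := [set z | [/\ bdry A z, `|z.1| <= r, `|z.2| <= r &
  forall a, closure A a ->
    ~ (0 < (-1) ^+ s1 * (a.1 - z.1) /\ 0 < (-1) ^+ s2 * (a.2 - z.2))]].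
have HB s1 s2 : (hausdorff1 (B s1 s2) <= (4 * r)%:E)%E.
  (* In the box the signed sum ranges over [[- 2 * r, 2 * r]]. *)
  have -> : 4 * r = 1 * (2 * r - - (2 * r)) by ring.
  apply: (@hausdorff1_lipschitz_param _ _
    (fun z => (-1) ^+ s1 * z.1 - (-1) ^+ s2 * z.2)) => //; first lra.
    move=> z [_ + + _]; rewrite !ler_norml => /andP[? ?] /andP[? ?].
    by case: s1; case: s2; rewrite ?expr1 ?expr0; apply/andP; split; lra.
  move=> x y [[cx _] _ _ Qx] [[cy _] _ _ Qy]; rewrite mul1r.
  apply: (le_trans (edist_le_l1 _ _)).
  have sg (s : bool) (u : R) : `|u| = `|(-1) ^+ s * u|.
    by rewrite normrM normrX normrN1 expr1n mul1r.
  rewrite (sg s1) (sg s2).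
  have -> : (-1) ^+ s1 * x.1 - (-1) ^+ s2 * x.2 - ((-1) ^+ s1 * y.1 - (-1) ^+ s2 * y.2)
    = (-1) ^+ s1 * (x.1 - y.1) - (-1) ^+ s2 * (x.2 - y.2) by ring.
  have := Qx _ cy; rewrite -(opprB x.1) -(opprB x.2) !mulrN.
  have := Qy _ cx.
  set u := _ * (x.1 - _); set v := _ * (x.2 - _) => nuv nuv'.
  (* If [u] and [v] had the same strict sign, one point would lie in the quadrant missed at the
     other; otherwise [|u| + |v| = |u - v|]. *)
  have [u0|u0] := lerP 0 u; have [v0|v0] := lerP 0 v.
  - have : u = 0 \/ v = 0.
      have [->|u1] := eqVneq u 0; first by left.
      have [->|v1] := eqVneq v 0; first by right.
      by exfalso; apply: nuv; split; rewrite lt_def ?u0 ?v0 ?u1 ?v1.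
    by case=> ->; rewrite ?sub0r ?subr0 ?normrN normr0 ?addr0 ?add0r.
  - by rewrite (ger0_norm u0) (ltr0_norm v0) ger0_norm; lra.
  - by rewrite (ltr0_norm u0) (ger0_norm v0) ler0_norm; lra.
  - by exfalso; apply: nuv'; split; lra.
apply: (@le_trans _ _ (hausdorff1 ((B false false `|` B false true) `|`
    (B true false `|` B true true)))).
  apply: hausdorff1S => z [bz [z1 z2]].
  have [s1 [s2 Qs]] : exists s1 s2 : bool, forall a, closure A a ->
      ~ (0 < (-1) ^+ s1 * (a.1 - z.1) /\ 0 < (-1) ^+ s2 * (a.2 - z.2)).
    apply: contrapT => nQ; case: bz => _; apply; apply: interior_quadrants => // s1 s2.
    apply: contrapT => na; apply: nQ; exists s1, s2 => a ca [a1 a2].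
    by apply: na; exists a.
  by case: s1 s2 Qs => -[] Qs; [right; right|right; left|left; right|left; left]; split.
have -> : (16 * r)%:E = ((4 * r)%:E + (4 * r)%:E + ((4 * r)%:E + (4 * r)%:E))%E.
  by rewrite -!EFinD; congr EFin; ring.
by apply: (le_trans (hausdorff1U _ _)); apply: leeD;
  apply: (le_trans (hausdorff1U _ _)); apply: leeD.
Qed.

Lemma gauss_H1_integral_bdry_lty A : convex_set2 A ->
  (gauss_H1_integral (bdry A) < +oo)%E.
Proof.
move=> cA; apply: (@gauss_H1_integral_lty _ _ 16) => // r r0.
exact: hausdorff1_bdry_box.
Qed.

End planar_topology.

(** * The two competitors *)

Section convex_arc.
Context {R : realType}.
Variables (Om : set (R * R)) (f f1 : R -> R) (a0 b0 : R).
Hypothesis cOm : convex_set2 Om.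
Hypothesis ff1 : forall x, a0 < x < b0 -> is_derive x 1 f (f1 x).
Hypothesis f1_incr : forall x y, a0 < x -> x < y -> y < b0 -> f1 x < f1 y.
Hypothesis f_bdry : forall x, a0 < x < b0 -> bdry Om (x, f x).
Local Notation K := (closure Om).

Let f1_le x y : a0 < x -> x <= y -> y < b0 -> f1 x <= f1 y.
Proof.
move=> ax; rewrite le_eqVlt => /orP[/eqP ->//|xy] yb.
by apply: ltW; exact: f1_incr.
Qed.

Lemma arc_above_tangent x y : a0 < x < b0 -> a0 < y < b0 -> x != y ->
  f x + f1 x * (y - x) < f y.
Proof.
move=> /andP[ax xb] /andP[ay yb] xy.
(* [MVT_cc] may return an end point, where slopes need not differ strictly. Halving the interval
   gives a strict inequality on the half away from [x]. *)
have [m Em] : exists m, 2 * m = x + y by exists ((x + y) / 2); lra.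
have [xlt|ylt|/eqP] := ltgtP x y; last by rewrite (negbTE xy).
  have [||c /andP[xc cm] E1] := @MVT_cc _ f f1 x m; first lra.
    by move=> z ?; apply: ff1; lra.
  have [||d /andP[md dy] E2] := @MVT_cc _ f f1 m y; first lra.
    by move=> z ?; apply: ff1; lra.
  have h1 : f1 x <= f1 c by apply: f1_le; lra.
  have h2 : f1 x < f1 d by apply: f1_incr; lra.
  by nra.
have [||c /andP[xc cm] E1] := @MVT_cc _ f f1 y m; first lra.
  by move=> z ?; apply: ff1; lra.
have [||d /andP[md dy] E2] := @MVT_cc _ f f1 m x; first lra.
  by move=> z ?; apply: ff1; lra.
have h1 : f1 c < f1 x by apply: f1_incr; lra.
have h2 : f1 d <= f1 x by apply: f1_le; lra.
by nra.
Qed.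

(* A point of the closure strictly below a tangent would, together with two nearby
   arc points, enclose the tangency point. *)
Lemma closure_above_tangent s z : a0 < s < b0 -> K z ->
  f s + f1 s * (z.1 - s) <= z.2.
Proof.
move=> sab Kz; rewrite leNgt; apply/negP => zs.
have [_] := f_bdry sab; apply.
pose D := f s + f1 s * (z.1 - s) - z.2.
have D0 : 0 < D by rewrite subr_gt0.
pose u := z.1 - s.
(* This tolerance makes [|u|] times the remainder of [f] at distance [tau] smaller than [D * tau];
   these are the two competing terms in the cross products below. *)
have e0 : 0 < D / (2 * (`|u| + 1)) by rewrite divr_gt0// mulr_gt0// ltr_wpDl.
have [d d0 dP] := is_derive_delta (ff1 sab) e0.
move/andP: sab => [as_ sb].
pose tau := Num.min (d / 2) (Num.min ((s - a0) / 2) ((b0 - s) / 2)).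
have t0 : 0 < tau by rewrite !lt_min !divr_gt0//; lra.
have [td ta tb] : [/\ tau <= d / 2, tau <= (s - a0) / 2 & tau <= (b0 - s) / 2].
  by rewrite !ge_min !lexx !orbT.
have small v : `|v| = tau -> `|u| * `|f (s + v) - f s - f1 s * v| < D * tau.
  move=> vt; have td' : tau < d by lra.
  have := dP (s + v); rewrite (_ : s + v - s = v) ?vt; last by ring.
  move => /(_ td') h; apply: (@le_lt_trans _ _ (`|u| * (D / (2 * (`|u| + 1)) * tau))).
    by rewrite ler_wpM2l.
  rewrite mulrA ltr_pM2r// mulrCA gtr_pMr//.
  by rewrite ltr_pdivrMr ?mul1r ?mulr_gt0 ?ltr_wpDl//; have := normr_ge0 u; lra.
have cp v : `|v| = tau -> 0 < f (s + v) - f s - f1 s * v.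
  move=> vt; have v0 : v != 0 by rewrite -normr_gt0 vt.
  have := @arc_above_tangent s (s + v); rewrite (_ : s + v - s = v); last by ring.
  have vtau : - tau <= v <= tau by rewrite -ler_norml vt.
  move=> h; rewrite subr_gt0 ltrBrDl h//; first lra; first lra.
  by rewrite -subr_eq0 opprD addrA subrr sub0r oppr_eq0.
have nt : `|- tau| = tau by rewrite normrN gtr0_norm.
have pt : `|tau| = tau by rewrite gtr0_norm.
have := small _ nt; have := small _ pt; have := cp _ nt; have := cp _ pt.
set rp := f (s + tau) - f s - f1 s * tau.
set rm := f (s + - tau) - f s - f1 s * - tau => rp0 rm0.
rewrite (gtr0_norm rp0) (gtr0_norm rm0) => hp hm.
have ul : - `|u| <= u by rewrite lerNl ler_normr lexx orbT.
have ur : u <= `|u| by exact: ler_norm.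
apply: (interior_triangle cOm (p := z) (q := (s + tau, f (s + tau)))
    (r := (s - tau, f (s - tau)))) => //.
- by case: (f_bdry (x := s + tau)) => //; lra.
- by case: (f_bdry (x := s - tau)) => //; lra.
- have -> : cross3 z (s + tau, f (s + tau)) (s, f s) = D * tau + u * rp.
    by rewrite /cross3 /rp /D /u /=; ring.
  by have := ler_wpM2r (ltW rp0) ul; lra.
- have -> : cross3 (s + tau, f (s + tau)) (s - tau, f (s - tau)) (s, f s) = tau * (rp + rm).
    by rewrite /cross3 /rp /rm /=; ring.
  by rewrite mulr_gt0// addr_gt0.
- have -> : cross3 (s - tau, f (s - tau)) z (s, f s) = D * tau - u * rm.
    by rewrite /cross3 /rm /D /u /=; ring.
  by have := ler_wpM2r (ltW rm0) ur; lra.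
Qed.

End convex_arc.

(** The intercept is isolated to match the form [c + m * x] of the segment bound. *)
Definition line {R : realType} (x0 y0 m : R) (x : R) : R := (y0 - m * x0) + m * x.

Section competitors.
Context {R : realType}.
Variables (Om : set (R * R)) (f f1 : R -> R) (a0 b0 : R).
Hypothesis cOm : convex_set2 Om.
Hypothesis ff1 : forall x, a0 < x < b0 -> is_derive x 1 f (f1 x).
Hypothesis f1_incr : forall x y, a0 < x -> x < y -> y < b0 -> f1 x < f1 y.
Hypothesis f_bdry : forall x, a0 < x < b0 -> bdry Om (x, f x).
Hypothesis Om_max : forall D : set (R * R), convex_set2 D ->
  (gauss_H1_integral (bdry D) <= gauss_H1_integral (bdry Om))%E.
Local Notation K := (closure Om).
Let tangent := arc_above_tangent ff1 f1_incr.
Let support := closure_above_tangent cOm ff1 f1_incr f_bdry.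

Variables (a' a b b' : R).
Hypotheses (a0a' : a0 < a') (a'a : a' < a) (ab : a < b) (bb' : b < b') (b'b0 : b' < b0).

(* [lra] ignores section hypotheses; these tactics copy them to the local context. *)
Ltac endpoints := move: (a0a') (a'a) (ab) (bb') (b'b0) => ? ? ? ? ?.

Let ina' : a0 < a' < b0. Proof. by endpoints; apply/andP; split; lra. Qed.
Let ina : a0 < a < b0. Proof. by endpoints; apply/andP; split; lra. Qed.
Let inb : a0 < b < b0. Proof. by endpoints; apply/andP; split; lra. Qed.
Let inb' : a0 < b' < b0. Proof. by endpoints; apply/andP; split; lra. Qed.
Let ba0 : 0 < b - a. Proof. by rewrite subr_gt0. Qed.

Definition chord_slope : R := (f b - f a) / (b - a).
Let mk := chord_slope.
Let mkE : f b = f a + mk * (b - a).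
Proof. by rewrite /mk /chord_slope divfK ?gt_eqF//; ring. Qed.

(** Heights over the chord line and over the two end tangents; being affine, they commute with
    convex combinations. *)
Let L (z : R * R) := z.2 - line a (f a) mk z.1.
Let Na (z : R * R) := z.2 - line a (f a) (f1 a) z.1.
Let Nb (z : R * R) := z.2 - line b (f b) (f1 b) z.1.

Let famk : f1 a < mk.
Proof.
have := tangent ina inb (negbT (lt_eqF ab)); rewrite mkE ltrD2l.
by rewrite ltr_pM2r.
Qed.

Let mkfb : mk < f1 b.
Proof.
endpoints; have := tangent inb ina (negbT (gt_eqF ab)); rewrite mkE => h.
rewrite -(ltr_pM2r ba0); lra.
Qed.

Ltac facts := endpoints; move: (famk) (mkfb) => ? ?.

Let La' : 0 < L (a', f a').
Proof.
facts; have := tangent ina ina' (negbT (gt_eqF a'a)); rewrite /L /line/= => h.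
have : (mk - f1 a) * (a' - a) < 0 by rewrite pmulr_rlt0; lra.
by lra.
Qed.

Let Lb' : 0 < L (b', f b').
Proof.
facts; have := tangent inb inb' (negbT (lt_eqF bb')); rewrite /L /line/= mkE => h.
have : 0 < (f1 b - mk) * (b' - b) by rewrite mulr_gt0; lra.
by lra.
Qed.

(** Outside the strip between [a'] and [b'], the support line at the nearer end keeps the point too
    high over the chord. Inside the strip, a point above the arc is interior to the triangle on two
    end points and the arc point below it. *)
Let arc_exhausted z : bdry Om z -> L z < L (a', f a') -> L z < L (b', f b') ->
  graph_on f a' b' z.
Proof.
facts; move=> [Kz nz] za' zb'.
have a'z : a' < z.1.
  rewrite ltNge; apply/negP => za.
  have h1 : f1 a' < f1 a by apply: f1_incr; lra.
  have := support ina' Kz.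
  have : 0 <= (mk - f1 a') * (a' - z.1) by rewrite mulr_ge0; lra.
  by move: za'; rewrite /L /line/=; lra.
have zb : z.1 < b'.
  rewrite ltNge; apply/negP => bz.
  have h1 : f1 b < f1 b' by apply: f1_incr; lra.
  have := support inb' Kz.
  have : 0 <= (f1 b' - mk) * (z.1 - b') by rewrite mulr_ge0; lra.
  by move: zb'; rewrite /L /line/=; lra.
have inz : a0 < z.1 < b0 by apply/andP; split; lra.
have := support inz Kz; rewrite subrr mulr0 addr0 le_eqVlt => /orP[/eqP fz|fz].
  by exists z.1; rewrite ?fz -?surjective_pairing//= in_itv/= !ltW.
exfalso; apply: nz.
apply: (interior_triangle cOm (p := (a', f a')) (q := (z.1, f z.1)) (r := (b', f b'))).
- by case: (f_bdry ina').
- by case: (f_bdry inz).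
- by case: (f_bdry inb').
- rewrite [X in 0 < X](_ : _ = (z.1 - a') * (z.2 - f z.1)); last by rewrite /cross3/=; ring.
  by rewrite mulr_gt0 ?subr_gt0.
- rewrite [X in 0 < X](_ : _ = (b' - z.1) * (z.2 - f z.1)); last by rewrite /cross3/=; ring.
  by rewrite mulr_gt0 ?subr_gt0.
- rewrite [X in 0 < X](_ : _ = (b' - z.1) * (L (a', f a') - L z) +
      (z.1 - a') * (L (b', f b') - L z)); last by rewrite /cross3 /L /line/=; ring.
  by rewrite addr_gt0// mulr_gt0 ?subr_gt0.
Qed.

(** Let [A] be the part of the boundary of [Om] at height at least [c] over the chord. It survives
    in the boundary of [D], at positive distance from [S], while the rest of the boundary of [Om]
    lies on the arc. Hence length [A] plus length [S] is at most length [A] plus length of the arc,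
    and finiteness allows [A] to be cancelled. *)
Let competitor_le (D S : set (R * R)) : convex_set2 D ->
  (forall z, 0 < L z -> D z <-> K z) -> S `<=` bdry D -> (forall z, S z -> L z <= 0) ->
  (gauss_H1_integral S <= gauss_H1_integral (graph_on f a' b'))%E.
Proof.
move=> cD DK SD SL.
pose c := Num.min (L (a', f a')) (L (b', f b')).
have c0 : 0 < c by rewrite lt_min La' Lb'.
pose M := 1 + `|mk|.
have M0 : 0 < M by rewrite ltr_pwDl.
pose A := bdry Om `&` [set z | c <= L z].
have LM (x y : R * R) : L x - L y <= `|x.2 - y.2| + `|mk| * `|x.1 - y.1|.
  have -> : L x - L y = (x.2 - y.2) + - (mk * (x.1 - y.1)) by rewrite /L /line; ring.
  by rewrite lerD ?ler_norm// -normrM -normrN ler_norm.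
have AD : A `<=` bdry D.
  move=> z [bz /= cz]; apply: (bdry_local (e := c / M) cOm) bz; first exact: divr_gt0.
  move=> x x1 x2; apply: DK.
  have := LM z x; rewrite distrC [`|z.1 - _|]distrC => h.
  have : `|mk| * `|x.1 - z.1| <= `|mk| * (c / M) by rewrite ler_wpM2l// ltW.
  have : c / M * M = c by rewrite divfK// gt_eqF.
  by rewrite {2}/M; lra.
have AS : (gauss_H1_integral A + gauss_H1_integral S <= gauss_H1_integral (A `|` S))%E.
  (* [M] is a Lipschitz constant of [L], so the distance is at least [c / M]; the factor 2 makes the
     inequality strict. *)
  apply: (@gauss_H1_integralU_separated _ (c / (2 * M))).
    by rewrite divr_gt0// mulr_gt0.
  move=> x y [_ /= cx] /SL Ly; rewrite ltr_pdivrMr ?mulr_gt0//.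
  have := LM x y; have := fst_le_edist x y; have := snd_le_edist x y.
  move=> e2 e1; have := ler_wpM2l (normr_ge0 mk) e1.
  by rewrite /M; lra.
have Afin : gauss_H1_integral A \is a fin_num.
  rewrite ge0_fin_numE ?gauss_H1_integral_ge0//.
  apply: le_lt_trans (gauss_H1_integral_bdry_lty cOm).
  by apply: gauss_H1_integralS => z [].
rewrite -(leeD2lE _ _ Afin); apply: (le_trans AS).
apply: (@le_trans _ _ (gauss_H1_integral (bdry D))).
  by apply: gauss_H1_integralS => z [/AD|/SD].
apply: (le_trans (Om_max cD)); apply: le_trans (gauss_H1_integralU _ _).
apply: gauss_H1_integralS => z bz.
have [cz|zc] := leP c (L z); [by left|right].
by move: zc; rewrite lt_min => /andP[]; exact: arc_exhausted.
Qed.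

(* [D1] cuts [K] along the chord; [D2] adds the triangle between the chord and the
   tangents at its end points. *)
Let D1 := K `&` [set z | 0 <= L z].
Let Tri := [set z | [/\ L z <= 0, 0 <= Na z & 0 <= Nb z]].
Let D2 := D1 `|` Tri.
Local Notation comb x y t := (((1 - t) * x.1 + t * y.1), ((1 - t) * x.2 + t * y.2)).

Let L_comb x y t : L (comb x y t) = (1 - t) * L x + t * L y.
Proof. by rewrite /L /line/=; ring. Qed.
Let Na_comb x y t : Na (comb x y t) = (1 - t) * Na x + t * Na y.
Proof. by rewrite /Na /line/=; ring. Qed.
Let Nb_comb x y t : Nb (comb x y t) = (1 - t) * Nb x + t * Nb y.
Proof. by rewrite /Nb /line/=; ring. Qed.

Let comb_ge0 (u v t : R) : 0 <= t <= 1 -> 0 <= u -> 0 <= v -> 0 <= (1 - t) * u + t * v.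
Proof. by move=> /andP[t0 t1] u0 v0; rewrite addr_ge0// mulr_ge0// subr_ge0. Qed.

Let D1_convex : convex_set2 D1.
Proof.
move=> x y t [Kx /= Lx] [Ky /= Ly] t01; split; first exact: closure_convex.
by rewrite /= L_comb comb_ge0.
Qed.

Let D2_Na z : D2 z -> 0 <= Na z.
Proof. by move=> [[Kz _]|[]//]; rewrite /Na /line; have := support ina Kz; lra. Qed.

Let D2_Nb z : D2 z -> 0 <= Nb z.
Proof. by move=> [[Kz _]|[]//]; rewrite /Nb /line; have := support inb Kz; lra. Qed.

(** The chord slope lies strictly between the tangent slopes, so on the chord line the two tangent
    conditions cut out exactly the chord. *)
Let chord_mem z : L z = 0 -> 0 <= Na z -> 0 <= Nb z -> K z.
Proof.
facts; move=> Lz Naz Nbz.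
have az : a <= z.1.
  rewrite leNgt; apply/negP => za.
  have : (mk - f1 a) * (z.1 - a) < 0 by rewrite pmulr_rlt0; lra.
  by move: Lz Naz; rewrite /L /Na /line; lra.
have zb : z.1 <= b.
  rewrite leNgt; apply/negP => za.
  have : 0 < (f1 b - mk) * (z.1 - b) by rewrite mulr_gt0; lra.
  by move: Lz Nbz; rewrite /L /Nb /line mkE; lra.
have t01 : 0 <= (z.1 - a) / (b - a) <= 1.
  by rewrite divr_ge0 ?ler_pdivrMr ?mul1r//; lra.
have [Ka _] := f_bdry ina; have [Kb _] := f_bdry inb.
have := closure_convex cOm Ka Kb t01; rewrite /= [z in _ -> K z]surjective_pairing.
set t := _ / _; have tE : t * (b - a) = z.1 - a by rewrite divfK// gt_eqF.
congr (K (_, _)); first by lra.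
have -> : z.2 = f a + mk * (z.1 - a) by move: Lz; rewrite /L /line; lra.
by rewrite -tE mkE; ring.
Qed.

(** Only a segment from [D1] to the triangle needs care. It crosses the chord line above both
    tangents, hence in [K]; before the crossing it runs in [K], after it in the triangle. *)
Let D2_convex : convex_set2 D2.
Proof.
have mixed x y t : D1 x -> Tri y -> 0 <= t <= 1 -> D2 (comb x y t).
  move=> Dx Ty t01; have [Kx /= Lx] := Dx; have [Ly Nay Nby] := Ty.
  have Nax : 0 <= Na x by apply: D2_Na; left.
  have Nbx : 0 <= Nb x by apply: D2_Nb; left.
  have [Lc|Lc] := leP (L (comb x y t)) 0.
    by right; split => //; rewrite ?Na_comb ?Nb_comb comb_ge0.
  left; split; last exact: ltW.
  move: Lc; rewrite L_comb => Lc; move/andP: (t01) => [t0 t1].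
  have tLy : t * L y <= 0 by rewrite mulr_ge0_le0.
  have Lxy : 0 < L x - L y.
    rewrite subr_gt0 ltNge; apply/negP => xy.
    have Lx0 : L x = 0 by lra.
    by move: Lc; rewrite Lx0 mulr0 add0r; lra.
  (* The parameter at which [L] vanishes along the segment. *)
  pose r := L x / (L x - L y).
  have rE : r * (L x - L y) = L x by rewrite divfK// gt_eqF.
  have tr : t < r by rewrite ltr_pdivlMr//; lra.
  have r0 : 0 < r by lra.
  have r1 : r <= 1 by rewrite ler_pdivrMr//; lra.
  have r01 : 0 <= r <= 1 by rewrite (ltW r0).
  have Kc : K (comb x y r).
    apply: chord_mem; rewrite ?Na_comb ?Nb_comb ?comb_ge0// L_comb.
    by rewrite -[RHS](subrr (L x)) -{3}rE; ring.
  have tr01 : 0 <= t / r <= 1 by rewrite divr_ge0 ?(ltW r0)//= ler_pdivrMr// mul1r ltW.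
  have := closure_convex cOm Kx Kc tr01.
  by congr (K (_, _)); rewrite /=; field; rewrite gt_eqF.
move=> x y t [Dx|Tx] [Dy|Ty] t01.
- by left; exact: D1_convex.
- exact: mixed.
- have t01' : 0 <= 1 - t <= 1 by move/andP: t01 => [? ?]; apply/andP; split; lra.
  have := mixed _ _ _ Dy Tx t01'.
  by congr (D2 (_, _)); rewrite /=; ring.
- have [Lx Nax Nbx] := Tx; have [Ly Nay Nby] := Ty.
  right; split; rewrite ?Na_comb ?Nb_comb ?L_comb ?comb_ge0//.
  by rewrite -oppr_ge0 opprD -!mulrN comb_ge0// oppr_ge0.
Qed.

Lemma chord_le : (gauss_H1_integral (graph_on (line a (f a) mk) a b) <=
  gauss_H1_integral (graph_on f a' b'))%E.
Proof.
apply: (competitor_le D1_convex) => [z Lz|_ [x /= xab <-]|_ [x /= xab <-]].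
- by split => [[]|Kz] //; split => //=; exact: ltW.
- facts; move: xab; rewrite in_itv/= => /andP[ax xb].
  have Lx0 : L (x, line a (f a) mk x) = 0 by rewrite /L/= subrr.
  apply: (bdry_supported_below (m := mk)).
    split; last by rewrite /= Lx0.
    apply: chord_mem => //.
      have : 0 <= (mk - f1 a) * (x - a) by rewrite mulr_ge0; lra.
      by rewrite /Na /line/=; lra.
    have : 0 <= (f1 b - mk) * (b - x) by rewrite mulr_ge0; lra.
    by rewrite /Nb /line/= mkE; lra.
  by move=> z [_]; rewrite /L /line/=; lra.
- by rewrite /L /= subrr.
Qed.

(** [xq] is the abscissa of the corner. Omitting [d] on either side of it separates the two tangent
    segments, so their lengths may be added. *)
Lemma tangents_le xq d : 0 < d -> a <= xq - d -> xq + d <= b ->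
  line a (f a) (f1 a) xq = line b (f b) (f1 b) xq ->
  (gauss_H1_integral (graph_on (line a (f a) (f1 a)) a (xq - d)) +
   gauss_H1_integral (graph_on (line b (f b) (f1 b)) (xq + d) b) <=
  gauss_H1_integral (graph_on f a' b'))%E.
Proof.
move=> d0 axq xqb lq.
facts; have fab : f1 a < f1 b by apply: f1_incr; lra.
apply: (le_trans (@gauss_H1_integralU_separated _ d _ _ d0 _)).
  move=> _ _ [x /= + <-] [y /= + <-]; rewrite !in_itv/= => /andP[ax xq1] /andP[yq yb].
  apply: lt_le_trans (fst_le_edist _ _); rewrite /= distrC.
  by apply: lt_le_trans (ler_norm _); lra.
have inTa x : a <= x -> x <= xq -> Tri (x, line a (f a) (f1 a) x).
  move=> ax xq1; split.
  - have : 0 <= (mk - f1 a) * (x - a) by rewrite mulr_ge0; lra.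
    by rewrite /L /line/=; lra.
  - by rewrite /Na /= subrr.
  - have : 0 <= (f1 b - f1 a) * (xq - x) by rewrite mulr_ge0; lra.
    by move: lq; rewrite /Nb /line/=; lra.
have inTb x : xq <= x -> x <= b -> Tri (x, line b (f b) (f1 b) x).
  move=> ax xq1; split.
  - have : 0 <= (f1 b - mk) * (b - x) by rewrite mulr_ge0; lra.
    by rewrite /L /line/= mkE; lra.
  - have : 0 <= (f1 b - f1 a) * (x - xq) by rewrite mulr_ge0; lra.
    by move: lq; rewrite /Na /line/=; lra.
  - by rewrite /Nb /= subrr.
apply: (competitor_le D2_convex).
- move=> z Lz; split => [[[]//|[Lz' _ _]]|Kz]; first by lra.
  by left; split => //=; exact: ltW.
- move=> _ [|] [x /= + <-]; rewrite in_itv/= => /andP[ax xb].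
    apply: (bdry_supported_below (m := f1 a)); first by right; apply: inTa; lra.
    by move=> z /D2_Na; rewrite /Na /line/=; lra.
  apply: (bdry_supported_below (m := f1 b)); first by right; apply: inTb; lra.
  by move=> z /D2_Nb; rewrite /Nb /line/=; lra.
- move=> _ [|] [x /= + <-]; rewrite in_itv/= => /andP[ax xb].
    by have [] : Tri (x, line a (f a) (f1 a) x) by apply: inTa; lra.
  by have [] : Tri (x, line b (f b) (f1 b) x) by apply: inTb; lra.
Qed.

End competitors.

(** * Third-order comparison of the weighted lengths *)

Section elementary_bounds.
Context {R : realType}.

Lemma expR_le_inv (t : R) : t < 1 -> expR t <= (1 - t)^-1.
Proof.
move=> t1; have t0 : 0 < 1 - t by lra.
rewrite -[expR t]invrK -expRN lef_pV2 ?posrE ?expR_gt0//.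
exact: expR_ge1Dx.
Qed.

Lemma expR_le_quadratic (t : R) : t <= 1 / 2 -> expR t <= 1 + t + 2 * t ^+ 2.
Proof.
move=> t1; apply: (le_trans (expR_le_inv _)); first lra.
have t0 : 0 < 1 - t by lra.
rewrite -[leLHS]mul1r ler_pdivrMr//.
rewrite (_ : (1 + t + 2 * t ^+ 2) * (1 - t) = 1 + t ^+ 2 * (1 - 2 * t)); last by ring.
by rewrite lerDl mulr_ge0 ?sqr_ge0//; lra.
Qed.

Lemma sqrt_le_expR (p : R) : Num.sqrt (1 + p ^+ 2) <= expR (p ^+ 2 / 2).
Proof.
rewrite -(ger0_norm (expR_ge0 _)) -sqrtr_sqr ler_sqrt ?sqr_ge0//.
by rewrite [leRHS]expr2 -expRD -splitr expR_ge1Dx.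
Qed.

(** With [s = m ^+ 2], [exp (s - s^2) <= 1 / (1 - s + s^2) <= 1 + s], because
    [(1 + s) * (1 - s + s^2) = 1 + s^3]. The exponential form merges with the Gaussian weight. *)
Lemma sqrt_ge_expR (m : R) : expR ((m ^+ 2 - m ^+ 4) / 2) <= Num.sqrt (1 + m ^+ 2).
Proof.
rewrite -(ger0_norm (expR_ge0 _)) -sqrtr_sqr ler_sqrt ?addr_ge0 ?sqr_ge0//.
rewrite [leLHS]expr2 -expRD -splitr.
have -> : m ^+ 4 = (m ^+ 2) ^+ 2 by rewrite -exprM.
have := sqr_ge0 m; move: (m ^+ 2) => s s0.
apply: (le_trans (expR_le_inv _)); first by nra.
have t0 : 0 < 1 - (s - s ^+ 2) by nra.
rewrite -[leLHS]mul1r ler_pdivrMr//.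
rewrite (_ : (1 + s) * _ = 1 + s ^+ 3); last by ring.
by rewrite lerDl exprn_ge0.
Qed.

Lemma is_derive_cubic (al be ga x0 x : R) :
  is_derive x 1 (fun x => al * x + be * x ^+ 2 + ga * (x - x0) ^+ 3)
    (al + 2 * be * x + 3 * ga * (x - x0) ^+ 2).
Proof.
have h1 : is_derive x 1 (fun x : R => al * x) al.
  by apply: (is_derive_eq (is_deriveZ al (is_derive_id x (1 : R)))); rewrite /GRing.scale/= mulr1.
have h2 : is_derive x 1 (fun x : R => be * x ^+ 2) (2 * be * x).
  apply: (is_derive_eq (is_deriveZ be (is_deriveX 2 (is_derive_id x (1 : R))))).
  by rewrite /GRing.scale/=; ring.
have h3 : is_derive x 1 (fun x : R => ga * (x - x0) ^+ 3) (3 * ga * (x - x0) ^+ 2).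
  apply: (is_derive_eq (is_deriveZ ga (is_deriveX 3
    (is_deriveB (is_derive_id x (1 : R)) (is_derive_cst x0 x 1))))).
  by rewrite /GRing.scale/= subr0 mulr1 -[(id - cst x0) x]/(x - x0); ring.
exact: is_deriveD (is_deriveD h1 h2) h3.
Qed.

(* The mean value theorem is applied to [f - k (. - x0)^2 / 2]; its linear
   correction is written as a cubic to reuse [is_derive_cubic]. *)
Lemma second_order_expansion (f f1 : R -> R) (x0 k r : R) : 0 < r ->
  (forall x, `|x - x0| < r -> is_derive x 1 f (f1 x)) -> f1 x0 = 0 ->
  is_derive x0 1 f1 k ->
  forall e, 0 < e -> exists2 d, 0 < d & forall x, `|x - x0| < d ->
  `|f1 x - k * (x - x0)| <= e * `|x - x0| /\
  `|f x - f x0 - k / 2 * (x - x0) ^+ 2| <= e * (x - x0) ^+ 2.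
Proof.
move=> r0 ff1 f1x0 f1k e e0.
have [d1 d10 d1P] := is_derive_delta f1k e0.
exists (Num.min r d1); first by rewrite lt_min r0 d10.
move=> x; rewrite lt_min => /andP[xr xd1].
pose u := x - x0.
have p1 : `|f1 x - k * u| <= e * `|u| by have := d1P _ xd1; rewrite f1x0 subr0.
pose g x := f x - (- (k * x0) * x + k / 2 * x ^+ 2 + 0 * (x - x0) ^+ 3).
have gd z : `|z - x0| < r -> is_derive z 1 g (f1 z - k * (z - x0)).
  move=> /ff1 fz; apply: (is_derive_eq (is_deriveB fz (is_derive_cubic _ _ _ _ _))).
  by field.
have gE : g x - g x0 = f x - f x0 - k / 2 * u ^+ 2 by rewrite /g /u; field.
have [c cP fE] : exists2 c, `|c - x0| <= `|u| & g x - g x0 = (f1 c - k * (c - x0)) * u.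
  have [xx|xx] := leP x0 x.
    have [|c /andP[c1 c2] cE] := @MVT_cc _ g (fun z => f1 z - k * (z - x0)) x0 x xx.
      move=> z /andP[z1 z2]; apply: gd; apply: le_lt_trans xr.
      by rewrite !ger0_norm ?subr_ge0// lerD2r.
    by exists c; [rewrite !ger0_norm ?subr_ge0// lerD2r|rewrite cE].
  have [|c /andP[c1 c2] cE] := @MVT_cc _ g (fun z => f1 z - k * (z - x0)) x x0 (ltW xx).
    move=> z /andP[z1 z2]; apply: gd; apply: le_lt_trans xr.
    by rewrite !ler0_norm ?subr_le0 ?(ltW xx)// lerN2 lerD2r.
  exists c; first by rewrite !ler0_norm ?subr_le0 ?(ltW xx)// lerN2 lerD2r.
  by rewrite -opprB cE /u; ring.
have p2 : `|f1 c - k * (c - x0)| <= e * `|u|.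
  have := d1P c (le_lt_trans cP xd1); rewrite f1x0 subr0 => h.
  by apply: (le_trans h); rewrite ler_wpM2l// ltW.
split; first exact: p1.
by rewrite -gE fE normrM -(real_normK (num_real (x - x0))) expr2 mulrA ler_wpM2r.
Qed.

End elementary_bounds.

Section weight_expansion.
Context {R : realType}.
Variables (x0 y0 : R).

(** Reference density on the horizontal line at the height of the point. Arc and segments are
    expanded around it, so its primitive cancels in the end. *)
Definition base_weight (x : R) : R := gauss_w (x, y0).
Let w0 := base_weight x0.

Lemma base_weight_continuous : continuous base_weight.
Proof.
suff c x : {for x, continuous base_weight} by move=> x; exact: c.
have -> : base_weight = fun x => expR (- (x * x + y0 * y0) / 2).
  by apply/funext => z; rewrite /base_weight gauss_wE/= !expr2.
apply: (@continuous_comp _ _ _ _ expR); last exact: continuous_expR.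
apply: cvgM; last exact: cvg_cst.
by apply: cvgN; apply: cvgD; [apply: cvgM; exact: cvg_id|exact: cvg_cst].
Qed.

Lemma gauss_w_shift x l : gauss_w (x, y0 + l) =
  base_weight x * expR (- (y0 * l) - l ^+ 2 / 2).
Proof. by rewrite /base_weight !gauss_wE/= -expRD; congr expR; field. Qed.

(** The lower limit [x0 - 1] is arbitrary; small half-widths keep all abscissae to its right. *)
Lemma base_weight_primitive : exists Phi : R -> R,
  forall x : R, x0 - 1 < x -> is_derive x 1 Phi (base_weight x).
Proof.
exists (fun x => \int[@lebesgue_measure R]_(t in `[x0 - 1, x]) base_weight t)%R.
move=> x xx0; have xx1 : x < x + 1 by lra.
have ib : (@lebesgue_measure R).-integrable `[x0 - 1, x + 1] (EFin \o base_weight).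
  apply: continuous_compact_integrable; first exact: segment_compact.
  by apply: continuous_subspaceT => z; exact: base_weight_continuous.
have [d <-] := continuous_FTC1_closed xx1 ib xx0 (@base_weight_continuous x).
by rewrite derive1E; apply: DeriveDef.
Qed.

(* The constant is the limit of [log (gauss_w (x, f x) * sqrt (1 + f1 x ^+ 2) /
   base_weight x) / (x - x0) ^+ 2] for [f] with osculating parabola of curvature [k]. *)
Lemma arc_weight_le (f f1 : R -> R) (k r : R) : 0 < r ->
  (forall x, `|x - x0| < r -> is_derive x 1 f (f1 x)) -> f x0 = y0 -> f1 x0 = 0 ->
  is_derive x0 1 f1 k -> 0 < k ->
  forall eps, 0 < eps -> exists2 d, 0 < d & forall x, `|x - x0| < d ->
  gauss_w (x, f x) * Num.sqrt (1 + f1 x ^+ 2) <=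
  base_weight x + (w0 * (k ^+ 2 / 2 - y0 * k / 2) + eps) * (x - x0) ^+ 2.
Proof.
move=> r0 ff1 fx0 f1x0 f1k k0 eps eps0.
have w00 : 0 < w0 by exact: gauss_w_gt0.
have w01 : w0 <= 1 by exact: gauss_w_le1.
pose th := k ^+ 2 / 2 - y0 * k / 2.
pose C := `|y0| + k + 1.
have C0 : 0 < C by rewrite ltr_wpDl// addr_ge0// ltW.
pose B := `|th| + C.
have B0 : 0 < B by rewrite ltr_wpDl.
(* [M] collects the coefficients of [e] in the error terms [k1], [k2] and [k3]. *)
pose M := C + B + 2 * B ^+ 2.
have B20 : 0 < 2 * B ^+ 2 by rewrite mulr_gt0// exprn_gt0.
have M0 : 0 < M by rewrite /M; lra.
have [e [e0 e1 eM]] : exists e, [/\ 0 < e, e <= 1 & e * M <= eps].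
  exists (Num.min 1 (eps / M)); split.
  - by rewrite lt_min ltr01 divr_gt0.
  - by rewrite ge_min lexx.
  - by rewrite -ler_pdivlMr// ge_min lexx orbT.
have [d1 d10 d1P] := second_order_expansion r0 ff1 f1x0 f1k e0.
have [d2 d20 d2P] := continuous_delta (@base_weight_continuous x0) e0.
(* The bound [1 / (2 * B)] keeps the exponent [T * q] at most 1/2, as [expR_le_quadratic]
   requires. *)
exists (Num.min (Num.min r d1) (Num.min d2 (Num.min e (1 / (2 * B))))).
  by rewrite !lt_min r0 d10 d20 e0 divr_gt0// mulr_gt0.
move=> x; rewrite !lt_min => /andP[/andP[xr xd1] /and3P[xd2 xe xB]].
pose u := x - x0.
have [p1 y2] := d1P _ xd1; rewrite -/u in p1 y2.
pose q := u ^+ 2.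
have q0 : 0 <= q by exact: sqr_ge0.
have uu : `|u| * `|u| = q by rewrite -expr2 real_normK ?num_real.
have u1 : `|u| < 1 by exact: lt_le_trans xe e1.
have qu : q <= `|u| by rewrite -uu ler_piMl// ltW.
rewrite fx0 -/q in y2.
have f2 : f1 x ^+ 2 <= (k ^+ 2 + 2 * k * e + e) * q.
  have f1k' : `|f1 x| <= (k + e) * `|u|.
    have := ler_normD (f1 x - k * u) (k * u); rewrite subrK normrM (gtr0_norm k0).
    by lra.
  have : f1 x ^+ 2 <= ((k + e) * `|u|) ^+ 2.
    by rewrite -real_normK ?num_real// lerXn2r ?nnegrE ?mulr_ge0 ?addr_ge0 ?(ltW k0) ?(ltW e0).
  rewrite exprMn (expr2 `|u|) uu => /le_trans; apply; rewrite ler_wpM2r//.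
  have : e ^+ 2 <= e by rewrite expr2 ler_piMl// ltW.
  by rewrite sqrrD -mulr_natr; lra.
pose T := th + C * e.
have fT : - (y0 * (f x - y0)) - (f x - y0) ^+ 2 / 2 + f1 x ^+ 2 / 2 <= T * q.
  have h1 : `|y0 * (f x - y0 - k / 2 * q)| <= `|y0| * (e * q) by rewrite normrM ler_wpM2l.
  have h2 := sqr_ge0 (f x - y0).
  have h3 : 0 <= e * q by rewrite mulr_ge0// ltW.
  move: h1; rewrite ler_norml => /andP[h1 _].
  by rewrite /T /th /C; lra.
have TB : `|T| <= B.
  apply: (le_trans (ler_normD _ _)); rewrite /B lerD2l normrM !gtr0_norm//.
  by rewrite ler_piMr// ltW.
have qB : q * B <= 1 / 2.
  have : `|u| * B <= 1 / 2.
    move: (ltW xB); rewrite ler_pdivlMr ?mulr_gt0//; rewrite -/u; lra.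
  by apply: le_trans; rewrite ler_wpM2r// ltW.
have Tq : T * q <= 1 / 2.
  apply: le_trans qB; rewrite mulrC ler_wpM2l//.
  by apply: le_trans TB; exact: ler_norm.
have T2 : T ^+ 2 <= B ^+ 2.
  by rewrite -real_normK ?num_real// lerXn2r ?nnegrE// ltW.
have bw0 : 0 < base_weight x by exact: gauss_w_gt0.
have bw1 : base_weight x <= 1 by exact: gauss_w_le1.
have bw : `|base_weight x - w0| <= e by exact: d2P.
have -> : gauss_w (x, f x) = gauss_w (x, y0 + (f x - y0)) by rewrite addrC subrK.
rewrite gauss_w_shift -mulrA.
apply: (@le_trans _ _ (base_weight x * (1 + T * q + 2 * (T * q) ^+ 2))).
  rewrite ler_pM2l//; apply: le_trans (expR_le_quadratic Tq).
  apply: (@le_trans _ _ (expR (- (y0 * (f x - y0)) - (f x - y0) ^+ 2 / 2) *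
     expR (f1 x ^+ 2 / 2))).
    by rewrite ler_wpM2l ?expR_ge0// sqrt_le_expR.
  by rewrite -expRD ler_expR.
rewrite -/th -/q.
have qe : q <= e by apply: (le_trans qu); exact: ltW.
have k1 : (base_weight x - w0) * T <= e * B.
  by apply: (le_trans (ler_norm _)); rewrite normrM ler_pM.
have k2 : w0 * (C * e) <= C * e by rewrite ler_piMl// mulr_ge0// ltW.
have k3 : base_weight x * (2 * T ^+ 2 * q) <= 2 * B ^+ 2 * e.
  apply: (@le_trans _ _ (2 * T ^+ 2 * q)).
    by rewrite ler_piMl// mulr_ge0// mulr_ge0// sqr_ge0.
  apply: ler_pM => //; first by rewrite mulr_ge0// sqr_ge0.
  by rewrite ler_pM2l.
have k4 : base_weight x * T + base_weight x * (2 * T ^+ 2 * q) <= w0 * th + eps.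
  apply: (@le_trans _ _ (w0 * th + e * M)); last by rewrite lerD2l.
  have wT : w0 * T = w0 * th + w0 * (C * e) by rewrite /T mulrDr.
  have eME : e * M = C * e + e * B + 2 * B ^+ 2 * e by rewrite /M; ring.
  by move: k1; rewrite mulrBl; lra.
have := ler_wpM2r q0 k4; lra.
Qed.

(** [l] is a height of order [h^2] over [y0] and [m] a slope of order [h]; the neglected [l^2] and
    [m^4] have order [h^4]. Uniformity in [l] and [m] lets one radius serve the chord and both
    tangents. *)
Lemma segment_weight_ge (B eps : R) : 0 <= B -> 0 < eps ->
  exists2 d, 0 < d & forall h x l m, 0 < h -> h < d -> `|x - x0| <= h ->
  `|l| <= B * h ^+ 2 -> `|m| <= B * h ->
  base_weight x + w0 * (m ^+ 2 / 2 - y0 * l) - eps * h ^+ 2 <=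
  gauss_w (x, y0 + l) * Num.sqrt (1 + m ^+ 2).
Proof.
move=> B0 eps0; have w00 : 0 < w0 by exact: gauss_w_gt0.
pose M := B ^+ 2 / 2 + `|y0| * B + (B ^+ 2 + B ^+ 4) / 2 + 1.
have M0 : 0 < M.
  by rewrite ltr_wpDl// !addr_ge0// ?mulr_ge0 ?addr_ge0 ?exprn_ge0.
have e0 : 0 < eps / M by rewrite divr_gt0.
have [d d0 dP] := continuous_delta (@base_weight_continuous x0) e0.
exists (Num.min d (Num.min 1 (eps / M))); first by rewrite !lt_min d0 ltr01.
move=> h x l m h0; rewrite !lt_min => /and3P[hd h1 he] xh lB mB.
have {}dP := dP x (le_lt_trans xh hd).
set e := eps / M in e0 dP he; have eM : e * M = eps by rewrite divfK// gt_eqF.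
have hh : 0 <= h ^+ 2 by rewrite sqr_ge0.
have m2 : m ^+ 2 <= B ^+ 2 * h ^+ 2.
  by rewrite -exprMn -real_normK ?num_real// lerXn2r ?nnegrE ?mulr_ge0 ?(ltW h0).
have m4 : m ^+ 4 <= B ^+ 4 * (h ^+ 2 * h ^+ 2).
  have -> : m ^+ 4 = (m ^+ 2) ^+ 2 by rewrite -exprM.
  have -> : B ^+ 4 * (h ^+ 2 * h ^+ 2) = (B ^+ 2 * h ^+ 2) ^+ 2 by ring.
  by rewrite lerXn2r ?nnegrE ?sqr_ge0// mulr_ge0// sqr_ge0.
have l2 : l ^+ 2 <= B ^+ 2 * (h ^+ 2 * h ^+ 2).
  rewrite (_ : B ^+ 2 * _ = (B * h ^+ 2) ^+ 2); last by ring.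
  by rewrite -real_normK ?num_real// lerXn2r ?nnegrE// mulr_ge0.
have hhe : h ^+ 2 * h ^+ 2 <= e * h ^+ 2.
  by rewrite ler_wpM2r// expr2; apply: le_trans (ltW he); rewrite ler_piMl ?ltW.
have yl : `|y0 * l| <= `|y0| * (B * h ^+ 2) by rewrite normrM ler_wpM2l.
rewrite gauss_w_shift -mulrA.
have bw0 : 0 <= base_weight x by rewrite ltW// gauss_w_gt0.
have bw1 : base_weight x <= 1 by exact: gauss_w_le1.
pose s := m ^+ 2 / 2 - y0 * l; pose t := (l ^+ 2 + m ^+ 4) / 2.
have t0 : 0 <= t by rewrite mulr_ge0 ?addr_ge0 ?sqr_ge0// (_ : m ^+ 4 = (m ^+ 2) ^+ 2) ?sqr_ge0// -exprM.
apply: (@le_trans _ _ (base_weight x * (1 + (s - t)))).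
  have st : `|s| <= (B ^+ 2 / 2 + `|y0| * B) * h ^+ 2.
    apply: (le_trans (ler_normB _ _)); rewrite [X in X + _]ger0_norm ?divr_ge0 ?sqr_ge0//.
    by lra.
  have tt : t <= (B ^+ 2 + B ^+ 4) / 2 * (e * h ^+ 2).
    have BB : 0 <= B ^+ 2 + B ^+ 4 by rewrite addr_ge0// exprn_ge0.
    have := ler_wpM2l BB hhe; rewrite /t; lra.
  have h2 : `|(base_weight x - w0) * s| <= e * ((B ^+ 2 / 2 + `|y0| * B) * h ^+ 2).
    by rewrite normrM ler_pM.
  have h3 : base_weight x * t <= t by rewrite ler_piMl.
  have h4 : eps * h ^+ 2 = e * ((B ^+ 2 / 2 + `|y0| * B) * h ^+ 2) +
     (B ^+ 2 + B ^+ 4) / 2 * (e * h ^+ 2) + e * h ^+ 2 by rewrite -eM /M; ring.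
  have h5 : 0 <= e * h ^+ 2 by rewrite mulr_ge0// ltW.
  move: h2; rewrite ler_norml => /andP[h2 _].
  by rewrite -/s; lra.
rewrite ler_wpM2l//; apply: (le_trans (expR_ge1Dx _)).
apply: (@le_trans _ _ (expR (- (y0 * l) - l ^+ 2 / 2) * expR ((m ^+ 2 - m ^+ 4) / 2))).
  by rewrite -expRD ler_expR /s /t; lra.
by rewrite ler_wpM2l ?expR_ge0// sqrt_ge_expR.
Qed.

End weight_expansion.

Section comparison_inequality.
Context {R : realType}.

(* [- mu1 * h] and [mu2 * h] are the slopes at the end points of the sub-arc,
   [eta1 * h ^+ 2] and [eta2 * h ^+ 2] their heights over the point of tangency, and
   [xi * h] the relative abscissa of the intersection of the two tangents; the right-hand
   side is the rescaled limit of [2 tangents + chord]. *)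
Lemma key_inequality (k y0 e mu1 mu2 eta1 eta2 xi : R) :
  0 < k -> 0 < e -> e <= k / 8 -> `|mu1 - k| <= e -> `|mu2 - k| <= e ->
  `|eta1 - k / 2| <= e -> `|eta2 - k / 2| <= e ->
  xi * (mu1 + mu2) = eta1 - eta2 + mu2 - mu1 ->
  e * (10 * k + 20 * `|y0| + 1) <= k ^+ 2 / 2 ->
  `|xi| <= 1 / 2 /\
  k ^+ 2 - y0 * k + k ^+ 2 / 4 < mu1 ^+ 2 * (1 + xi) + mu2 ^+ 2 * (1 - xi) -
    y0 * ((1 + xi) * (2 * eta1 - mu1 * (1 + xi)) +
          (1 - xi) * (eta1 + eta2 - mu1 * (1 + xi)) + eta1 + eta2).
Proof.
move=> k0 e0 ek; rewrite !ler_norml => /andP[m1l m1u] /andP[m2l m2u].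
move=> /andP[n1l n1u] /andP[n2l n2u] xiE ey.
have mm : k <= mu1 + mu2 by lra.
(* By symmetry the tangents of a parabola meet above the midpoint, so [xi] is of the order of the
   error [e]. *)
have xk : `|xi| * k <= 4 * e.
  apply: (@le_trans _ _ (`|xi| * (mu1 + mu2))); first by rewrite ler_wpM2l.
  rewrite -[mu1 + mu2]ger0_norm; last by lra.
  by rewrite -normrM xiE ler_norml; apply/andP; split; lra.
have xi2 : `|xi| <= 1 / 2.
  by rewrite -(ler_pM2r k0); lra.
split; first by rewrite -ler_norml.
have sq (mu : R) : - e <= mu - k -> mu - k <= e -> k ^+ 2 - 2 * k * e <= mu ^+ 2.
  move=> l _; have : 0 <= mu - k + e by lra.
  move=> /(mulr_ge0 (ltW k0)); have := sqr_ge0 (mu - k).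
  rewrite sqrrB -mulr_natr; lra.
have s1 := sq _ m1l m1u; have s2 := sq _ m2l m2u.
have dmu : `|xi * (mu1 ^+ 2 - mu2 ^+ 2)| <= 6 * k * e.
  rewrite subr_sqr mulrCA normrM [in leLHS]mulrC.
  rewrite xiE.
  have h1 : `|mu1 - mu2| <= 2 * e by rewrite ler_norml; apply/andP; split; lra.
  have h2 : `|eta1 - eta2 + mu2 - mu1| <= 4 * e by rewrite ler_norml; apply/andP; split; lra.
  apply: (le_trans (ler_pM (normr_ge0 _) (normr_ge0 _) h2 h1)).
  have := ler_wpM2r (ltW e0) ek; nra.
pose Q := (1 + xi) * (2 * eta1 - mu1 * (1 + xi)) +
          (1 - xi) * (eta1 + eta2 - mu1 * (1 + xi)) + eta1 + eta2.
have QE : Q - k = 4 * (eta1 - k / 2) + 2 * (eta2 - k / 2) + xi * (eta1 - eta2) -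
     2 * (mu1 - k) - 2 * (mu1 - k) * xi - 2 * (k * xi) - 2 * (eta2 - k / 2) +
     2 * (eta2 - k / 2).
  by rewrite /Q; field.
have yQ : `|y0 * (Q - k)| <= `|y0| * (20 * e).
  rewrite normrM ler_wpM2l// QE.
  have h1 : `|xi * (eta1 - eta2)| <= 1 / 2 * (2 * e).
    by rewrite normrM ler_pM// ler_norml; apply/andP; split; lra.
  have h2 : `|(mu1 - k) * xi| <= e * (1 / 2).
    by rewrite normrM ler_pM// ler_norml; apply/andP; split; lra.
  have h3 : `|k * xi| <= 4 * e by rewrite normrM (gtr0_norm k0) mulrC.
  move: h1 h2 h3; rewrite !ler_norml => /andP[? ?] /andP[? ?] /andP[? ?].
  by apply/andP; split; lra.
(* The quadratic part is at least [2 * k^2 - 10 * k * e], and the [y0] part differs from [y0 * k] by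
   at most [20 * |y0| * e]. Together the errors are at most [k^2 / 2], less than the available
   [3 * k^2 / 4]. *)
move: yQ dmu; rewrite !ler_norml => /andP[_ yQ] /andP[dmu _].
rewrite -/Q; clear QE; clearbody Q.
have k20 : 0 < k ^+ 2 by rewrite exprn_gt0.
clear -e0 ey s1 s2 yQ dmu k20.
lra.
Qed.

(** This removes the margins that separate the pieces of the boundaries. *)
Lemma ge_at_0 (c : R) (F : R -> R) : {for 0, continuous F} ->
  (exists2 d, 0 < d & forall x, 0 < x -> x < d -> c <= F x) -> c <= F 0.
Proof.
move=> cF [d d0 dF]; rewrite leNgt; apply/negP => Fc.
have g0 : 0 < (c - F 0) / 2 by lra.
have [t t0 tP] := continuous_delta cF g0.
pose x := Num.min d t / 2.
have m0 : 0 < Num.min d t by rewrite lt_min d0.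
have md : Num.min d t <= d by rewrite ge_min lexx.
have mt : Num.min d t <= t by rewrite ge_min lexx orbT.
have := dF x; rewrite /x; move=> /(_ _ _) h.
have xt : `|x - 0| < t by rewrite subr0 ger0_norm /x; lra.
have := tP _ xt; rewrite ler_norml => /andP[_].
have : c <= F x by apply: h; lra.
lra.
Qed.

Lemma continuous_along_line (G : R -> R) (x l s : R) : is_derive x 1 G l ->
  {for 0, continuous (fun d => G (x + s * d))}.
Proof.
move=> /is_derive_continuous cG.
apply: (@continuous_comp _ _ _ (fun d : R => x + s * d) G); last by rewrite mulr0 addr0.
by apply: cvgD; [exact: cvg_cst|apply: cvgM; [exact: cvg_cst|exact: cvg_id]].
Qed.
End comparison_inequality.

Section segment_bound.
Context {R : realType}.

(* A primitive of the lower bound of [segment_weight_ge] along [line xa ya m]. *)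
Definition segment_primitive (Phi : R -> R) (x0 y0 eps h xa ya m x : R) : R :=
  Phi x + ((base_weight y0 x0 * (m ^+ 2 / 2 - y0 * (ya - m * xa - y0)) - eps * h ^+ 2) * x +
    (- (base_weight y0 x0 * y0 * m / 2)) * x ^+ 2 + 0 * (x - x0) ^+ 3).

(** The trapezoid rule is exact on a line, so only the heights at the two ends enter. *)
Lemma segment_primitiveB (Phi : R -> R) (x0 y0 eps h xa ya m p q : R) :
  segment_primitive Phi x0 y0 eps h xa ya m q - segment_primitive Phi x0 y0 eps h xa ya m p =
  Phi q - Phi p + base_weight y0 x0 * (m ^+ 2 / 2 * (q - p) -
    y0 * ((q - p) * ((line xa ya m p - y0) + (line xa ya m q - y0)) / 2)) -
  eps * h ^+ 2 * (q - p).
Proof. by rewrite /segment_primitive /line; field. Qed.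

Lemma is_derive_segment_primitive (Phi : R -> R) (x0 y0 eps h xa ya m x : R) :
  is_derive x 1 Phi (base_weight y0 x) ->
  is_derive x 1 (segment_primitive Phi x0 y0 eps h xa ya m)
   (base_weight y0 x + (base_weight y0 x0 * (m ^+ 2 / 2 - y0 * (line xa ya m x - y0)) -
     eps * h ^+ 2)).
Proof.
move=> dPhi; apply: (is_derive_eq (is_deriveD dPhi (is_derive_cubic _ _ _ _ _))).
by rewrite /line; field.
Qed.

Lemma line_between (xa ya m y0 c p x q : R) : p <= x -> x <= q ->
  `|line xa ya m p - y0| <= c -> `|line xa ya m q - y0| <= c ->
  `|line xa ya m x - y0| <= c.
Proof.
rewrite /line !ler_norml => px xq /andP[lp1 lp2] /andP[lq1 lq2].
have [m0|m0] := leP 0 m.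
  have := ler_wpM2l m0 px; have := ler_wpM2l m0 xq.
  by move=> ? ?; apply/andP; split; lra.
have m0' : 0 <= - m by lra.
have := ler_wpM2l m0' px; have := ler_wpM2l m0' xq.
by move=> ? ?; apply/andP; split; lra.
Qed.

Lemma segment_lower (Phi : R -> R) (x0 y0 B eps d h xa ya m p q : R) :
  (forall x : R, x0 - 1 < x -> is_derive x 1 Phi (base_weight y0 x)) ->
  (forall h x l m, 0 < h -> h < d -> `|x - x0| <= h ->
    `|l| <= B * h ^+ 2 -> `|m| <= B * h ->
    base_weight y0 x + base_weight y0 x0 * (m ^+ 2 / 2 - y0 * l) - eps * h ^+ 2 <=
    gauss_w (x, y0 + l) * Num.sqrt (1 + m ^+ 2)) ->
  0 < h -> h < d -> h < 1 -> x0 - h <= p -> p <= q -> q <= x0 + h -> `|m| <= B * h ->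
  `|line xa ya m p - y0| <= B * h ^+ 2 -> `|line xa ya m q - y0| <= B * h ^+ 2 ->
  ((segment_primitive Phi x0 y0 eps h xa ya m q -
    segment_primitive Phi x0 y0 eps h xa ya m p)%:E <=
    gauss_H1_integral (graph_on (line xa ya m) p q))%E.
Proof.
move=> dPhi lowP h0 hd h1 ph pq qh mB lp lq.
apply: (gauss_H1_integral_segment_ge pq (g := fun x => base_weight y0 x +
  (base_weight y0 x0 * (m ^+ 2 / 2 - y0 * (line xa ya m x - y0)) - eps * h ^+ 2))).
- move=> x /andP[px xq]; apply: is_derive_segment_primitive; apply: dPhi; lra.
- suff c x : {for x, continuous (fun x => base_weight y0 x +
      (base_weight y0 x0 * (m ^+ 2 / 2 - y0 * (line xa ya m x - y0)) - eps * h ^+ 2))}.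
    by move=> x; exact: c.
  apply: cvgD; first exact: base_weight_continuous.
  apply: cvgD; last exact: cvg_cst.
  apply: cvgM; first exact: cvg_cst.
  apply: cvgD; first exact: cvg_cst.
  apply: cvgN; apply: cvgM; first exact: cvg_cst.
  apply: cvgD; last exact: cvg_cst.
  apply: cvgD; first exact: cvg_cst.
  by apply: cvgM; [exact: cvg_cst|exact: cvg_id].
- move=> x /andP[px xq]; rewrite -/(line xa ya m x).
  have xh : `|x - x0| <= h by rewrite ler_norml; apply/andP; split; lra.
  have lB : `|line xa ya m x - y0| <= B * h ^+ 2.
    exact: line_between px xq lp lq.
  by have := lowP _ _ _ _ h0 hd xh lB mB; rewrite [y0 + _]addrC subrK; lra.
Qed.

End segment_bound.

Section competitor_bounds.
Context {R : realType}.

(** [G] majorizes the arc length, and [Sa], [Sb], [Sc] minorize the segments. The arc is first taken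
    over [[a - d, b + d]] and the tangents without []xq - d, xq + d[]; continuity of [G], [Sa] and
    [Sb] permits [d] to tend to 0. *)
Lemma competitor_bounds (Om : set (R * R)) (f f1 G g Sa Sb Sc : R -> R)
    (a0 b0 a b xq rho ga gb : R) :
  convex_set2 Om ->
  (forall x, a0 < x < b0 -> is_derive x 1 f (f1 x)) ->
  (forall x, a0 < x < b0 -> {for x, continuous f1}) ->
  (forall x y, a0 < x -> x < y -> y < b0 -> f1 x < f1 y) ->
  (forall x, a0 < x < b0 -> bdry Om (x, f x)) ->
  (forall D : set (R * R), convex_set2 D ->
    (gauss_H1_integral (bdry D) <= gauss_H1_integral (bdry Om))%E) ->
  0 < rho -> a0 < a - rho -> a + rho <= xq -> xq <= b - rho -> b + rho < b0 ->
  (forall x, a - rho < x < b + rho -> is_derive x 1 G (g x)) ->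
  (forall x, a - rho < x < b + rho ->
    gauss_w (x, f x) * Num.sqrt (1 + f1 x ^+ 2) <= g x) ->
  line a (f a) (f1 a) xq = line b (f b) (f1 b) xq ->
  is_derive xq 1 Sa ga -> is_derive xq 1 Sb gb ->
  (forall q, a <= q -> q <= xq -> ((Sa q - Sa a)%:E <=
    gauss_H1_integral (graph_on (line a (f a) (f1 a)) a q))%E) ->
  (forall p, xq <= p -> p <= b -> ((Sb b - Sb p)%:E <=
    gauss_H1_integral (graph_on (line b (f b) (f1 b)) p b))%E) ->
  ((Sc b - Sc a)%:E <=
    gauss_H1_integral (graph_on (line a (f a) (chord_slope f a b)) a b))%E ->
  Sc b - Sc a <= G b - G a /\ (Sa xq - Sa a) + (Sb b - Sb xq) <= G b - G a.
Proof.
move=> cOm ff1 cf1 f1_incr f_bdry Om_max rho0 a0a axq xqb bb0 dG gG lq dSa dSb lowa lowb lowc.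
have arc d : 0 < d -> d < rho ->
    (gauss_H1_integral (graph_on f (a - d) (b + d)) <= (G (b + d) - G (a - d))%:E)%E.
  move=> d0 dh; apply: (gauss_H1_integral_graph_le (f1 := f1) (g := g)); first by lra.
  - by move=> x /andP[? ?]; apply: ff1; apply/andP; split; lra.
  - by move=> x /andP[? ?]; apply: cf1; apply/andP; split; lra.
  - by move=> x /andP[? ?]; apply: dG; apply/andP; split; lra.
  - by move=> x /andP[? ?]; apply: gG; apply/andP; split; lra.
have dGb : is_derive b 1 G (g b) by apply: dG; apply/andP; split; lra.
have dGa : is_derive a 1 G (g a) by apply: dG; apply/andP; split; lra.
split.
  pose F d := G (b + 1 * d) - G (a + (-1) * d).
  have -> : G b - G a = F 0 by rewrite /F !mulr0 !addr0.
  apply: ge_at_0; first by apply: cvgB; [exact: (continuous_along_line (s := 1) dGb)|exact: (continuous_along_line (s := -1) dGa)].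
  exists rho => // d d0 dh; rewrite /F mul1r mulN1r -lee_fin.
  apply: le_trans (arc _ d0 dh); apply: (le_trans lowc).
  by apply: (chord_le cOm ff1 f1_incr f_bdry Om_max); lra.
pose F d := (G (b + 1 * d) - G (a + (-1) * d)) -
   ((Sa (xq + (-1) * d) - Sa a) + (Sb b - Sb (xq + 1 * d))).
suff : 0 <= F 0 by rewrite /F !mulr0 !addr0 subr_ge0.
apply: ge_at_0.
  apply: cvgB; first by apply: cvgB; [exact: (continuous_along_line (s := 1) dGb)|exact: (continuous_along_line (s := -1) dGa)].
  apply: cvgD; apply: cvgB; try exact: cvg_cst.
    exact: (continuous_along_line (s := -1) dSa).
  exact: (continuous_along_line (s := 1) dSb).
exists rho => // d d0 dh; rewrite /F !mul1r !mulN1r subr_ge0 -lee_fin.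
apply: le_trans (arc _ d0 dh); rewrite EFinD.
have T : (gauss_H1_integral (graph_on (line a (f a) (f1 a)) a (xq - d)) +
   gauss_H1_integral (graph_on (line b (f b) (f1 b)) (xq + d) b) <=
   gauss_H1_integral (graph_on f (a - d) (b + d)))%E.
  by apply: (tangents_le cOm ff1 f1_incr f_bdry Om_max) => //; lra.
by apply: le_trans T; apply: leeD; [apply: lowa; lra|apply: lowb; lra].
Qed.

End competitor_bounds.

(** * Contradiction at a point of positive curvature *)

Section no_curved_graph.
Context {R : realType}.

Lemma no_curved_graph (Om : set (R * R)) (f f1 : R -> R) (a0 b0 x0 k : R) :
  convex_set2 Om ->
  (forall x, a0 < x < b0 -> is_derive x 1 f (f1 x)) ->
  (forall x, a0 < x < b0 -> {for x, continuous f1}) ->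
  (forall x y, a0 < x -> x < y -> y < b0 -> f1 x < f1 y) ->
  (forall x, a0 < x < b0 -> bdry Om (x, f x)) ->
  (forall D : set (R * R), convex_set2 D ->
    (gauss_H1_integral (bdry D) <= gauss_H1_integral (bdry Om))%E) ->
  a0 < x0 < b0 -> f1 x0 = 0 -> is_derive x0 1 f1 k -> ~ 0 < k.
Proof.
move=> cOm ff1 cf1 f1_incr f_bdry Om_max /andP[a0x0 x0b0] f1x0 f1k k0.
pose y0 := f x0.
pose w0 := base_weight y0 x0.
have w00 : 0 < w0 by exact: gauss_w_gt0.
have k20 : 0 < k ^+ 2 by rewrite exprn_gt0.
(* The errors total [8 * eps * h^3]: 2 from three arcs, 4 from two tangent pairs, 2 from the chord.
   This equals [w0 * k^2 / 4 * h^3], the surplus provided by [key_inequality]. *)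
pose eps := w0 * k ^+ 2 / 32.
have eps0 : 0 < eps by rewrite divr_gt0// mulr_gt0.
have [r [r0 ra rb]] : exists r, [/\ 0 < r, r <= x0 - a0 & r <= b0 - x0].
  exists (Num.min (x0 - a0) (b0 - x0)); split.
  - by rewrite lt_min !subr_gt0 a0x0.
  - by rewrite ge_min lexx.
  - by rewrite ge_min lexx orbT.
have ff1r x : `|x - x0| < r -> is_derive x 1 f (f1 x).
  by rewrite ltr_norml => /andP[? ?]; apply: ff1; apply/andP; split; lra.
have [dC dC0 dCP] := arc_weight_le r0 ff1r (erefl : f x0 = y0) f1x0 f1k k0 eps0.
(* A generous common bound for the rescaled slopes and heights of chord and tangents. *)
pose B := 4 * k.
have B0 : 0 <= B by rewrite /B; lra.
have [dS dS0 dSP] := segment_weight_ge x0 y0 B0 eps0.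
have [e [e0 ek ey]] : exists e, [/\ 0 < e, e <= k / 8 &
    e * (10 * k + 20 * `|y0| + 1) <= k ^+ 2 / 2].
  have N0 : 0 < 10 * k + 20 * `|y0| + 1 by have := normr_ge0 y0; lra.
  exists (Num.min (k / 8) (k ^+ 2 / 2 / (10 * k + 20 * `|y0| + 1))); split.
  - by rewrite lt_min !divr_gt0.
  - by rewrite ge_min lexx.
  - by rewrite -ler_pdivlMr// ge_min lexx orbT.
have [d1 d10 d1P] := second_order_expansion r0 ff1r f1x0 f1k e0.
have [Phi dPhi] := base_weight_primitive x0 y0.
(* The factors 2 leave room for the margin [h / 2] on each side of [[x0 - h, x0 + h]], where the arc
   bound must still hold. *)
have [h [h0 hdC hdS h1 [hr hd1]]] : exists h,
    [/\ 0 < h, 2 * h <= dC, h < dS, 2 * h <= 1 & 2 * h <= r /\ h < d1].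
  exists (Num.min (Num.min dC dS) (Num.min d1 (Num.min 1 r)) / 2).
  set mm := Num.min _ _.
  have m0 : 0 < mm by rewrite !lt_min dC0 dS0 d10 ltr01.
  have mC : mm <= dC by rewrite !ge_min lexx.
  have mS : mm <= dS by rewrite !ge_min lexx !orbT.
  have m1 : mm <= d1 by rewrite !ge_min lexx !orbT.
  have m2 : mm <= 1 by rewrite !ge_min lexx !orbT.
  have mr : mm <= r by rewrite !ge_min lexx !orbT.
  by clear -m0 mC mS m1 m2 mr; split; [| | | |split]; lra.
have h2 : 0 < h ^+ 2 by rewrite exprn_gt0.
pose a := x0 - h; pose b := x0 + h.
have [|m1e y1e] := d1P a; first by rewrite /a; rewrite addrAC subrr sub0r normrN gtr0_norm.
have [|m2e y2e] := d1P b; first by rewrite /b addrAC subrr add0r gtr0_norm.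
have aE : a - x0 = - h by rewrite /a; ring.
have bE : b - x0 = h by rewrite /b; ring.
rewrite aE normrN (gtr0_norm h0) sqrrN in m1e y1e.
rewrite bE (gtr0_norm h0) in m2e y2e.
pose mu1 := - f1 a / h; pose mu2 := f1 b / h.
pose eta1 := (f a - y0) / h ^+ 2; pose eta2 := (f b - y0) / h ^+ 2.
have hn : h != 0 by rewrite gt_eqF.
have m1E : f1 a = - mu1 * h by rewrite /mu1 mulNr divfK// opprK.
have m2E : f1 b = mu2 * h by rewrite /mu2 divfK.
have y1E : f a = y0 + eta1 * h ^+ 2 by rewrite /eta1 divfK ?gt_eqF//; ring.
have y2E : f b = y0 + eta2 * h ^+ 2 by rewrite /eta2 divfK ?gt_eqF//; ring.
have eqle (x y : R) : x = y -> x <= y by move=> ->.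
have mu1e : `|mu1 - k| <= e.
  rewrite -(ler_pM2r h0) -[X in _ * X](gtr0_norm h0) -normrM -normrN.
  by apply: le_trans m1e; rewrite m1E; apply: eqle; congr `|_|; ring.
have mu2e : `|mu2 - k| <= e.
  rewrite -(ler_pM2r h0) -[X in _ * X](gtr0_norm h0) -normrM.
  by apply: le_trans m2e; rewrite m2E; apply: eqle; congr `|_|; ring.
have eta1e : `|eta1 - k / 2| <= e.
  rewrite -(ler_pM2r h2) -[X in _ * X](gtr0_norm h2) -normrM.
  by apply: le_trans y1e; rewrite y1E -/y0; apply: eqle; congr `|_|; ring.
have eta2e : `|eta2 - k / 2| <= e.
  rewrite -(ler_pM2r h2) -[X in _ * X](gtr0_norm h2) -normrM.
  by apply: le_trans y2e; rewrite y2E -/y0; apply: eqle; congr `|_|; ring.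
clearbody mu1 mu2 eta1 eta2.
have mm : 0 < mu1 + mu2.
  by clear -mu1e mu2e ek k0 e0; move: mu1e mu2e; rewrite !ler_norml => /andP[? ?] /andP[? ?]; lra.
(* Solution of [eta1 - mu1 * (1 + xi) = eta2 + mu2 * (xi - 1)], which equates the rescaled heights
   of the two tangents. *)
pose xi := (eta1 - eta2 + mu2 - mu1) / (mu1 + mu2).
have xiE : xi * (mu1 + mu2) = eta1 - eta2 + mu2 - mu1 by rewrite divfK ?gt_eqF.
have [xi12 key] := key_inequality k0 e0 ek mu1e mu2e eta1e eta2e xiE ey.
clearbody xi.
pose xq := x0 + xi * h.
pose la := line a (f a) (f1 a); pose lb := line b (f b) (f1 b).
pose mk := chord_slope f a b; pose lc := line a (f a) mk.
have laa : la a = y0 + eta1 * h ^+ 2 by rewrite /la /line y1E; ring.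
have laq : la xq = y0 + (eta1 - mu1 * (1 + xi)) * h ^+ 2.
  by rewrite /la /line y1E m1E /xq /a; ring.
have lbb : lb b = y0 + eta2 * h ^+ 2 by rewrite /lb /line y2E; ring.
have lbq : lb xq = y0 + (eta1 - mu1 * (1 + xi)) * h ^+ 2.
  have -> : eta1 - mu1 * (1 + xi) = eta2 + mu2 * (xi - 1).
    by apply/eqP; rewrite -subr_eq0; apply/eqP; clear -xiE; move: xiE; lra.
  by rewrite /lb /line y2E m2E /xq /b; ring.
have lca : lc a = y0 + eta1 * h ^+ 2 by rewrite /lc /line y1E; ring.
have mkE : mk * (2 * h) = (eta2 - eta1) * h ^+ 2.
  have -> : 2 * h = b - a by rewrite /a /b; ring.
  rewrite /mk /chord_slope divfK; first by rewrite y1E y2E; ring.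
  by rewrite (_ : b - a = 2 * h) ?mulf_neq0// /a /b; ring.
have lcb : lc b = y0 + eta2 * h ^+ 2.
  have -> : lc b = lc a + mk * (2 * h) by rewrite /lc /line /a /b; ring.
  by rewrite lca mkE; ring.
have bnd (c : R) : `|c| <= B -> `|y0 + c * h ^+ 2 - y0| <= B * h ^+ 2.
  move=> cB; rewrite (_ : y0 + c * h ^+ 2 - y0 = c * h ^+ 2); last by ring.
  by rewrite normrM (gtr0_norm h2) ler_wpM2r// ltW.
have [mu1B mu2B eta1B eta2B] : [/\ `|mu1| <= B, `|mu2| <= B, `|eta1| <= B & `|eta2| <= B].
  have nB (x y : R) : `|x - y| <= e -> 0 < y -> y + e <= 4 * k -> `|x| <= B.
    move=> xy y_gt0; apply: le_trans; rewrite -[in leLHS](subrK y x).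
    by apply: (le_trans (ler_normD _ _)); rewrite (gtr0_norm y_gt0) addrC lerD2l.
  by split; [apply: (nB _ k)|apply: (nB _ k)|apply: (nB _ (k / 2))|apply: (nB _ (k / 2))] => //;
    clear -k0 ek; lra.
have etaqB : `|eta1 - mu1 * (1 + xi)| <= B.
  have h3 : `|mu1 * (1 + xi)| <= (9 / 8 * k) * (3 / 2).
    rewrite normrM ler_pM//.
      by clear -mu1e ek k0; move: mu1e; rewrite !ler_norml => /andP[? ?]; apply/andP; split; lra.
    by clear -xi12; move: xi12; rewrite !ler_norml => /andP[? ?]; apply/andP; split; lra.
  clear -h3 eta1e ek k0; move: h3 eta1e; rewrite /B !ler_norml => /andP[? ?] /andP[? ?].
  by apply/andP; split; lra.
have maB : `|f1 a| <= B * h by rewrite m1E normrM normrN (gtr0_norm h0) ler_wpM2r// ltW.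
have mbB : `|f1 b| <= B * h by rewrite m2E normrM (gtr0_norm h0) ler_wpM2r// ltW.
have mkB : `|mk| <= B * h.
  have -> : mk = (eta2 - eta1) / 2 * h.
    by apply: (@mulIf _ (2 * h)); rewrite ?mulf_neq0// mkE; field.
  rewrite normrM (gtr0_norm h0) ler_wpM2r ?(ltW h0)//.
  clear -eta1e eta2e ek k0; move: eta1e eta2e; rewrite /B !ler_norml => /andP[? ?] /andP[? ?].
  by apply/andP; split; lra.
have laaB : `|la a - y0| <= B * h ^+ 2 by rewrite laa bnd.
have laqB : `|la xq - y0| <= B * h ^+ 2 by rewrite laq bnd.
have lbbB : `|lb b - y0| <= B * h ^+ 2 by rewrite lbb bnd.
have lbqB : `|lb xq - y0| <= B * h ^+ 2 by rewrite lbq bnd.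
have lcaB : `|lc a - y0| <= B * h ^+ 2 by rewrite lca bnd.
have lcbB : `|lc b - y0| <= B * h ^+ 2 by rewrite lcb bnd.
have [xq1 xq2] : a + h / 2 <= xq /\ xq <= b - h / 2.
  have : `|xi * h| <= 1 / 2 * h by rewrite normrM (gtr0_norm h0) ler_wpM2r// ltW.
  by clear -h0; rewrite ler_norml /xq /a /b => /andP[? ?]; split; lra.
pose C := w0 * (k ^+ 2 / 2 - y0 * k / 2) + eps.
(* A primitive of the majorant from [arc_weight_le]; the zero coefficients fit the shape of
   [is_derive_cubic]. *)
pose Gc x := Phi x + (0 * x + 0 * x ^+ 2 + C / 3 * (x - x0) ^+ 3).
have dGc x : x0 - 1 < x -> is_derive x 1 Gc (base_weight y0 x + C * (x - x0) ^+ 2).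
  move=> /dPhi dx; apply: (is_derive_eq (is_deriveD dx (is_derive_cubic _ _ _ _ _))).
  by field.
pose Sa := segment_primitive Phi x0 y0 eps h a (f a) (f1 a).
pose Sb := segment_primitive Phi x0 y0 eps h b (f b) (f1 b).
pose Sc := segment_primitive Phi x0 y0 eps h a (f a) mk.
have low := segment_lower dPhi dSP h0 hdS.
have [ord1 ord2 ord3 ord4] : [/\ h < 1, x0 - 1 < a - h / 2, a0 < a - h / 2 & b + h / 2 < b0].
  by clear -h0 h1 hr ra rb; rewrite /a /b; split; lra.
have [ord5 ord6 ord7 ord8] : [/\ x0 - 1 < xq, a <= xq, xq <= b & a <= b].
  by clear -h0 h1 xq1 xq2; rewrite /a /b in xq1 xq2 *; split; lra.
have [ord9 ord10] : x0 - h <= a /\ b <= x0 + h by [].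
have h20 : 0 < h / 2 by rewrite divr_gt0.
have lq : la xq = lb xq by rewrite laq lbq.
have xqd := dPhi _ ord5.
have [tauK tauT] : Sc b - Sc a <= Gc b - Gc a /\
    (Sa xq - Sa a) + (Sb b - Sb xq) <= Gc b - Gc a.
  apply: (competitor_bounds (g := fun x => base_weight y0 x + C * (x - x0) ^+ 2)
    cOm ff1 cf1 f1_incr f_bdry Om_max h20 ord3 xq1 xq2 ord4 _ _ lq
    (is_derive_segment_primitive _ _ _ _ _ _ xqd)
    (is_derive_segment_primitive _ _ _ _ _ _ xqd)).
  - by move=> x /andP[xa _]; apply: dGc; exact: lt_trans xa.
  - move=> x xab; apply: dCP; apply: lt_le_trans hdC.
    by clear -xab h0; rewrite /a /b in xab; move/andP: xab => [? ?];
      rewrite ltr_norml; apply/andP; split; lra.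
  - move=> q aq qx; apply: low => //; first exact: le_trans qx (le_trans ord7 ord10).
    exact: (line_between aq qx laaB laqB).
  - move=> p xp pb; apply: low => //; first exact: le_trans ord9 (le_trans ord6 xp).
    exact: (line_between xp pb lbqB lbbB).
  - exact: low.
have mk2 : 0 <= w0 * mk ^+ 2 * h.
  by rewrite mulr_ge0 ?(ltW h0)// mulr_ge0 ?sqr_ge0// ltW.
have h3 : 0 < h ^+ 3 by rewrite exprn_gt0.
pose E := mu1 ^+ 2 * (1 + xi) + mu2 ^+ 2 * (1 - xi) -
    y0 * ((1 + xi) * (2 * eta1 - mu1 * (1 + xi)) +
          (1 - xi) * (eta1 + eta2 - mu1 * (1 + xi)) + eta1 + eta2).
(* An exact identity once the end heights are substituted. The last term comes from the slope of the
   chord and is nonnegative; positivity of the whole contradicts [tauT] taken twice plus [tauK]. *)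
have EQ : 2 * ((Sa xq - Sa a) + (Sb b - Sb xq)) + (Sc b - Sc a) - 3 * (Gc b - Gc a) =
    w0 * h ^+ 3 * (E - (k ^+ 2 - y0 * k + k ^+ 2 / 4)) + w0 * mk ^+ 2 * h.
  clearbody mk.
  rewrite /Sa /Sb /Sc !segment_primitiveB -/la -/lb -/lc laa laq lbb lbq lca lcb.
  rewrite m1E m2E /Gc /C /eps /E -/w0 /xq aE bE /a /b; by field.
have : 0 < w0 * h ^+ 3 * (E - (k ^+ 2 - y0 * k + k ^+ 2 / 4)).
  by rewrite !mulr_gt0// subr_gt0.
move=> gap; clear -gap EQ tauK tauT mk2; lra.
Qed.

End no_curved_graph.

(** * From curves to graphs *)

Section isometry_invariance.
Context {R : realType}.
Variables phi psi : R * R -> R * R.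
Hypothesis phiK : cancel phi psi.
Hypothesis psiK : cancel psi phi.
Hypothesis phi_edist : forall x y, edist (phi x) (phi y) = edist x y.
Hypothesis phi_enorm : forall x, enorm (phi x) = enorm x.
Hypothesis phi_comb : forall (x y : R * R) t,
  phi ((1 - t) * x.1 + t * y.1, (1 - t) * x.2 + t * y.2) =
  ((1 - t) * (phi x).1 + t * (phi y).1, (1 - t) * (phi x).2 + t * (phi y).2).

(** Isometries preserve Euclidean discs but not the boxes of the product topology. *)
Lemma closure_edistP (A : set (R * R)) z : closure A z <->
  forall e : R, 0 < e -> exists2 a, A a & edist a z < e.
Proof.
rewrite closure_boxP; split => Az e e0.
  have e20 : 0 < e / 2 by rewrite divr_gt0.
  have [a [Aa a1 a2]] := Az _ e20; exists a => //.
  by apply: (le_lt_trans (edist_le_l1 _ _)); rewrite [ltRHS]splitr ltrD.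
have [a Aa ae] := Az _ e0; exists a; split => //; apply: le_lt_trans ae.
  exact: fst_le_edist.
exact: snd_le_edist.
Qed.

Lemma interior_edistP (A : set (R * R)) z : interior A z <->
  exists2 e : R, 0 < e & forall a, edist a z < e -> A a.
Proof.
rewrite interior_boxP; split => [[e e0 Az]|[e e0 Az]].
  exists e => // a ae; apply: Az; apply: le_lt_trans ae; first exact: fst_le_edist.
  exact: snd_le_edist.
exists (e / 2); first by rewrite divr_gt0.
move=> a a1 a2; apply: Az; apply: (le_lt_trans (edist_le_l1 _ _)).
by rewrite [ltRHS]splitr ltrD.
Qed.

Lemma bdry_preimage (A : set (R * R)) : bdry (phi @^-1` A) = phi @^-1` bdry A.
Proof.
apply/seteqP; split => z; rewrite /bdry /=.
  move=> [/closure_edistP Az nz]; split.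
    apply/closure_edistP => e e0; have [a Aa ae] := Az _ e0.
    by exists (phi a) => //; rewrite phi_edist.
  move=> /interior_edistP[e e0 zA]; apply: nz; apply/interior_edistP.
  by exists e => // a ae; apply: zA; rewrite phi_edist.
move=> [/closure_edistP Az nz]; split.
  apply/closure_edistP => e e0; have [a Aa ae] := Az _ e0.
  by exists (psi a); rewrite /= ?psiK// -phi_edist psiK.
move=> /interior_edistP[e e0 zA]; apply: nz; apply/interior_edistP.
exists e => // a ae; rewrite -(psiK a); apply: zA.
by rewrite -phi_edist psiK.
Qed.

Lemma convex_preimage (A : set (R * R)) : convex_set2 A -> convex_set2 (phi @^-1` A).
Proof. by move=> cA x y t Ax Ay t01; rewrite /preimage/= phi_comb; exact: cA. Qed.

Lemma gauss_H1_integral_isometry (A : set (R * R)) :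
  (gauss_H1_integral (phi @^-1` A) <= gauss_H1_integral A)%E.
Proof. by apply: gauss_H1_integral_preimage => // x y; rewrite phi_edist. Qed.

End isometry_invariance.

Section orthogonal_maps.
Context {R : realType}.
Variables al be sg : R.
Hypothesis ab1 : al ^+ 2 + be ^+ 2 = 1.
Hypothesis sg1 : sg ^+ 2 = 1.

(** The rotation taking [(1, 0)] to [(al, be)], preceded by the reflection in the horizontal axis
    when [sg = -1]. *)
Definition orth (z : R * R) : R * R :=
  (al * z.1 - sg * be * z.2, be * z.1 + sg * al * z.2).
Definition orth_inv (z : R * R) : R * R :=
  (al * z.1 + be * z.2, sg * (al * z.2 - be * z.1)).

Lemma orthK : cancel orth orth_inv.
Proof.
move=> [x y]; rewrite /orth /orth_inv /=; congr (_, _).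
  by rewrite -[RHS]mul1r -ab1; ring.
by rewrite -[RHS]mul1r -[1]mul1r -{1}ab1 -sg1; ring.
Qed.

Lemma orth_invK : cancel orth_inv orth.
Proof.
move=> [x y]; rewrite /orth /orth_inv /=; congr (_, _).
  transitivity ((al ^+ 2 + sg ^+ 2 * be ^+ 2) * x + al * be * y * (1 - sg ^+ 2)); first by ring.
  by rewrite sg1 mul1r ab1; ring.
transitivity ((be ^+ 2 + sg ^+ 2 * al ^+ 2) * y + al * be * x * (1 - sg ^+ 2)); first by ring.
by rewrite sg1 mul1r addrC [be ^+ 2 + _]addrC ab1; ring.
Qed.

Lemma orth_enorm x : enorm (orth x) = enorm x.
Proof.
rewrite /enorm /orth/=; congr Num.sqrt.
transitivity ((al ^+ 2 + be ^+ 2) * x.1 ^+ 2 + sg ^+ 2 * (al ^+ 2 + be ^+ 2) * x.2 ^+ 2).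
  by ring.
by rewrite ab1 sg1; ring.
Qed.

Lemma orth_edist x y : edist (orth x) (orth y) = edist x y.
Proof.
rewrite /edist -[in RHS]orth_enorm /orth/=; congr enorm; congr (_, _); ring.
Qed.

Lemma orth_comb (x y : R * R) t :
  orth ((1 - t) * x.1 + t * y.1, (1 - t) * x.2 + t * y.2) =
  ((1 - t) * (orth x).1 + t * (orth y).1, (1 - t) * (orth x).2 + t * (orth y).2).
Proof. by rewrite /orth/=; congr (_, _); ring. Qed.

Lemma orth_inv_enorm x : enorm (orth_inv x) = enorm x.
Proof. by rewrite -orth_enorm orth_invK. Qed.

Lemma orth_inv_edist x y : edist (orth_inv x) (orth_inv y) = edist x y.
Proof. by rewrite -orth_edist !orth_invK. Qed.

Lemma orth_inv_comb (x y : R * R) t :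
  orth_inv ((1 - t) * x.1 + t * y.1, (1 - t) * x.2 + t * y.2) =
  ((1 - t) * (orth_inv x).1 + t * (orth_inv y).1,
   (1 - t) * (orth_inv x).2 + t * (orth_inv y).2).
Proof. by rewrite /orth_inv/=; congr (_, _); ring. Qed.

(** The inequality for preimages, applied to the map and to its inverse, transports both sides of
    the maximality statement. *)
Lemma maximal_orth (Om : set (R * R)) :
  (forall D : set (R * R), convex_set2 D ->
    (gauss_H1_integral (bdry D) <= gauss_H1_integral (bdry Om))%E) ->
  forall D : set (R * R), convex_set2 D ->
    (gauss_H1_integral (bdry D) <= gauss_H1_integral (bdry (orth @^-1` Om)))%E.
Proof.
move=> Om_max D cD.
have -> : D = orth @^-1` (orth_inv @^-1` D).
  by apply/funext => z; rewrite /preimage/= orthK.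
rewrite (bdry_preimage orth_invK orth_edist).
apply: (le_trans (gauss_H1_integral_isometry orth_edist orth_enorm _)).
apply: (le_trans (Om_max _ (convex_preimage orth_inv_comb cD))).
have {1}-> : Om = orth_inv @^-1` (orth @^-1` Om).
  by apply/funext => z; rewrite /preimage/= orth_invK.
rewrite (bdry_preimage orthK orth_inv_edist).
exact: gauss_H1_integral_isometry orth_inv_edist orth_inv_enorm _.
Qed.

End orthogonal_maps.

Section curved_arcs.
Context {R : realType}.

Lemma is_derive_comp (f g : R -> R) (x k l : R) :
  is_derive x 1 g l -> is_derive (g x) 1 f k -> is_derive x 1 (f \o g) (k * l).
Proof.
move=> dg df; have cg := is_derive_continuous dg.
have /is_derive1_caratheodory[lg [gE clg <-]] := dg.
have /is_derive1_caratheodory[kf [fE ckf <-]] := df.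
apply/is_derive1_caratheodory; exists (fun z => kf (g z) * lg z); split => //.
- by move=> z; rewrite /= fE gE mulrA.
- by apply: cvgM => //; exact: (@continuous_comp _ _ _ g kf).
Qed.

Lemma MVT_incr (f k : R -> R) (a b : R) : a < b ->
  (forall x, a <= x <= b -> is_derive x 1 f (k x)) ->
  (forall x, a <= x <= b -> 0 < k x) -> f a < f b.
Proof.
move=> ab fk kp; have [c cab E] := MVT_cc (ltW ab) fk.
by rewrite -subr_gt0 E mulr_gt0 ?kp// subr_gt0.
Qed.

Lemma continuous_pos (f : R -> R) (s : R) : {for s, continuous f} -> 0 < f s ->
  exists2 d, 0 < d & forall z, `|z - s| < d -> 0 < f z.
Proof.
move=> cf fs; have f2 : 0 < f s / 2 by rewrite divr_gt0.
have [d d0 dP] := continuous_delta cf f2; exists d => // z /dP.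
by rewrite ler_norml => /andP[? _]; lra.
Qed.

(* Near [t0] the abscissa is a parameter, which turns the arc into a graph. *)
Lemma no_curved_param (Om : set (R * R)) (X Y dX dY ddX ddY : R -> R) (a b t0 : R) :
  convex_set2 Om ->
  (forall D : set (R * R), convex_set2 D ->
    (gauss_H1_integral (bdry D) <= gauss_H1_integral (bdry Om))%E) ->
  a < t0 < b ->
  (forall t, a < t < b -> [/\ is_derive t 1 X (dX t), is_derive t 1 Y (dY t),
      is_derive t 1 dX (ddX t) & is_derive t 1 dY (ddY t)]) ->
  {for t0, continuous ddX} -> {for t0, continuous ddY} ->
  (forall t, a < t < b -> bdry Om (X t, Y t)) ->
  0 < dX t0 -> dY t0 = 0 -> ~ 0 < dX t0 * ddY t0 - dY t0 * ddX t0.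
Proof.
move=> cOm Om_max t0ab der cddX cddY XY dX0 dY0 W0.
(* The numerator of the signed curvature. *)
pose W t := dX t * ddY t - dY t * ddX t.
have [dXt dYt ddXt ddYt] := der _ t0ab.
have cdX := is_derive_continuous ddXt; have cdY := is_derive_continuous ddYt.
have cW : {for t0, continuous W} by apply: cvgB; apply: cvgM.
have [d1 d10 d1P] := continuous_pos cdX dX0.
have [d2 d20 d2P] := continuous_pos cW W0.
case/andP: t0ab => at0 t0b.
have [r [r0 rd1 rd2 ra rb]] : exists r, [/\ 0 < r, r < d1, r < d2, a < t0 - r & t0 + r < b].
  exists (Num.min (Num.min d1 d2) (Num.min (t0 - a) (b - t0)) / 2).
  set mm := Num.min _ _.
  have m0 : 0 < mm by rewrite !lt_min d10 d20 !subr_gt0 at0.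
  have m1 : mm <= d1 by rewrite !ge_min lexx.
  have m2 : mm <= d2 by rewrite !ge_min lexx !orbT.
  have m3 : mm <= t0 - a by rewrite !ge_min lexx !orbT.
  have m4 : mm <= b - t0 by rewrite !ge_min lexx !orbT.
  by clear -m0 m1 m2 m3 m4 d10 d20; split; lra.
pose sl := t0 - r; pose sr := t0 + r.
have inr t : sl <= t <= sr -> [/\ a < t < b, 0 < dX t & 0 < W t].
  move=> tr; have tr' : `|t - t0| <= r.
    by move: tr; rewrite ler_norml /sl /sr => /andP[? ?]; apply/andP; split; lra.
  split; [|by apply: d1P; exact: le_lt_trans rd1|by apply: d2P; exact: le_lt_trans rd2].
  by move/andP: tr => [? ?]; rewrite (lt_le_trans ra)//= (le_lt_trans _ rb).
have Xincr s t : sl <= s -> s < t -> t <= sr -> X s < X t.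
  move=> ls st tr; apply: (MVT_incr (k := dX) st) => x /andP[sx xt].
    have [xab _ _] : [/\ a < x < b, 0 < dX x & 0 < W x].
      by apply: inr; rewrite (le_trans ls sx) (le_trans xt tr).
    by have [] := der _ xab.
  have [] // : [/\ a < x < b, 0 < dX x & 0 < W x].
  by apply: inr; rewrite (le_trans ls sx) (le_trans xt tr).
have slsr : sl < sr by rewrite /sl /sr; clear -r0; lra.
have Xsurj x : X sl < x < X sr -> exists2 t, sl < t < sr & X t = x.
  move=> /andP[xl xr]; have cX : {within `[sl, sr], continuous X}.
    apply: derivable_within_continuous => t; rewrite in_itv/= => /inr[tab _ _].
    by have [h _ _ _] := der _ tab; exact: ex_derive.
  have [|t] := IVT (ltW slsr) cX (v := x).
    by rewrite ge_min le_max (ltW xl) (ltW xr) orbT.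
  rewrite in_itv/= => /andP[lt tr] Xt; exists t => //.
  rewrite !lt_neqAle lt tr !andbT; apply/andP; split; apply/eqP => E.
    by move: xl; rewrite E Xt ltxx.
  by move: xr; rewrite -E Xt ltxx.
have [xi xiP] : exists xi : R -> R, forall x, X sl < x < X sr ->
    sl < xi x < sr /\ X (xi x) = x.
  (* The value 0 is a default outside the range of [X]. *)
  have ex x : exists t, X sl < x < X sr -> sl < t < sr /\ X t = x.
    have [/Xsurj[t tr Xt]|nx] := boolP (X sl < x < X sr); first by exists t.
    by exists 0.
  exists (fun x => projT1 (cid (ex x))) => x; exact: projT2 (cid (ex x)).
have Xin t : sl < t < sr -> X sl < X t < X sr.
  by move=> /andP[lt tr]; apply/andP; split; apply: Xincr => //; exact: ltW.
have xiK t : sl < t < sr -> xi (X t) = t.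
  move=> tr; have [/andP[xl xr] E] := xiP _ (Xin _ tr); move/andP: tr => [tl tr].
  apply/eqP; rewrite eq_le !leNgt; apply/andP; split; apply/negP => lt.
    by have := Xincr _ _ (ltW tl) lt (ltW xr); rewrite E ltxx.
  by have := Xincr _ _ (ltW xl) lt (ltW tr); rewrite E ltxx.
have inr' t : sl < t < sr -> [/\ a < t < b, 0 < dX t & 0 < W t].
  by move=> /andP[? ?]; apply: inr; rewrite !ltW.
have near_sr t (P : R -> Prop) : sl < t < sr -> (forall s, sl < s < sr -> P s) ->
    \forall s \near t, P s.
  move=> tr PP; have : \forall s \near t, s \in `]sl, sr[.
    by apply: near_in_itvoo; rewrite in_itv.
  by apply: filterS => s; rewrite in_itv/=; exact: PP.
have dxi x : X sl < x < X sr -> is_derive x 1 xi (dX (xi x))^-1.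
  move=> xx; have [tr E] := xiP _ xx; have [tab dXp _] := inr' _ tr.
  rewrite -{1}E; apply: (@is_derive_inverse _ X xi (dX (xi x))).
  - by apply: near_sr tr _ => s; exact: xiK.
  - apply: near_sr tr _ => s /inr'[sab _ _].
    by have [h _ _ _] := der _ sab; exact: is_derive_continuous h.
  - by have [] := der _ tab.
  - by rewrite gt_eqF.
pose f := Y \o xi; pose m t := dY t / dX t; pose f1 := m \o xi.
(* The slope has derivative [W / dX ^+ 2] in [t]; the last factor is the derivative of [xi]. *)
pose f2 x := W (xi x) / dX (xi x) ^+ 2 * (dX (xi x))^-1.
have df x : X sl < x < X sr -> is_derive x 1 f (f1 x).
  move=> xx; have [/inr'[tab _ _] E] := xiP _ xx; have [_ h _ _] := der _ tab.
  exact: is_derive_comp (dxi _ xx) h.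
have df1 x : X sl < x < X sr -> is_derive x 1 f1 (f2 x).
  move=> xx; have [/inr'[tab dXp _] E] := xiP _ xx; have [_ _ h1 h2] := der _ tab.
  apply: is_derive_comp (dxi _ xx) _.
  have dXn : dX (xi x) != 0 by rewrite gt_eqF.
  apply: (is_derive_eq (is_deriveM h2 (is_deriveV dXn h1))).
  by rewrite /GRing.scale/= /W; field.
have f2p x : X sl < x < X sr -> 0 < f2 x.
  move=> xx; have [/inr'[tab dXp Wp] E] := xiP _ xx.
  by rewrite mulr_gt0 ?invr_gt0// divr_gt0// exprn_gt0.
have t0r : sl < t0 < sr by rewrite /sl /sr; clear -r0; apply/andP; split; lra.
have x0in := Xin _ t0r.
apply: (@no_curved_graph _ Om f f1 (X sl) (X sr) (X t0) (f2 (X t0)) cOm df _ _ _ Om_max x0in) => //.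
- by move=> x /df1; exact: is_derive_continuous.
- move=> x y lx xy yr; apply: (MVT_incr xy (k := f2)) => z /andP[xz zy].
    by apply: df1; rewrite (lt_le_trans lx xz) (le_lt_trans zy yr).
  by apply: f2p; rewrite (lt_le_trans lx xz) (le_lt_trans zy yr).
- move=> x xx; have [/inr'[tab _ _] E] := xiP _ xx.
  by rewrite -{1}E /f /=; exact: XY.
- by rewrite /f1 /= xiK// /m dY0 mul0r.
- exact: df1.
- exact: f2p.
Qed.

(** If the cross product [cr] of velocity and acceleration is nonzero, rotating the unit tangent
    [(al, be)] to [(1, 0)] and reflecting according to the sign of [cr] gives positive curvature at
    a horizontal tangent. *)
Lemma no_curved_arc (Om : set (R * R)) (g1 g2 : R -> R) (a b t : R) :
  convex_set2 Om ->
  (forall D : set (R * R), convex_set2 D ->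
    (gauss_H1_integral (bdry D) <= gauss_H1_integral (bdry Om))%E) ->
  (forall t, a < t < b ->
    [/\ C2_at g1 t, C2_at g2 t & (derive1 g1 t, derive1 g2 t) != (0, 0)]) ->
  (forall t, a < t < b -> bdry Om (g1 t, g2 t)) ->
  a < t < b ->
  derive1 g1 t * derive1 (derive1 g2) t = derive1 g2 t * derive1 (derive1 g1) t.
Proof.
move=> cOm Om_max reg gb tab; apply/eqP; rewrite -subr_eq0; apply/negPn/negP => cr0.
set p := derive1 g1 t in cr0; set q := derive1 g2 t in cr0.
set cr := _ - _ in cr0.
have [[_ [_ c1]] [_ [_ c2]] pq] := reg _ tab.
pose V := Num.sqrt (p ^+ 2 + q ^+ 2).
have V0 : 0 < V.
  rewrite sqrtr_gt0 lt_neqAle addr_ge0 ?sqr_ge0// andbT eq_sym paddr_eq0 ?sqr_ge0//.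
  by rewrite !sqrf_eq0; apply: contra pq => /andP[/eqP p0 /eqP q0]; rewrite -/p -/q p0 q0.
have V2 : V ^+ 2 = p ^+ 2 + q ^+ 2 by rewrite sqr_sqrtr// addr_ge0 ?sqr_ge0.
have Vn : V != 0 by rewrite gt_eqF.
clearbody V.
pose al := p / V; pose be := q / V; pose sg := Num.sg cr.
have ab1 : al ^+ 2 + be ^+ 2 = 1.
  by rewrite /al /be !expr_div_n -mulrDl -V2 divff// expf_neq0.
have sg1 : sg ^+ 2 = 1 by rewrite sqr_sg cr0.
have dd s (h : R -> R) : C2_at h s -> is_derive s 1 h (derive1 h s) /\
    is_derive s 1 (derive1 h) (derive1 (derive1 h) s).
  by move=> [h1 [h2 _]]; split; rewrite derive1E; apply: DeriveDef.
pose X s := al * g1 s + be * g2 s; pose Y s := sg * (al * g2 s - be * g1 s).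
pose dX s := al * derive1 g1 s + be * derive1 g2 s.
pose dY s := sg * (al * derive1 g2 s - be * derive1 g1 s).
pose ddX s := al * derive1 (derive1 g1) s + be * derive1 (derive1 g2) s.
pose ddY s := sg * (al * derive1 (derive1 g2) s - be * derive1 (derive1 g1) s).
have lin (h k : R -> R) (u v s dh dk : R) : is_derive s 1 h dh -> is_derive s 1 k dk ->
    is_derive s 1 (fun s => u * h s + v * k s) (u * dh + v * dk).
  by move=> h1 h2; exact: is_deriveD (is_deriveZ u h1) (is_deriveZ v h2).
have lin' (h k : R -> R) (u v s dh dk : R) : is_derive s 1 h dh -> is_derive s 1 k dk ->
    is_derive s 1 (fun s => sg * (u * h s - v * k s)) (sg * (u * dh - v * dk)).
  move=> h1 h2.
  exact: (@is_deriveZ _ _ _ (fun s => u * h s - v * k s) sg s 1 _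
    (is_deriveB (is_deriveZ u h1) (is_deriveZ v h2))).
have dXE : dX t = V by rewrite /dX /al /be -/p -/q; apply: (mulIf Vn); rewrite -expr2 V2; field.
have dYE : dY t = 0 by rewrite /dY /al /be -/p -/q; field.
have WE : dX t * ddY t - dY t * ddX t = sg * cr.
  have aux (c u v w x : R) : V * (c * (u / V * v - w / V * x)) = c * (u * v - w * x) by field.
  by rewrite dYE mul0r subr0 dXE /ddY /al /be aux.
have cOm' : convex_set2 (orth al be sg @^-1` Om).
  by apply: convex_preimage cOm => x y u; exact: orth_comb.
have der s : a < s < b -> [/\ is_derive s 1 X (dX s), is_derive s 1 Y (dY s),
      is_derive s 1 dX (ddX s) & is_derive s 1 dY (ddY s)].
  move=> /reg[/dd[h1 h2] /dd[k1 k2] _].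
  by split; [exact: lin h1 k1|exact: lin' k1 h1|exact: lin h2 k2|exact: lin' k2 h2].
have cddX : {for t, continuous ddX}.
  by apply: cvgD; apply: cvgM; [exact: cvg_cst|exact: c1|exact: cvg_cst|exact: c2].
have cddY : {for t, continuous ddY}.
  apply: cvgM; first exact: cvg_cst.
  by apply: cvgB; apply: cvgM; [exact: cvg_cst|exact: c2|exact: cvg_cst|exact: c1].
have XYb s : a < s < b -> bdry (orth al be sg @^-1` Om) (X s, Y s).
  move=> /gb gbs; rewrite (bdry_preimage (orth_invK ab1 sg1) (orth_edist ab1 sg1)).
  change (bdry Om (orth al be sg (orth_inv al be sg (g1 s, g2 s)))).
  by rewrite orth_invK.
have dX0 : 0 < dX t by rewrite dXE.
apply: (no_curved_param cOm' (maximal_orth ab1 sg1 Om_max) tab der cddX cddY XYb dX0 dYE).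
by rewrite WE /sg -normrEsg normr_gt0.
Qed.

End curved_arcs.

(** * Flat arcs are straight segments *)

Section flat_arcs.
Context {R : realType}.

Lemma derive0_eq (f : R -> R) (a b s t : R) :
  (forall x, a < x < b -> is_derive x 1 f 0) -> a < s < b -> a < t < b -> f s = f t.
Proof.
move=> f0; wlog st : s t / s <= t => [hw sab tab|].
  by have [st|/ltW ts] := leP s t; [exact: hw|apply/esym; exact: hw].
move=> /andP[sa sb] /andP[ta tb].
have [|c _ /eqP] := @MVT_cc _ f (fun=> 0) s t st.
  by move=> x /andP[sx xt]; apply: f0; rewrite (lt_le_trans sa sx) (le_lt_trans xt tb).
by rewrite mul0r subr_eq0 => /eqP.
Qed.

(* With [D] the cross product of the tangents at [t0] and [t], flatness makes
   [D ^ 2 / |g'|^2] constant. *)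
Lemma flat_arc_collinear (g1 g2 : R -> R) (a b t0 : R) :
  (forall t, a < t < b ->
    [/\ C2_at g1 t, C2_at g2 t & (derive1 g1 t, derive1 g2 t) != (0, 0)]) ->
  (forall t, a < t < b ->
    derive1 g1 t * derive1 (derive1 g2) t = derive1 g2 t * derive1 (derive1 g1) t) ->
  a < t0 < b -> forall t, a < t < b ->
  derive1 g1 t0 * g2 t - derive1 g2 t0 * g1 t =
  derive1 g1 t0 * g2 t0 - derive1 g2 t0 * g1 t0.
Proof.
move=> reg flat t0ab t tab.
set p := derive1 g1 t0; set q := derive1 g2 t0.
have dd s (h : R -> R) : C2_at h s -> is_derive s 1 h (derive1 h s) /\
    is_derive s 1 (derive1 h) (derive1 (derive1 h) s).
  by move=> [h1 [h2 _]]; split; rewrite derive1E; apply: DeriveDef.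
pose D s := p * derive1 g2 s - q * derive1 g1 s.
pose n s := derive1 g1 s * derive1 g1 s + derive1 g2 s * derive1 g2 s.
have n0 s : a < s < b -> n s != 0.
  move=> /reg[_ _]; apply: contra; rewrite /n -!expr2 paddr_eq0 ?sqr_ge0// !sqrf_eq0.
  by move=> /andP[/eqP -> /eqP ->].
have dD s : a < s < b ->
    is_derive s 1 D (p * derive1 (derive1 g2) s - q * derive1 (derive1 g1) s).
  move=> /reg[/dd[_ h1] /dd[_ h2] _].
  exact: is_deriveB (is_deriveZ p h2) (is_deriveZ q h1).
have D0 s : a < s < b -> D s = 0.
  move=> sab; have Q0 : D s * D s / n s = D t0 * D t0 / n t0.
    apply: (@derive0_eq (fun s => D s * D s / n s) a b) => // x xab.
    have [/dd[_ h1] /dd[_ h2] _] := reg _ xab.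
    have dn := is_deriveD (is_deriveM h1 h1) (is_deriveM h2 h2).
    have dDx := dD _ xab; have nx := n0 _ xab; have fx := flat _ xab.
    apply: (is_derive_eq (is_deriveM (is_deriveM dDx dDx) (is_deriveV nx dn))).
    rewrite /GRing.scale/= -/(n x) -[(D * D) x]/(D x * D x).
    move: nx fx; rewrite /n /D; move: (derive1 (derive1 g1) x) (derive1 (derive1 g2) x).
    move: (derive1 g1 x) (derive1 g2 x) => u v u' v' nx fx.
    apply: (mulIf nx); apply: (mulIf nx); rewrite !mul0r.
    (* Up to a power of [n], the derivative of [D^2 / n] contains the flatness expression as a
       factor; dividing by [n] removes the effect of the speed. *)
    transitivity (2 * (p * v - q * u) * (p * u + q * v) * (u * v' - v * u')).
      by field.
    by rewrite fx subrr mulr0.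
  have : D t0 = 0 by rewrite /D -/p -/q mulrC subrr.
  move: Q0 => /[swap] ->; rewrite mul0r mul0r => /eqP.
  by rewrite mulf_eq0 invr_eq0 (negbTE (n0 _ sab)) orbF mulf_eq0 orbb => /eqP.
apply: (@derive0_eq (fun s => p * g2 s - q * g1 s) a b) => // x xab.
have [/dd[h1 _] /dd[h2 _] _] := reg _ xab; rewrite -(D0 _ xab).
exact: is_deriveB (is_deriveZ p h2) (is_deriveZ q h1).
Qed.

(** The arc is a connected subset of a line through [P], so its part in the smaller disc corresponds
    to an interval [J] of positions. The ends are [inf J] and [sup J]; they may or may not belong to
    the set, hence the open and the closed segment in the conclusion. *)
Lemma collinear_arc_segment (B : set (R * R)) (P : R * R) (delta p q c : R)
    (g1 g2 : R -> R) (I : set R) (a b : R) :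
  0 < delta -> B P -> (p, q) != (0, 0) ->
  (forall t, a < t < b -> I t) -> (forall t, I t -> a <= t < b) ->
  (forall t, I t -> {for t, continuous g1} /\ {for t, continuous g2}) ->
  (forall t, I t -> p * g2 t - q * g1 t = c) ->
  set_inj I (fun t => (g1 t, g2 t)) ->
  (fun t => (g1 t, g2 t)) @` I = disc P (2 * delta) `&` B ->
  exists a b : R * R, a != b /\ open_seg a b `<=` disc P delta `&` B /\
    disc P delta `&` B `<=` closed_seg a b.
Proof.
move=> d0 BP pq0 abI Iab cg col ginj gI.
pose N := p ^+ 2 + q ^+ 2.
have N0 : 0 < N.
  rewrite lt_neqAle addr_ge0 ?sqr_ge0// andbT eq_sym paddr_eq0 ?sqr_ge0//.
  by rewrite !sqrf_eq0; apply: contra pq0 => /andP[/eqP -> /eqP ->].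
have Nn : N != 0 by rewrite gt_eqF.
pose n := Num.sqrt N.
have n0 : 0 < n by rewrite sqrtr_gt0.
have n2 : n ^+ 2 = N by rewrite sqr_sqrtr// ltW.
(* [lam] parametrizes the line through [P] with direction [(p, q)]; [sig] is the coordinate of the
   orthogonal projection onto it. *)
pose lam s : R * R := (P.1 + s * p, P.2 + s * q).
pose sig (z : R * R) := (p * (z.1 - P.1) + q * (z.2 - P.2)) / N.
have sigl s : sig (lam s) = s by rewrite /sig /lam /= /N; field.
have dlam s : edist (lam s) P = `|s| * n.
  apply/eqP; rewrite -(eqrXn2 (n := 2))// ?mulr_ge0 ?euclidean_edist_ge0 ?(ltW n0)//.
  rewrite edist_sqr exprMn n2 real_normK ?num_real// /lam /N /=.
  by apply/eqP; ring.
pose S := disc P (2 * delta) `&` B.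
have SP : S P by split => //; rewrite /disc /= edistxx mulr_gt0.
have [tP IP gP] : exists2 t, I t & (g1 t, g2 t) = P.
  by move: SP; rewrite /S -gI => -[t It tP]; exists t.
have g1P : g1 tP = P.1 by rewrite -gP.
have g2P : g2 tP = P.2 by rewrite -gP.
have lams t : I t -> lam (sig (g1 t, g2 t)) = (g1 t, g2 t).
  move=> It; have := col _ It; rewrite -(col _ IP) g1P g2P => E.
  rewrite /lam /sig /=; congr (_, _); apply: (mulIf Nn); rewrite mulrDl mulrAC divfK// /N.
    transitivity (g1 t * (p ^+ 2 + q ^+ 2) + q * (p * g2 t - q * g1 t - (p * P.2 - q * P.1))); first by ring.
    by rewrite E subrr mulr0 addr0.
  transitivity (g2 t * (p ^+ 2 + q ^+ 2) - p * (p * g2 t - q * g1 t - (p * P.2 - q * P.1))); first by ring.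
  by rewrite E subrr mulr0 subr0.
have Sgam t : I t -> S (g1 t, g2 t) by move=> It; rewrite /S -gI; exists t.
have Slam z : S z -> lam (sig z) = z.
  by rewrite /S -gI => -[t It <-]; exact: lams.
have Iint s t x : I s -> I t -> s <= x -> x <= t -> I x.
  move=> Is It; rewrite le_eqVlt => /orP[/eqP <-//|sx] xt; apply: abI.
  have /andP[as_ _] := Iab _ Is; have /andP[_ tb] := Iab _ It.
  by rewrite (le_lt_trans as_ sx) (le_lt_trans xt tb).
have csig t : I t -> {for t, continuous (fun t => sig (g1 t, g2 t))}.
  move=> /cg[c1 c2]; apply: cvgM; last exact: cvg_cst.
  by apply: cvgD; apply: cvgM; try exact: cvg_cst; apply: cvgB => //; exact: cvg_cst.
(* The intermediate value theorem for [sig] along the curve: positions between two attained ones are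
   attained. *)
have Sconv x y v : S (lam x) -> S (lam y) -> x <= v -> v <= y -> S (lam v).
  move=> Sx Sy xv vy.
  have [s Is sE] : exists2 s, I s & sig (g1 s, g2 s) = x.
    by move: Sx; rewrite /S -gI => -[s Is E]; exists s => //; rewrite E sigl.
  have [t It tE] : exists2 t, I t & sig (g1 t, g2 t) = y.
    by move: Sy; rewrite /S -gI => -[t It E]; exists t => //; rewrite E sigl.
  have [w Iw <-] : exists2 w, I w & sig (g1 w, g2 w) = v.
    have cs u w : I u -> I w -> {within `[u, w], continuous (fun t => sig (g1 t, g2 t))}.
      move=> Iu Iw; apply: continuous_in_subspaceT => z; rewrite inE/= in_itv/= => /andP[uz zw].
      by apply: csig; exact: Iint uz zw.
    have [st|/ltW ts] := leP s t.
      have [|w] := IVT st (cs _ _ Is It) (v := v).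
        by rewrite sE tE ge_min le_max xv vy orbT.
      by rewrite in_itv/= => /andP[sw wt] wv; exists w => //; exact: Iint sw wt.
    have [|w] := IVT ts (cs _ _ It Is) (v := v).
      by rewrite sE tE ge_min le_max xv vy orbT.
    by rewrite in_itv/= => /andP[sw wt] wv; exists w => //; exact: Iint sw wt.
  by rewrite lams//; exact: Sgam.
pose J := [set s | S (lam s) /\ `|s| * n < delta].
have Jconv x y v : J x -> J y -> x <= v -> v <= y -> J v.
  move=> [Sx xd] [Sy yd] xv vy; split; first exact: Sconv xv vy.
  move: xd yd; rewrite -!ltr_pdivlMr// !ltr_norml => /andP[x1 _] /andP[_ y2].
  by rewrite (lt_le_trans x1 xv) (le_lt_trans vy y2).
have lam0 : lam 0 = P by rewrite /lam !mul0r !addr0 -surjective_pairing.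
have J0 : J 0 by split; rewrite ?lam0// normr0 mul0r.
(* A curve point just after [P] in the parameter: [I] has room on the right, and injectivity makes
   the point differ from [P]. The segment is therefore not degenerate. *)
have [s' Js' s'0] : exists2 s', J s' & s' != 0.
  have e0 : 0 < delta / (2 * n) by rewrite divr_gt0// mulr_gt0.
  have [d dd dP] := continuous_delta (csig _ IP) e0.
  have /andP[aP Pb] := Iab _ IP.
  pose t := tP + Num.min (d / 2) ((b - tP) / 2).
  have m0 : 0 < Num.min (d / 2) ((b - tP) / 2) by rewrite lt_min !divr_gt0// subr_gt0.
  have m1 : Num.min (d / 2) ((b - tP) / 2) <= d / 2 by rewrite ge_min lexx.
  have m2 : Num.min (d / 2) ((b - tP) / 2) <= (b - tP) / 2 by rewrite ge_min lexx orbT.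
  have tPt : tP < t by rewrite /t ltrDl.
  have It : I t by apply: abI; rewrite (le_lt_trans aP tPt)/= /t; clear -m2 Pb; lra.
  have td : `|t - tP| < d.
    by rewrite gtr0_norm ?subr_gt0// /t addrAC subrr add0r; clear -m1 dd; lra.
  have := dP _ td; rewrite gP -lam0 sigl subr0 => sd.
  exists (sig (g1 t, g2 t)).
    split; first by rewrite lams//; exact: Sgam.
    apply: (@le_lt_trans _ _ (delta / (2 * n) * n)); first by rewrite ler_wpM2r// ltW.
    rewrite (_ : delta / (2 * n) * n = delta / 2); last by field; rewrite gt_eqF.
    by clear -d0; lra.
  apply/eqP => sg0; have := lams _ It; rewrite sg0 lam0 -gP => E.
  by move: tPt; rewrite (ginj _ _ _ _ E) ?ltxx// inE.
have Jb x : J x -> `|x| <= delta / n by move=> [_ xd]; rewrite ler_pdivlMr// ltW.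
have Jne : J !=set0 by exists 0.
have Jub : has_ubound J by exists (delta / n) => x /Jb; apply: le_trans; exact: ler_norm.
have Jlb : has_lbound J.
  by exists (- (delta / n)) => x /Jb; rewrite ler_norml => /andP[].
have Jsup x : J x -> x <= sup J by move=> Jx; exact: ub_le_sup.
have Jinf x : J x -> inf J <= x by move=> Jx; exact: ge_inf.
have infsup : inf J < sup J.
  have [lt|gt] := ltP s' 0.
    by apply: (le_lt_trans (Jinf _ Js')); apply: (lt_le_trans lt); exact: Jsup.
  apply: (le_lt_trans (Jinf _ J0)); apply: lt_le_trans (Jsup _ Js').
  by rewrite lt_neqAle gt eq_sym s'0.
have lamcomb x y t : ((1 - t) * (lam x).1 + t * (lam y).1,
    (1 - t) * (lam x).2 + t * (lam y).2) = lam ((1 - t) * x + t * y).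
  by rewrite /lam /=; congr (_, _); ring.
exists (lam (inf J)), (lam (sup J)); split; last split.
- apply/eqP => E; have : inf J = sup J by rewrite -(sigl (inf J)) E sigl.
  by move=> e; rewrite e ltxx in infsup.
- move=> _ [t /= + <-]; rewrite in_itv/= => /andP[t0 t1]; rewrite lamcomb.
  have l1 : 0 < t * (sup J - inf J) by rewrite mulr_gt0// subr_gt0.
  have l2 : 0 < (1 - t) * (sup J - inf J) by rewrite mulr_gt0// subr_gt0.
  set v := _ + _.
  have v1 : inf J < v by rewrite /v; clear -l1; lra.
  have v2 : v < sup J by rewrite /v; clear -l2; lra.
  have [x Jx xv] : exists2 x, J x & x < v.
    have vi : 0 < v - inf J by rewrite subr_gt0.
    have [x Jx] := inf_adherent vi (conj Jne Jlb).
    by rewrite addrC subrK => xv; exists x.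
  have [y Jy vy] : exists2 y, J y & v < y.
    have vi : 0 < sup J - v by rewrite subr_gt0.
    have [y Jy] := sup_adherent vi (conj Jne Jub).
    by rewrite opprB addrC subrK => vy; exists y.
  have [[_ Bv] vd] := Jconv _ _ _ Jx Jy (ltW xv) (ltW vy).
  by split => //; rewrite /disc/= dlam.
- move=> z [zd Bz].
  have Sz : S z by split => //; apply: (lt_trans zd); clear -d0; lra.
  have zE := Slam _ Sz; have Jz : J (sig z) by split; rewrite ?zE// -dlam zE.
  have is0 : 0 < sup J - inf J by rewrite subr_gt0.
  exists ((sig z - inf J) / (sup J - inf J)).
    rewrite /= in_itv/= divr_ge0 ?subr_ge0 ?(Jinf _ Jz) ?(ltW infsup)//=.
    by rewrite ler_pdivrMr// mul1r lerD2r Jsup.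
  rewrite lamcomb -[RHS]zE; congr lam; field.
  by rewrite gt_eqF.
Qed.

End flat_arcs.

Theorem theorem1p1 (R : realType) (Om : set (R * R)) (P : R * R) (delta : R) :
  convex_set2 Om ->
  (forall D : set (R * R), convex_set2 D ->
     (gauss_perimeter D <= gauss_perimeter Om)%E) ->
  bdry Om P ->
  0 < delta ->
  C2_curve (disc P (2 * delta) `&` bdry Om) ->
  exists a b : R * R, a != b /\
    open_seg a b `<=` disc P delta `&` bdry Om /\
    disc P delta `&` bdry Om `<=` closed_seg a b.
Proof.
move=> cOm Om_max bP d0 [g1 [g2 [a [b [ab curve]]]]].
have GI_max (D : set (R * R)) : convex_set2 D ->
    (gauss_H1_integral (bdry D) <= gauss_H1_integral (bdry Om))%E.
  move=> /Om_max; rewrite /gauss_perimeter lee_pmul2l//.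
  by rewrite lte_fin invr_gt0 mulr_gt0// pi_gt0.
pose t0 := (a + b) / 2.
have t0ab : a < t0 < b by rewrite /t0; clear -ab; apply/andP; split; lra.
have C2c t (h : R -> R) : C2_at h t -> {for t, continuous h}.
  by move=> [h1 _]; exact/differentiable_continuous/derivable1_diffP.
(* [I] is []a, b[] for an open arc and [[a, b[] for a closed curve; the two cases share the interior
   argument. *)
suff main (I : set R) : (forall t, a < t < b -> I t) -> (forall t, I t -> a <= t < b) ->
    (forall t, I t ->
      [/\ C2_at g1 t, C2_at g2 t & (derive1 g1 t, derive1 g2 t) != (0, 0)]) ->
    set_inj I (fun t => (g1 t, g2 t)) ->
    (fun t => (g1 t, g2 t)) @` I = disc P (2 * delta) `&` bdry Om ->
    exists a b : R * R, a != b /\ open_seg a b `<=` disc P delta `&` bdry Om /\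
      disc P delta `&` bdry Om `<=` closed_seg a b.
  case: curve => [[reg [inj im]]|[reg [_ [inj im]]]].
    apply: (main `]a, b[%classic _ _ _ inj im) => t /=; rewrite in_itv/=.
    - by [].
    - by move=> /andP[ta tb]; rewrite ltW.
    - exact: reg.
  apply: (main `[a, b[%classic _ _ _ inj im) => t /=; rewrite in_itv/=.
  - by move=> /andP[ta tb]; rewrite ltW.
  - by [].
  - by move=> _; exact: reg.
move=> abI Iab reg inj im.
have reg' t : a < t < b ->
    [/\ C2_at g1 t, C2_at g2 t & (derive1 g1 t, derive1 g2 t) != (0, 0)].
  by move=> /abI; exact: reg.
have gb t : a < t < b -> bdry Om (g1 t, g2 t).
  move=> /abI It; have : (disc P (2 * delta) `&` bdry Om) (g1 t, g2 t).
    by rewrite -im; exists t.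
  by case.
have flat t : a < t < b ->
    derive1 g1 t * derive1 (derive1 g2) t = derive1 g2 t * derive1 (derive1 g1) t.
  exact: no_curved_arc cOm GI_max reg' gb.
have col := flat_arc_collinear reg' flat t0ab.
set p := derive1 g1 t0 in col; set q := derive1 g2 t0 in col.
pose h t := p * g2 t - q * g1 t.
have [_ _ pq0] := reg' _ t0ab.
apply: (@collinear_arc_segment _ _ _ _ p q (h t0) g1 g2 I a b d0 bP pq0 abI Iab) => //.
  by move=> t /reg[/C2c c1 /C2c c2 _].
move=> t It; have /andP[at_ tb] := Iab _ It.
(* Flatness is known on []a, b[] only; at the left end of [[a, b[] collinearity follows by
   continuity from the right. *)
move: at_; rewrite le_eqVlt => /orP[/eqP at_|at_]; last by apply: col; rewrite at_.
have ch : {for t, continuous h}.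
  have [/C2c c1 /C2c c2 _] := reg _ It.
  by apply: cvgB; apply: cvgM => //; exact: cvg_cst.
apply/eqP; rewrite -subr_eq0 -normr_le0; apply/ler_addgt0Pr => e e0; rewrite add0r.
have [d dd dP] := continuous_delta ch e0.
pose s := t + Num.min (d / 2) ((b - t) / 2).
have m0 : 0 < Num.min (d / 2) ((b - t) / 2) by rewrite lt_min !divr_gt0// subr_gt0.
have m1 : Num.min (d / 2) ((b - t) / 2) <= d / 2 by rewrite ge_min lexx.
have m2 : Num.min (d / 2) ((b - t) / 2) <= (b - t) / 2 by rewrite ge_min lexx orbT.
have sd : `|s - t| < d.
  by rewrite /s addrAC subrr add0r gtr0_norm//; clear -m1 dd; lra.
have sab : a < s < b by rewrite at_ /s; clear -m0 m2 tb; apply/andP; split; lra.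
have -> : h t0 = h s by apply/esym; exact: col.
by rewrite distrC; exact: dP.
Qed.
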